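(* Let $\varphi\colon A\to B$ be a surjective map of local rings in $\mathrm{C}_{\mathcal O}(c)$. For any finitely generated $B$-module $M$ with $\operatorname{depth}_BM\ge c$, one has an isomorphism of $\mathcal O$-modules $$\Psi_A(M)\cong\Psi_B(M).$$ Thus $\delta_A(M)\ge\delta_B(M)$, with equality if and only if $\operatorname{length}_{\mathcal O}\Phi_A=\operatorname{length}_{\mathcal O}\Phi_B$.
   Context: $\mathcal O$ is a discrete valuation ring with uniformizer $\varpi$. For a finitely generated $\mathcal O$-module $U$, $\operatorname{tors}(U)$ is its torsion submodule and $U^{\mathrm{tf}}:=U/\operatorname{tors}(U)$. $\mathrm{C}_{\mathcal O}(c)$ is the category of pairs $(A,\lambda_A)$ where $A$ is a complete noetherian local $\mathcal O$-algebra and $\lambda_A\colon A\to\mathcal O$ is a surjective map of $\mathcal O$-algebras such that, with $\mathfrak p_A:=\operatorname{Ker}\lambda_A$, the local ring $A_{\mathfrak p_A}$ is regular of Krull dimension $c$. Morphisms are local $\mathcal O$-algebra maps $\varphi\colon A\to B$ with $\lambda_B\varphi=\lambda_A$. $\mathcal O$ is an $A$-module via $\lambda_A$. For a finitely generated $A$-module $M$, the natural map $M\to M/\mathfrak p_AM$ induces a map of $\mathcal O$-modules $\operatorname{Ext}^c_A(\mathcal O,M)^{\mathrm{tf}}\to \operatorname{Ext}^c_A(\mathcal O,M/\mathfrak p_AM)^{\mathrm{tf}}$; its cokernel is the congruence module $\Psi_A(M)$ (of finite length over $\mathcal O$). Put $\Phi_A:=\operatorname{tors}(\mathfrak p_A/\mathfrak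 p_A^2)$. The Wiles defect is $$\delta_A(M):=(\operatorname{rank}_{A_{\mathfrak p_A}}M_{\mathfrak p_A})\cdot\operatorname{length}_{\mathcal O}\Phi_A-\operatorname{length}_{\mathcal O}\Psi_A(M),$$ where the rank of a finitely generated module over the regular local domain $A_{\mathfrak p_A}$ is its dimension after passing to the fraction field. The same definitions apply to $B$; a $B$-module is viewed as an $A$-module via $\varphi$.
   Formalization: The criterion for equality of the Wiles defects is stated only when M has positive rank at the augmentation prime of B; for rank zero both defects always agree, so the criterion as written fails whenever the lengths of Φ_A and Φ_B differ. *)

(* Defs.v *)
From HB Require Import structures.
From mathcomp Require Import all_boot all_order all_algebra.
From mathcomp Require Import ring boolp classical_sets.

Set Implicit Arguments.
Unset Strict Implicit.
Unset Printing Implicit Defensive.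

Import GRing.Theory.
Local Open Scope ring_scope.
Local Open Scope quotient_scope.

(* Submodules and ideals are boolean predicates; Prop-valued conditions are
   turned into predicates by the classical [< _ >] of boolp.  An ideal of a
   commutative ring R is a submodule of the regular module R^o. *)
Section Submodules.
Variables (R : pzRingType) (V : lmodType R).

Definition span (S : {pred V}) : {pred V} :=
  [pred v | `[< exists n (a : 'I_n -> R) (s : 'I_n -> V),
                  (forall i, s i \in S) /\ v = \sum_i a i *: s i >]].

Fact span_submod S : submod_closed (span S).
Proof.
split; first by apply/asboolP; exists 0, (fun=> 0), (fun=> 0); split=> [[]|] //;
  rewrite big_ord0.
move=> c _ _ /asboolP[n [a [s [Ss ->]]]] /asboolP[m [b [t [St ->]]]].
apply/asboolP; exists (n + m)%N.
exists (fun i => match fintype.split i with inl j => c * a j | inr j => b j end).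
exists (fun i => match fintype.split i with inl j => s j | inr j => t j end).
split=> [i|]; first by case: (fintype.split i).
rewrite big_split_ord /= scaler_sumr; congr (_ + _); apply: eq_bigr => i _.
  by rewrite (unsplitK (inl i)) scalerA.
by rewrite (unsplitK (inr i)).
Qed.
HB.instance Definition _ S :=
  GRing.isSubmodClosed.Build R V (span S) (span_submod S).

(* I N, the submodule generated by the products a *: n. *)
Definition smul (I : {pred R}) (N : {pred V}) : {pred V} :=
  span [pred v | `[< exists a n, [/\ a \in I, n \in N & v = a *: n] >]].
HB.instance Definition _ I N := GRing.SubmodClosed.on (smul I N).

Definition fin_gen (N : {pred V}) : Prop := exists s : seq V, N =i span (mem s).

End Submodules.

Definition fin_gen_module (R : pzRingType) (M : lmodType R) : Prop :=
  @fin_gen R M predT.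

Section KerIm.
Variables (R : pzRingType) (U V : lmodType R) (f : {linear U -> V}).

Definition kerl : {pred U} := [pred u | f u == 0].
Definition imgl : {pred V} := [pred v | `[< exists u, f u = v >]].

Fact kerl_submod : submod_closed kerl.
Proof.
by split=> [|a u v /eqP fu /eqP fv]; rewrite !inE ?linear0 // linearP fu fv
  scaler0 addr0.
Qed.
HB.instance Definition _ := GRing.isSubmodClosed.Build R U kerl kerl_submod.

Fact imgl_submod : submod_closed imgl.
Proof.
split=> [|a _ _ /asboolP[u <-] /asboolP[v <-]]; apply/asboolP.
  by exists 0; rewrite linear0.
by exists (a *: u + v); rewrite linearP.
Qed.
HB.instance Definition _ := GRing.isSubmodClosed.Build R V imgl imgl_submod.
End KerIm.

Section SubType.
Variables (R : pzRingType) (V : lmodType R) (S : submodClosed V).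
Definition submod : Type := {v : V | v \in S}.
HB.instance Definition _ := SubChoice.on submod.
HB.instance Definition _ := [SubChoice_isSubLmodule of submod by <:].
End SubType.

Section QuotMod.
Variables (R : pzRingType) (V : lmodType R) (S : submodClosed V).
(* submodClosed does not inherit from zmodClosed in ssralg, while the quotient of
   ring_quotient is taken by a zmodClosed predicate. *)
Definition zmod_pred : {pred V} := S.
HB.instance Definition _ :=
  GRing.isZmodClosed.Build V zmod_pred (GRing.submod_closedB (submodClosedP S)).
Definition quotmod : Type := Quotient.quot zmod_pred.
HB.instance Definition _ := GRing.Zmodule.on quotmod.

Definition quotmod_pi (v : V) : quotmod := \pi_(Quotient.quot zmod_pred) v.
Definition quotmod_repr (x : quotmod) : V := repr (x : Quotient.quot zmod_pred).

Lemma quotmod_reprK : cancel quotmod_repr quotmod_pi.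
Proof. exact: reprK. Qed.

Lemma quotmod_eq u v : quotmod_pi u = quotmod_pi v <-> u - v \in S.
Proof.
have -> : (u - v \in S) = (u - v \in (zmod_pred : zmodClosed V)) by [].
by rewrite Quotient.idealrBE; split=> /eqP.
Qed.

Fact quotmod_piB u v : quotmod_pi (u - v) = quotmod_pi u - quotmod_pi v.
Proof. by rewrite /quotmod_pi !piE. Qed.
HB.instance Definition _ :=
  GRing.isZmodMorphism.Build V quotmod quotmod_pi quotmod_piB.

Definition quotmod_scale (a : R) (x : quotmod) := quotmod_pi (a *: quotmod_repr x).

Lemma quotmod_scaleE a v : quotmod_scale a (quotmod_pi v) = quotmod_pi (a *: v).
Proof.
apply/quotmod_eq; rewrite -scalerBr rpredZ //.
by apply/quotmod_eq; rewrite quotmod_reprK.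
Qed.

Fact quotmod_scaleA a b x :
  quotmod_scale a (quotmod_scale b x) = quotmod_scale (a * b) x.
Proof. by rewrite -(quotmod_reprK x) !quotmod_scaleE scalerA. Qed.
Fact quotmod_scale1 : left_id 1 quotmod_scale.
Proof. by move=> x; rewrite -(quotmod_reprK x) !quotmod_scaleE scale1r. Qed.
Fact quotmod_scaleDr : right_distributive quotmod_scale +%R.
Proof.
move=> a x y; rewrite -(quotmod_reprK x) -(quotmod_reprK y) -raddfD.
by rewrite !quotmod_scaleE scalerDr raddfD.
Qed.
Fact quotmod_scaleDl x : {morph quotmod_scale^~ x : a b / a + b}.
Proof.
by move=> a b; rewrite -(quotmod_reprK x) !quotmod_scaleE scalerDl raddfD.
Qed.
HB.instance Definition _ := GRing.Zmodule_isLmodule.Build R quotmod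
  quotmod_scaleA quotmod_scale1 quotmod_scaleDr quotmod_scaleDl.

Fact quotmod_piZ : scalable quotmod_pi.
Proof. by move=> a v; rewrite -quotmod_scaleE. Qed.
HB.instance Definition _ :=
  GRing.isScalable.Build R V quotmod *:%R quotmod_pi quotmod_piZ.
End QuotMod.
Arguments quotmod_pi {R V} S v.

Section Induced.
Variables (R : pzRingType) (U V : lmodType R) (f : {linear U -> V}).
Variables (S : submodClosed U) (T : submodClosed V).
Hypothesis fST : forall u, u \in S -> f u \in T.

Definition sub_map (u : submod S) : submod T := exist _ (f (val u)) (fST (valP u)).
Fact sub_map_linear : linear sub_map.
Proof. by move=> a u v; apply: val_inj; rewrite /= linearP. Qed.
HB.instance Definition _ :=
  GRing.isLinear.Build R (submod S) (submod T) *:%R sub_map sub_map_linear.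

#[using="All"] Definition quot_map (x : quotmod S) : quotmod T := quotmod_pi T (f (quotmod_repr x)).
Lemma quot_mapE u : quot_map (quotmod_pi S u) = quotmod_pi T (f u).
Proof.
apply/quotmod_eq; rewrite -raddfB fST //.
by apply/quotmod_eq; rewrite quotmod_reprK.
Qed.
Fact quot_map_linear : linear quot_map.
Proof.
move=> a x y; rewrite -(quotmod_reprK x) -(quotmod_reprK y) -linearP.
by rewrite !quot_mapE !linearP.
Qed.
HB.instance Definition _ :=
  GRing.isLinear.Build R (quotmod S) (quotmod T) *:%R quot_map quot_map_linear.
End Induced.
Arguments sub_map {R U V} f {S T} fST.
Arguments quot_map {R U V} f {S T} fST.

Section SubQuot.
Variables (R : pzRingType) (V : lmodType R) (Z B : submodClosed V).
Definition in_sub : {pred submod Z} := [pred z | val z \in B].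
Fact in_sub_submod : submod_closed in_sub.
Proof.
by split=> [|a u v]; rewrite !inE ?raddf0 ?rpred0 // => uB vB;
  rewrite linearP rpredD ?rpredZ.
Qed.
HB.instance Definition _ :=
  GRing.isSubmodClosed.Build R (submod Z) in_sub in_sub_submod.
(* The subquotient Z / (Z :&: B); it is used only for B included in Z. *)
Definition subquot := quotmod in_sub.
HB.instance Definition _ := GRing.Lmodule.on subquot.
End SubQuot.
Arguments in_sub {R V} Z B.

Section SubQuotMap.
Variables (R : pzRingType) (U V : lmodType R) (f : {linear U -> V}).
Variables (Z B : submodClosed U) (Z' B' : submodClosed V).
Hypotheses (fZ : forall u, u \in Z -> f u \in Z').
Hypotheses (fB : forall u, u \in B -> f u \in B').
Fact subquot_map_subproof u : u \in in_sub Z B -> sub_map f fZ u \in in_sub Z' B'.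
Proof. exact: fB. Qed.
Definition subquot_map : subquot Z B -> subquot Z' B' :=
  quot_map (sub_map f fZ) subquot_map_subproof.
HB.instance Definition _ := GRing.Linear.on subquot_map.
End SubQuotMap.

Definition isomorphic (R : pzRingType) (U V : lmodType R) : Prop :=
  exists f : {linear U -> V}, bijective f.

Section Restr.
Variables (R S : pzRingType) (f : {rmorphism R -> S}).
(* Restriction of scalars along f.  The carrier does not depend on f; f is kept as
   a parameter so that the R-module structure can be inferred. *)
#[using="f"] Definition restr (M : lmodType S) : Type := M.
Variable M : lmodType S.
HB.instance Definition _ := GRing.Zmodule.on (restr M).
Definition restr_scale (a : R) (m : restr M) : restr M := f a *: (m : M).
Fact restr_scaleA a b x : restr_scale a (restr_scale b x) = restr_scale (a * b) x.
Proof. by rewrite /restr_scale scalerA rmorphM. Qed.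
Fact restr_scale1 : left_id 1 restr_scale.
Proof. by move=> x; rewrite /restr_scale rmorph1 scale1r. Qed.
Fact restr_scaleDr : right_distributive restr_scale +%R.
Proof. by move=> a x y; rewrite /restr_scale scalerDr. Qed.
Fact restr_scaleDl x : {morph restr_scale^~ x : a b / a + b}.
Proof. by move=> a b; rewrite /restr_scale rmorphD scalerDl. Qed.
HB.instance Definition _ := GRing.Zmodule_isLmodule.Build R (restr M)
  restr_scaleA restr_scale1 restr_scaleDr restr_scaleDl.
End Restr.

Section RestrMap.
Variables (R S : pzRingType) (f : {rmorphism R -> S}) (M N : lmodType S).
Definition restr_map (g : {linear M -> N}) : restr f M -> restr f N := g.
Variable g : {linear M -> N}.
Fact restr_map_linear : linear (restr_map g).
Proof. by move=> a u v; rewrite /restr_map [LHS]linearP. Qed.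
HB.instance Definition _ := GRing.isLinear.Build R (restr f M) (restr f N) *:%R
  (restr_map g) restr_map_linear.
End RestrMap.
Arguments restr_map {R S} f {M N} g.

Section Chains.
Variables (T : Type) (P : {pred T} -> Prop).

(* C 0 < C 1 < ... < C n, strictly increasing for inclusion. *)
Definition has_chain (n : nat) : Prop :=
  exists C : nat -> {pred T},
    (forall i, (i <= n)%N -> P (C i)) /\
    (forall i, (i < n)%N ->
       {subset C i <= C i.+1} /\ exists2 x, x \in C i.+1 & x \notin C i).

Definition max_chain (n : nat) : Prop :=
  has_chain n /\ forall k, has_chain k -> (k <= n)%N.
End Chains.

(* The length of a module of finite length, and 0 for any other module. *)
Definition mlength (R : pzRingType) (U : lmodType R) : nat :=
  xget 0%N [set n | max_chain (@submod_closed R U) n]%classic.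

Section Rings.
Variable R : comPzRingType.

Definition invertible (x : R) : Prop := exists y, x * y = 1.

Definition nonunits : {pred R^o} := [pred x | `[< ~ invertible x >]].

(* If the nonunits form an ideal, it is the unique maximal ideal; as it contains 0,
   the ring is nonzero. *)
Definition local_ring : Prop := submod_closed nonunits.

Definition noetherian : Prop :=
  forall I : {pred R^o}, submod_closed I -> fin_gen I.

Definition prime_ideal (P : {pred R^o}) : Prop :=
  [/\ submod_closed P, 1 \notin P &
      forall x y : R, x * y \in P -> x \in P \/ y \in P].

Definition krull_dim (n : nat) : Prop := max_chain prime_ideal n.

(* A noetherian local ring of Krull dimension n whose maximal ideal is generated
   by n elements. *)
Definition regular_local_ring (n : nat) : Prop :=
  [/\ noetherian, local_ring, krull_dim n &
      exists s : seq R^o, size s = n /\ nonunits =i span (mem s)].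

Fixpoint idealX (I : {pred R^o}) (n : nat) : {pred R^o} :=
  if n is n'.+1 then smul I (idealX I n') else predT.

(* Completeness for the topology of the maximal ideal: separation and convergence of
   Cauchy sequences, that is, bijectivity of R -> lim R / m^n. *)
Definition complete_local : Prop :=
  (forall x, (forall n, x \in idealX nonunits n) -> x = 0) /\
  (forall u : nat -> R^o, (forall n, u n.+1 - u n \in idealX nonunits n) ->
     exists l, forall n, l - u n \in idealX nonunits n).

Section Depth.
Variable M : lmodType R.

(* s`_i is a non-zero-divisor on M / (s`_0, ..., s`_(i-1)) M, and M <> (s) M. *)
Definition regular_sequence (s : seq R) : Prop :=
  (forall i, (i < size s)%N -> forall m : M,
     s`_i *: m \in smul (mem (take i s)) predT -> m \in smul (mem (take i s)) predT)
  /\ exists m : M, m \notin smul (mem s) predT.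

(* depth M >= n, with the convention that the zero module has infinite depth. *)
Definition depth_ge (n : nat) : Prop :=
  (forall m : M, m = 0) \/
  exists s : seq R, [/\ (n <= size s)%N, {subset s <= nonunits} &
                        regular_sequence s].
End Depth.
End Rings.

Arguments nonunits R : clear implicits.

(* A local principal ideal domain that is not a field. *)
Definition dvr (O : idomainType) : Prop :=
  [/\ local_ring O, exists2 x : O, x != 0 & ~ invertible x &
      forall I : {pred O^o}, submod_closed I -> exists a, I =i span (pred1 a)].

Definition uniformizer (O : idomainType) (w : O) : Prop :=
  nonunits O =i span (pred1 (w : O^o)).

(* The localizations S^-1 M and S^-1 R; S may contain 0, and then they vanish. *)
Section Localization.
Variables (R : comPzRingType) (S : mulrClosed R).

Definition dens : Type := {s : R | s \in S}.
HB.instance Definition _ := Choice.on dens.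
Definition den (s : dens) : R := sval s.
Lemma den_in s : den s \in S. Proof. exact: (valP s). Qed.
Definition den_mul (s t : dens) : dens :=
  exist _ (den s * den t) (rpredM (den_in s) (den_in t)).
Definition den_one : dens := exist _ 1 (rpred1 S).
Lemma denE : (forall s t, den (den_mul s t) = den s * den t) * (den den_one = 1).
Proof. by []. Qed.
Arguments den : simpl never.

Section LocMod.
Variable M : lmodType R.
Let frac := (M * dens)%type.

Definition loc_equiv : rel frac := fun x y =>
  `[< exists2 t, t \in S & t *: (den y.2 *: x.1) = t *: (den x.2 *: y.1) >].

Fact loc_equiv_is_equiv : equiv_class_of loc_equiv.
Proof.
split=> [x|x y|y x z].
- by apply/asboolP; exists 1; rewrite ?rpred1.
- by apply/asboolP/asboolP=> -[t St E]; exists t.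
case/asboolP=> t St E1 /asboolP[u Su E2]; apply/asboolP.
exists (t * u * den y.2); first by rewrite !rpredM // den_in.
transitivity ((u * den z.2) *: (t *: (den y.2 *: x.1))).
  by rewrite !scalerA; congr (_ *: _); ring.
transitivity ((t * den x.2) *: (u *: (den z.2 *: y.1))).
  by rewrite E1 !scalerA; congr (_ *: _); ring.
by rewrite E2 !scalerA; congr (_ *: _); ring.
Qed.
Canonical loc_equiv_rel := EquivRelPack loc_equiv_is_equiv.
Canonical loc_encModRel := defaultEncModRel loc_equiv.

Definition loc : Type := {eq_quot loc_equiv}.
HB.instance Definition _ := Choice.on loc.

Definition lfrac (m : M) (s : dens) : loc :=
  \pi_({eq_quot loc_equiv}) (m, s).

Lemma lfrac_eq m s n t : lfrac m s = lfrac n t <->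
  exists2 u, u \in S & u *: (den t *: m) = u *: (den s *: n).
Proof.
split=> [/eqmodP/asboolP[u Su E]|[u Su E]]; first by exists u.
by apply/eqmodP/asboolP; exists u.
Qed.

Definition lrep (x : loc) : frac := repr (x : {eq_quot loc_equiv}).

Lemma lrepK x : lfrac (lrep x).1 (lrep x).2 = x.
Proof. by rewrite /lfrac -surjective_pairing /lrep reprK. Qed.

Lemma locP (P : loc -> Prop) : (forall m s, P (lfrac m s)) -> forall x, P x.
Proof. by move=> H x; rewrite -(lrepK x). Qed.

Lemma lrep_lfrac m s : exists2 u, u \in S &
  u *: (den (lrep (lfrac m s)).2 *: m) = u *: (den s *: (lrep (lfrac m s)).1).
Proof. by apply/lfrac_eq; rewrite lrepK. Qed.

Definition loc_add (x y : loc) : loc :=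
  lfrac (den (lrep y).2 *: (lrep x).1 + den (lrep x).2 *: (lrep y).1)
        (den_mul (lrep x).2 (lrep y).2).
Definition loc_opp (x : loc) : loc := lfrac (- (lrep x).1) (lrep x).2.
Definition loc_zero : loc := lfrac 0 den_one.

Lemma loc_addE m s n t :
  loc_add (lfrac m s) (lfrac n t) = lfrac (den t *: m + den s *: n) (den_mul s t).
Proof.
have [u Su E1] := lrep_lfrac m s; have [v Sv E2] := lrep_lfrac n t.
rewrite /loc_add; set x := lrep _ in E1 *; set y := lrep _ in E2 *.
apply/lfrac_eq; exists (u * v); first exact: rpredM.
rewrite ?denE /= !scalerDr; congr (_ + _).
  transitivity ((v * den t * den y.2) *: (u *: (den s *: x.1))).
    by rewrite !scalerA; congr (_ *: _); ring.
  by rewrite -E1 !scalerA; congr (_ *: _); ring.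
transitivity ((u * den s * den x.2) *: (v *: (den t *: y.1))).
  by rewrite !scalerA; congr (_ *: _); ring.
by rewrite -E2 !scalerA; congr (_ *: _); ring.
Qed.

Lemma loc_oppE m s : loc_opp (lfrac m s) = lfrac (- m) s.
Proof.
have [u Su E] := lrep_lfrac m s; apply/lfrac_eq; exists u => //.
by rewrite !scalerN E.
Qed.

Fact loc_addA : associative loc_add.
Proof.
elim/locP=> m s; elim/locP=> n t; elim/locP=> p u; rewrite !loc_addE.
apply/lfrac_eq; exists 1; rewrite ?rpred1 ?denE //= !scalerDr !scalerA addrA.
by congr (_ *: _ + _ *: _ + _ *: _); ring.
Qed.
Fact loc_addC : commutative loc_add.
Proof.
elim/locP=> m s; elim/locP=> n t; rewrite !loc_addE.
apply/lfrac_eq; exists 1; rewrite ?rpred1 ?denE //= addrC !scalerDr !scalerA.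
by congr (_ *: _ + _ *: _); ring.
Qed.
Fact loc_add0 : left_id loc_zero loc_add.
Proof.
elim/locP=> m s; rewrite loc_addE scaler0 add0r.
by apply/lfrac_eq; exists 1; rewrite ?rpred1 ?denE //= !scalerA; congr (_ *: _); ring.
Qed.
Fact loc_addN : left_inverse loc_zero loc_opp loc_add.
Proof.
elim/locP=> m s; rewrite loc_oppE loc_addE scalerN addNr.
by apply/lfrac_eq; exists 1; rewrite ?rpred1 ?denE //= !scaler0.
Qed.
HB.instance Definition _ :=
  GRing.isZmodule.Build loc loc_addA loc_addC loc_add0 loc_addN.

Lemma lfracD m s n t :
  lfrac m s + lfrac n t = lfrac (den t *: m + den s *: n) (den_mul s t).
Proof. exact: loc_addE. Qed.
End LocMod.

Definition loc_ring : Type := loc R^o.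
HB.instance Definition _ := GRing.Zmodule.on loc_ring.

Section LocScale.
Variable M : lmodType R.

Definition loc_scale (a : loc_ring) (x : loc M) : loc M :=
  lfrac (((lrep a).1 : R) *: (lrep x).1) (den_mul (lrep a).2 (lrep x).2).

Lemma loc_scaleE (a : R^o) s m t :
  loc_scale (lfrac a s) (lfrac m t) = lfrac ((a : R) *: m) (den_mul s t).
Proof.
have [u Su E1] := lrep_lfrac a s; have [v Sv E2] := lrep_lfrac m t.
rewrite /loc_scale; set x := lrep _ in E1 *; set y := lrep _ in E2 *.
apply/lfrac_eq; exists (u * v); first exact: rpredM.
have {}E1 : u * (den x.2 * a) = u * (den s * x.1) by exact: E1.
transitivity ((u * (den s * x.1)) *: (v *: (den t *: y.1))).
  by rewrite ?denE /= !scalerA; congr (_ *: _); ring.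
by rewrite -E1 -E2 ?denE /= !scalerA; congr (_ *: _); ring.
Qed.
End LocScale.

Section LocRing.
Definition loc_one : loc_ring := lfrac (1 : R^o) den_one.
Definition loc_mul (a b : loc_ring) : loc_ring := loc_scale a b.

Lemma loc_scaleA (M : lmodType R) (a b : loc_ring) (x : loc M) :
  loc_scale a (loc_scale b x) = loc_scale (loc_mul a b) x.
Proof.
elim/locP: a => a s; elim/locP: b => b t; elim/locP: x => m u.
rewrite /loc_mul (loc_scaleE b t m u) (loc_scaleE a s b t) !loc_scaleE.
apply/lfrac_eq; exists 1; rewrite ?rpred1 ?denE //.
have -> : (a : R) *: (b : R^o) = (a : R) * b by [].
by rewrite ?denE /= !scalerA; congr (_ *: _); ring.
Qed.
Lemma loc_scale1 (M : lmodType R) (x : loc M) : loc_scale loc_one x = x.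
Proof.
elim/locP: x => m u; rewrite loc_scaleE scale1r.
by apply/lfrac_eq; exists 1; rewrite ?rpred1 ?denE //= !scalerA; congr (_ *: _); ring.
Qed.
Lemma loc_scaleDr (M : lmodType R) (a : loc_ring) (x y : loc M) :
  loc_scale a (x + y) = loc_scale a x + loc_scale a y.
Proof.
elim/locP: a => a s; elim/locP: x => m t; elim/locP: y => n u.
rewrite lfracD (loc_scaleE a s m t) (loc_scaleE a s n u) loc_scaleE lfracD.
apply/lfrac_eq; exists 1; rewrite ?rpred1 ?denE //=.
by rewrite !scalerDr !scalerA; congr (_ *: _ + _ *: _); ring.
Qed.
Lemma loc_scaleDl (M : lmodType R) (x : loc M) (a b : loc_ring) :
  loc_scale (a + b) x = loc_scale a x + loc_scale b x.
Proof.
elim/locP: a => a s; elim/locP: b => b t; elim/locP: x => m u.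
rewrite lfracD (loc_scaleE a s m u) (loc_scaleE b t m u) loc_scaleE lfracD.
apply/lfrac_eq; exists 1; rewrite ?rpred1 ?denE //=.
have -> : (den t *: (a : R^o) + den s *: (b : R^o) : R) = den t * a + den s * b by [].
by rewrite !scalerDr !scalerA -scalerDl; congr (_ *: _); ring.
Qed.
Lemma loc_mulC : commutative loc_mul.
Proof.
elim/locP=> a s; elim/locP=> b t; rewrite /loc_mul (loc_scaleE a s b t) (loc_scaleE b t a s).
apply/lfrac_eq; exists 1; rewrite ?rpred1 ?denE //=; congr (_ *: _).
by change (den t * den s * (a * b) = den s * den t * (b * a) :> R); ring.
Qed.
HB.instance Definition _ := GRing.Zmodule_isComPzRing.Build loc_ring
  (fun a b c => loc_scaleA a b c) loc_mulC (fun a => loc_scale1 a)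
  (fun a b c => loc_scaleDl c a b).
End LocRing.

HB.instance Definition _ (M : lmodType R) :=
  GRing.Zmodule_isLmodule.Build loc_ring (loc M)
    (@loc_scaleA M) (@loc_scale1 M) (@loc_scaleDr M) (@loc_scaleDl M).
End Localization.

Section TotalFractions.
Variable R : comPzRingType.
Definition non_zero_divisors : {pred R} :=
  [pred x | `[< forall y : R, x * y = 0 -> y = 0 >]].
Fact non_zero_divisors_mulr_closed : mulr_closed non_zero_divisors.
Proof.
split=> [|x y /asboolP xP /asboolP yP]; apply/asboolP => z; first by rewrite mul1r.
by rewrite -mulrA => /xP/yP.
Qed.
HB.instance Definition _ := GRing.isMulClosed.Build R non_zero_divisors
  non_zero_divisors_mulr_closed.
End TotalFractions.

Definition has_basis (K : pzRingType) (V : lmodType K) (n : nat) : Prop :=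
  exists e : 'I_n -> V,
    (forall v, exists a : 'I_n -> K, v = \sum_i a i *: e i) /\
    (forall a : 'I_n -> K, \sum_i a i *: e i = 0 -> forall i, a i = 0).

(* Over a domain the non-zero-divisors are the nonzero elements, so that this is the
   dimension of N tensored with the fraction field (for N finitely generated). *)
Definition generic_rank (R : comPzRingType) (N : lmodType R) : nat :=
  xget 0%N [set n | has_basis (loc (@non_zero_divisors R) N) n]%classic.

(* ... -> A^(r 1) -> A^(r 0) -> N -> 0 exact, matrices acting on the right of row
   vectors.  Over a noetherian ring every finitely generated module has such a
   resolution, see free_resolution_exists. *)
Record free_resolution (A : pzRingType) (N : lmodType A) := FreeResolution {
  fr_rank : nat -> nat;
  fr_diff : forall i, 'M[A]_(fr_rank i.+1, fr_rank i);
  fr_aug : {linear 'rV[A]_(fr_rank 0) -> N};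
  fr_aug_surj : forall x, exists v, fr_aug v = x;
  fr_exact0 : forall v, fr_aug v = 0 <-> exists u, v = u *m fr_diff 0;
  fr_exact : forall i v, v *m fr_diff i = 0 <-> exists u : 'rV_(_), v = u *m fr_diff i.+1
}.

Section ResolutionExists.
Variable A : comPzRingType.
Hypothesis noethA : noetherian A.

Lemma noetherian_rV n (W : {pred 'rV[A]_n}) : submod_closed W ->
  exists m (d : 'M[A]_(m, n)), forall v, v \in W <-> exists u, v = u *m d.
Proof.
elim: n W => [|n IHn] W Wmod.
  exists 0, 0 => v; split=> _; first by exists 0; apply/rowP=> -[].
  by case: Wmod => W0 _; have -> : v = 0 by apply/rowP=> -[].
have [W0 Wlin] := Wmod.
have WD : {in W &, forall u v, u + v \in W}.
  by move=> u v Wu Wv; rewrite -[u]scale1r Wlin.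
pose I : {pred A^o} := [pred a | `[< exists2 w, w \in W & w 0 ord0 = a >]].
have Imod : submod_closed I.
  split=> [|c a b /asboolP[u Wu <-] /asboolP[v Wv <-]]; apply/asboolP.
    by exists 0; rewrite ?mxE.
  by exists (c *: u + v); rewrite ?Wlin ?mxE.
have [s Is] := noethA Imod.
have Wi (i : 'I_(size s)) : {w | w \in W & w 0 ord0 = s`_i}.
  apply/cid2; apply/asboolP; rewrite -[`[< _ >]]/(s`_i \in I) Is.
  apply/asboolP; exists 1, (fun=> 1), (fun=> s`_i); split=> [_|].
    exact: mem_nth.
  by rewrite big_ord1 scale1r.
pose L : 'M[A]_(size s, n.+1) := \matrix_i s2val (Wi i).
have LW u : u *m L \in W.
  rewrite mulmx_sum_row; elim/big_ind: _ => // i _.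
  by rewrite rowK -[_ *: _]addr0 Wlin //; exact: (s2valP (Wi i)).
have L0 u : (u *m L) 0 ord0 = \sum_i u 0 i * s`_i.
  by rewrite mxE; apply: eq_bigr => i _; rewrite mxE (s2valP' (Wi i)).
pose J : 'rV[A]_n -> 'rV[A]_n.+1 := row_mx (0 : 'rV[A]_1).
pose W' : {pred 'rV[A]_n} := [pred v | J v \in W].
have W'mod : submod_closed W'.
  split=> [|c u v]; rewrite !inE /J ?row_mx0 // => Wu Wv.
  have -> : row_mx 0 (c *: u + v) = c *: row_mx (0 : 'rV_1) u + row_mx 0 v.
    by rewrite scale_row_mx add_row_mx scaler0 addr0.
  exact: Wlin.
have [m [d Hd]] := IHn _ W'mod.
exists (size s + m)%N, (col_mx L (row_mx (0 : 'M_(m, 1)) d : 'M_(m, n.+1))) => v.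
have JM (u : 'rV_m) : u *m (row_mx (0 : 'M_(m, 1)) d : 'M_(m, n.+1)) = J (u *m d).
  by have := mul_mx_row u (0 : 'M_(m, 1)) d; rewrite mulmx0.
split.
  move=> Wv; have : v 0 ord0 \in I by apply/asboolP; exists v.
  rewrite Is => /asboolP[k [a [t [ts Ea]]]].
  have [b Eb] : exists b : 'rV[A]_(size s), v 0 ord0 = \sum_i b 0 i * s`_i.
    pose idx j := Ordinal (etrans (index_mem (t j) s) (ts j)).
    exists (\row_i \sum_(j | idx j == i) a j).
    rewrite Ea (partition_big idx predT) //=; apply: eq_bigr => i _.
    rewrite mxE mulr_suml; apply: eq_bigr => j /eqP <-.
    by rewrite /= nth_index //; exact: ts.
  have Wv' : v - b *m L \in W.
    by rewrite addrC -scaleN1r Wlin.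
  pose z := rsubmx (v - b *m L : 'rV_(1 + n)).
  have Ez : v - b *m L = J z.
    have E0 : lsubmx (v - b *m L : 'rV_(1 + n)) = 0.
      apply/rowP=> i; rewrite (ord1 i) !mxE.
      have -> : lshift n (0 : 'I_1) = ord0 by apply: val_inj.
      by rewrite Eb -L0 mxE subrr.
    by rewrite -[LHS](@hsubmxK _ 1 1 n) E0.
  have : z \in W' by rewrite inE -Ez.
  move=> /Hd[u Eu]; exists (row_mx b u).
  rewrite mul_row_col JM -Eu -Ez.
  by rewrite addrC subrK.
move=> [u ->]; rewrite -[u]hsubmxK mul_row_col JM.
by apply: WD => //; apply/Hd; exists (rsubmx u).
Qed.

Lemma syzygy m n (d : 'M[A]_(m, n)) :
  {kd : {k & 'M[A]_(k, m)} |
    forall v : 'rV_m, v *m d = 0 <-> exists u, v = u *m tagged kd}.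
Proof.
apply/cid; have [|k [e He]] := @noetherian_rV m [pred v | v *m d == 0].
  split=> [|a u v /eqP Eu /eqP Ev]; rewrite !inE ?mul0mx //.
  by rewrite mulmxDl -scalemxAl Eu Ev scaler0 addr0.
exists (Tagged (fun k => 'M_(k, m)) e) => v /=.
by rewrite -He inE; split=> /eqP.
Qed.

Lemma free_resolution_exists (N : lmodType A) :
  fin_gen_module N -> inhabited (free_resolution N).
Proof.
move=> [s Ns].
pose aug (v : 'rV[A]_(size s)) : N := \sum_i v 0 i *: s`_i.
have aug_lin : linear aug.
  move=> a u v; rewrite /aug scaler_sumr -big_split /=; apply: eq_bigr => i _.
  by rewrite !mxE scalerDl scalerA.
pose aM := GRing.isLinear.Build A _ N *:%R aug aug_lin.
pose augL : {linear 'rV[A]_(size s) -> N} := HB.pack aug aM.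
have [|k [d0 Hd0]] := @noetherian_rV (size s) [pred v | aug v == 0].
  split=> [|a u v /eqP Eu /eqP Ev]; rewrite !inE.
    by rewrite /aug big1 // => i _; rewrite mxE scale0r.
  by rewrite aug_lin Eu Ev scaler0 addr0.
pose St := {mn : nat * nat & 'M[A]_(mn.1, mn.2)}.
pose next (x : St) : St :=
  existT (fun mn : nat * nat => 'M[A]_(mn.1, mn.2))
    (tag (sval (syzygy (projT2 x))), (projT1 x).1)
    (tagged (sval (syzygy (projT2 x)))).
pose x0 : St := existT (fun mn : nat * nat => 'M[A]_(mn.1, mn.2)) (k, size s) d0.
pose st := fix st i : St := if i is j.+1 then next (st j) else x0.
pose rk i := (projT1 (st i)).2.
split.
refine (@FreeResolution A N rk (fun i => projT2 (st i)) augL _ _ _).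
- move=> x; have : x \in @predT N by [].
  rewrite Ns => /asboolP[p [a [t [ts ->]]]].
  pose idx j := Ordinal (etrans (index_mem (t j) s) (ts j)).
  exists (\row_i \sum_(j | idx j == i) a j).
  rewrite -[LHS]/(aug _) /aug [RHS](partition_big idx predT) //=.
  apply: eq_bigr => i _; rewrite mxE scaler_suml; apply: eq_bigr => j /eqP <-.
  by rewrite /= nth_index //; exact: ts.
- by move=> v; rewrite -Hd0 inE; split=> /eqP.
- by move=> i v; exact: (svalP (syzygy (projT2 (st i)))).
Qed.
End ResolutionExists.

(* Hom_A(A^n, M) is identified with M^n through the values on the standard basis;
   hom_map d is then precomposition with v |-> v *m d : A^m -> A^n. *)
Section Coboundary.
Variables (A : comPzRingType) (M : lmodType A) (m n : nat) (d : 'M[A]_(m, n)).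
Definition hom_map (f : {ffun 'I_n -> M}) : {ffun 'I_m -> M} :=
  [ffun j => \sum_k d j k *: f k].
Fact hom_map_linear : linear hom_map.
Proof.
move=> a f g; apply/ffunP=> j; rewrite !ffunE scaler_sumr -big_split /=.
by apply: eq_bigr => k _; rewrite !ffunE scalerDr !scalerA mulrC.
Qed.
HB.instance Definition _ := GRing.isLinear.Build A {ffun 'I_n -> M}
  {ffun 'I_m -> M} *:%R hom_map hom_map_linear.
End Coboundary.

Section PostComp.
Variables (A : comPzRingType) (M N : lmodType A) (g : {linear M -> N}) (n : nat).
Definition post_comp (f : {ffun 'I_n -> M}) : {ffun 'I_n -> N} :=
  [ffun k => g (f k)].
Fact post_comp_linear : linear post_comp.
Proof. by move=> a u v; apply/ffunP=> k; rewrite !ffunE linearP. Qed.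
HB.instance Definition _ := GRing.isLinear.Build A {ffun 'I_n -> M}
  {ffun 'I_n -> N} *:%R post_comp post_comp_linear.

Lemma post_comp_hom m (d : 'M[A]_(m, n)) f :
  hom_map d (post_comp f) = [ffun j => g (hom_map d f j)].
Proof.
apply/ffunP=> j; rewrite !ffunE linear_sum; apply: eq_bigr => k _.
by rewrite ffunE linearZ.
Qed.
End PostComp.

Section Ext.
Variables (A : comPzRingType) (N : lmodType A) (F : free_resolution N).

Definition cocycles (i : nat) (M : lmodType A) : {pred {ffun 'I_(fr_rank F i) -> M}} :=
  kerl (hom_map (M := M) (fr_diff F i)).
Arguments cocycles : clear implicits.
HB.instance Definition _ i M := GRing.SubmodClosed.on (cocycles i M).

Definition coboundaries (i : nat) (M : lmodType A) :
    {pred {ffun 'I_(fr_rank F i) -> M}} :=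
  match i with
  | 0 => pred1 0
  | j.+1 => imgl (hom_map (M := M) (fr_diff F j))
  end.
Arguments coboundaries : clear implicits.
Fact coboundaries_submod i M : submod_closed (coboundaries i M).
Proof.
case: i => [|i]; last exact: imgl_submod.
by split=> [|a u v /eqP-> /eqP->]; rewrite !inE // scaler0 addr0.
Qed.
HB.instance Definition _ i M := GRing.isSubmodClosed.Build A _ (coboundaries i M)
  (coboundaries_submod i M).

(* Ext^i_A(N, M), the i-th cohomology of Hom_A(F, M). *)
Definition ext (i : nat) (M : lmodType A) : Type :=
  subquot (cocycles i M) (coboundaries i M).
HB.instance Definition _ i M := GRing.Lmodule.on (ext i M).

Section ExtMap.
Variables (i : nat) (M M' : lmodType A) (g : {linear M -> M'}).
Fact ext_map_cocycles u : u \in cocycles i M -> post_comp g u \in cocycles i M'.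
Proof.
move=> /eqP /= du; apply/eqP; rewrite /= post_comp_hom du; apply/ffunP => j.
by rewrite !ffunE linear0.
Qed.
Fact ext_map_coboundaries u :
  u \in coboundaries i M -> post_comp g u \in coboundaries i M'.
Proof.
case: i u => [|j] u /=; first by rewrite !inE => /eqP->; rewrite linear0.
move=> /asboolP[v <-]; apply/asboolP; exists (post_comp g v).
by rewrite /= post_comp_hom.
Qed.
Definition ext_map : ext i M -> ext i M' :=
  subquot_map ext_map_cocycles ext_map_coboundaries.
HB.instance Definition _ := GRing.Linear.on ext_map.
End ExtMap.
End Ext.
Arguments ext_map {A N} F i {M M'} g.

Section Torsion.
Variables (O : idomainType) (U : lmodType O).
Definition tors : {pred U} := [pred u | `[< exists2 a : O, a != 0 & a *: u = 0 >]].
Fact tors_submod : submod_closed tors.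
Proof.
split=> [|c u v /asboolP[a a0 au] /asboolP[b b0 bv]]; apply/asboolP.
  by exists 1; rewrite ?oner_neq0 ?scaler0.
exists (a * b); first by rewrite mulf_neq0.
rewrite scalerDr scalerA (_ : a * b * c = b * c * a); last by ring.
by rewrite -!scalerA au bv !scaler0 addr0.
Qed.
HB.instance Definition _ := GRing.isSubmodClosed.Build O U tors tors_submod.

Definition torsion_free_quotient : Type := quotmod tors.
HB.instance Definition _ := GRing.Lmodule.on torsion_free_quotient.
End Torsion.
Arguments tors {O} U.

Section TfMap.
Variables (O : idomainType) (U V : lmodType O) (f : {linear U -> V}).
Fact tors_map u : u \in tors U -> f u \in tors V.
Proof.
by move=> /asboolP[a a0 au]; apply/asboolP; exists a; rewrite // -linearZ au linear0.
Qed.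
Definition tf_map : torsion_free_quotient U -> torsion_free_quotient V :=
  quot_map f tors_map.
HB.instance Definition _ := GRing.Linear.on tf_map.
End TfMap.

Definition coker (R : pzRingType) (U V : lmodType R) (f : {linear U -> V}) : Type :=
  quotmod (imgl f).
HB.instance Definition _ (R : pzRingType) (U V : lmodType R) (f : {linear U -> V}) :=
  GRing.Lmodule.on (coker f).

Section Augmented.
Variables (O : idomainType) (A : comAlgType O) (lam : {rmorphism A -> O}).

Definition aug_ideal : {pred A^o} := [pred a | lam a == 0].
Fact aug_ideal_submod : submod_closed aug_ideal.
Proof.
split=> [|a x y /eqP xI /eqP yI]; rewrite !inE ?rmorph0 //.
have -> : (a *: x : A^o) = a * (x : A) by [].
by rewrite rmorphD rmorphM xI yI mulr0 addr0.
Qed.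
HB.instance Definition _ := GRing.isSubmodClosed.Build A A^o aug_ideal aug_ideal_submod.

Definition aug_compl : {pred A} := [pred a | lam a != 0].
Fact aug_compl_mulr_closed : mulr_closed aug_compl.
Proof.
split=> [|x y]; rewrite !inE ?rmorph1 ?oner_neq0 // => x0 y0.
by rewrite rmorphM mulf_neq0.
Qed.
HB.instance Definition _ := GRing.isMulClosed.Build A aug_compl aug_compl_mulr_closed.

(* O as an A-module. *)
Definition residue : Type := restr lam O^o.
HB.instance Definition _ := GRing.Lmodule.on residue.

(* The rank of M_p over A_p, for p = aug_ideal. *)
Definition local_rank (M : lmodType A) : nat := generic_rank (loc aug_compl M).

(* (A, lam) is an object of C_O(c). *)
Record in_C (c : nat) : Prop := InC {
  in_C_noetherian : noetherian A;
  in_C_local : local_ring A;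
  in_C_complete : complete_local A;
  in_C_algebra : forall x : O, lam x%:A = x;
  in_C_surj : forall x : O, exists a, lam a = x;
  in_C_regular : regular_local_ring (loc_ring aug_compl) c
}.

(* p / p^2 *)
Definition cotangent : Type := subquot aug_ideal (smul aug_ideal aug_ideal).
HB.instance Definition _ := GRing.Lmodule.on cotangent.

Definition Phi : Type := submod (tors (restr (GRing.in_alg A) cotangent)).
HB.instance Definition _ := GRing.Lmodule.on Phi.

(* F is an auxiliary resolution computing Ext_A(O, _); up to isomorphism Psi does not
   depend on it. *)
Section CongruenceModule.
Variables (F : free_resolution residue) (c : nat) (M : lmodType A).

Definition mod_aug : Type := quotmod (smul aug_ideal (@predT M)).
HB.instance Definition _ := GRing.Lmodule.on mod_aug.
Definition mod_aug_pi : M -> mod_aug := quotmod_pi (smul aug_ideal (@predT M)).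
HB.instance Definition _ := GRing.Linear.on mod_aug_pi.

(* Ext^c_A(O, X) as an O-module through O -> A. *)
Definition ext_O (X : lmodType A) : lmodType O := restr (GRing.in_alg A) (ext F c X).
Definition ext_mod_aug : {linear ext_O M -> ext_O mod_aug} :=
  restr_map (GRing.in_alg A) (ext_map F c mod_aug_pi).
Definition Psi : Type := coker (tf_map ext_mod_aug).
HB.instance Definition _ := GRing.Lmodule.on Psi.

Definition wiles_defect : int :=
  (local_rank M)%:Z * (mlength Phi)%:Z - (mlength Psi)%:Z.
End CongruenceModule.
End Augmented.

Definition local_map (A B : comPzRingType) (f : A -> B) : Prop :=
  forall a, invertible (f a) -> invertible a.

(* Main.v *)
From HB Require Import structures.
Require Import Defs.
From mathcomp Require Import all_boot all_order all_algebra.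
From mathcomp Require Import ring zify boolp.

Set Implicit Arguments.
Unset Strict Implicit.
Unset Printing Implicit Defensive.

Import GRing.Theory.
Local Open Scope ring_scope.
Local Notation span := Defs.span.
Local Notation coker := Defs.coker.

(** Let p_A and p_B be the augmentation ideals, D the given free resolution of O
    over B, and C the complex obtained by applying phi to the given free resolution
    of O over A, so that Hom_B(C, N) computes Ext_A(O, N) for a B-module N.  Let
    tau : C -> D lift the identity of O.  The isomorphism of congruence modules is
    induced by tau.

    The first point is that phi is an isomorphism near p_A.  A chain of c + 1 primes
    inside p_B pulls back to a chain of primes of A which all contain the kernel of
    phi.  As p_A is locally generated by c elements, a chain of this length starts
    at the zero ideal of the localisation (prime_chain_regular); hence the kernel of
    phi is torsion (kernel_torsion).  The same argument shows that any c local
    generators of p_A form a regular sequence locally at p_A.  It rests on Krull's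
    principal ideal theorem (krull_principal).

    So the positive homology of C is torsion.  It is also annihilated by p_B, because
    p_A acts by null-homotopic maps on a resolution of O, and therefore each of its
    elements is killed by a power of every nonunit (map_resolution_nonunit).  The
    cone of tau has such homology too, and it is exact in degrees 0 and 1.  Since
    depth M >= c, the cohomology of the cone with values in M vanishes in all degrees
    below c + 2 (depth_coboundary), and tau is surjective on H^c with values in M.
    This is the spectral sequence Ext_B(Tor^A(O, B), M) => Ext_A(O, M) in elementary
    terms.

    With values in N = M / p M the map induced by tau on the torsion-free quotients
    is an isomorphism as well, but for another reason, which uses that both local
    rings are regular of dimension c.  Choose f_1, ..., f_c in p_A and derivations
    d_1, ..., d_c from A to O with d_i (f_j) = delta_ij (dual_derivations), and
    let K be the Koszul complex of f, mapped to C and hence to D.  All differentials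
    of K vanish modulo p, so a cocycle with values in N can be evaluated on the top
    generator of K.  This evaluation is injective modulo torsion because K resolves O
    up to torsion (ev_injective).  It is surjective because the product of the classes
    of the d_i takes the value 1 there (ev_surjective).  This product is explicit:
    multiplication by the class of a derivation applies the derivation to the entries
    of the differential.  Evaluation thus identifies both torsion-free Ext groups with
    the torsion-free quotient of N, compatibly with tau.

    Both congruence modules are therefore quotients of the same group of cochains by
    the same relations (psi_eq, relation_comparison).

    For the Wiles defects, the ranks agree because the localisations do
    (local_rank_restr), the map from Phi_A to Phi_B is surjective because the kernel
    of phi is torsion (Phi_map), and Phi_A has finite length (Phi_bounded_chains), so
    that length Phi_B <= length Phi_A.

    Statements that hold locally at a prime P are expressed without localising: an
    inclusion of I in J that holds locally says that every x in I has a multiple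
    s * x in J with s outside P. *)

(** * Ideals, generators and a local form of the Nakayama lemma *)

(** Elements of a span come with arbitrary finite families; indexing the coefficients by
    the positions in s is what the constructions with matrices need. *)
Lemma span_seqP (R : pzRingType) (V : lmodType R) (s : seq V) (v : V) :
  v \in span (mem s) -> exists a : 'I_(size s) -> R, v = \sum_i a i *: s`_i.
Proof.
move=> /asboolP[n [a [t [ts ->]]]].
pose idx j := Ordinal (etrans (index_mem (t j) s) (ts j)).
exists (fun i => \sum_(j | idx j == i) a j).
rewrite [LHS](partition_big idx predT) //=; apply: eq_bigr => i _.
rewrite scaler_suml; apply: eq_bigr => j /eqP <-.
by rewrite /= nth_index //; exact: ts.
Qed.

Section Ideals.
Variable R : comPzRingType.
Implicit Types (I J P Q : R -> Prop).

(** Ideals as Prop-valued predicates: saturations, symbolic powers and pullbacks of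
    ideals are then written without reflecting them into booleans. *)
Record is_ideal I : Prop := IsIdeal {
  ideal0 : I 0;
  idealD : forall x y, I x -> I y -> I (x + y);
  idealM : forall a x, I x -> I (a * x) }.

Record is_prime P : Prop := IsPrime {
  prime_is_ideal : is_ideal P;
  prime1 : ~ P 1;
  primeM : forall x y, P (x * y) -> P x \/ P y }.

Definition incl I J : Prop := forall x, I x -> J x.

Definition local_incl P I J : Prop := forall x, I x -> exists2 s, ~ P s & J (s * x).

Definition adjoin I x : R -> Prop := fun y => exists a, I (y - a * x).

(** The ideal I + (xs), as the smallest ideal above I and xs.  This form makes it
    immediate to change the list of generators. *)
Definition gen I (xs : seq R) : R -> Prop := fun x =>
  forall J, is_ideal J -> incl I J -> (forall y, y \in xs -> J y) -> J x.

Lemma idealN I x : is_ideal I -> I x -> I (- x).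
Proof. by move=> idI Ix; rewrite -mulN1r; apply: idealM. Qed.

Lemma idealB I x y : is_ideal I -> I x -> I y -> I (x - y).
Proof. by move=> idI Ix Iy; apply: idealD => //; apply: idealN. Qed.

Lemma ideal_mulr I a x : is_ideal I -> I x -> I (x * a).
Proof. by move=> idI Ix; rewrite mulrC; apply: idealM. Qed.

Lemma ideal_sum (T : Type) (r : seq T) (p : pred T) (F : T -> R) I :
  is_ideal I -> (forall i, p i -> I (F i)) -> I (\sum_(i <- r | p i) F i).
Proof.
move=> idI IF; elim/big_ind: _ => //; first exact: ideal0.
by move=> x y; apply: idealD.
Qed.

Lemma prime_notM P x y : is_prime P -> ~ P x -> ~ P y -> ~ P (x * y).
Proof. by move=> prP Px Py /(primeM prP)[]. Qed.

Lemma prime_not_prod P (T : finType) (F : T -> R) :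
  is_prime P -> (forall i, ~ P (F i)) -> ~ P (\prod_i F i).
Proof.
move=> prP PF; elim/big_ind: _ => // [|x y Px Py]; first exact: prime1.
exact: prime_notM.
Qed.

Lemma zero_ideal : is_ideal (eq 0).
Proof.
split=> // [_ _ <- <-|a _ <-]; [by rewrite addr0 | by rewrite mulr0].
Qed.

Lemma adjoin_ideal I x : is_ideal I -> is_ideal (adjoin I x).
Proof.
move=> idI; split.
- by exists 0; rewrite mul0r subr0; apply: ideal0.
- move=> y z [a Ia] [b Ib]; exists (a + b).
  have -> : y + z - (a + b) * x = (y - a * x) + (z - b * x) by ring.
  exact: idealD.
- move=> c y [a Ia]; exists (c * a).
  have -> : c * y - c * a * x = c * (y - a * x) by ring.
  exact: idealM.
Qed.

Lemma adjoin_incl I x : incl I (adjoin I x).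
Proof. by move=> y Iy; exists 0; rewrite mul0r subr0. Qed.

Lemma adjoin_mem I x : is_ideal I -> adjoin I x x.
Proof. by move=> idI; exists 1; rewrite mul1r subrr; apply: ideal0. Qed.

Lemma adjoin_sub I J x : is_ideal J -> incl I J -> J x -> incl (adjoin I x) J.
Proof.
move=> idJ IJ Jx y [a Ia]; rewrite -[y](subrK (a * x)).
by apply: idealD => //; [apply: IJ | apply: idealM].
Qed.

Lemma gen_nil I x : is_ideal I -> gen I [::] x -> I x.
Proof. by move=> idI; apply. Qed.

Lemma gen_cons I y ys x : is_ideal I -> gen I (y :: ys) x -> gen (adjoin I y) ys x.
Proof.
move=> idI gx J idJ IJ Jys; apply: gx => // [z Iz|z].
  by apply: IJ; apply: adjoin_incl.
by rewrite inE => /orP[/eqP->|/Jys//]; apply: IJ; apply: adjoin_mem.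
Qed.

Lemma gen_ideal I xs : is_ideal (gen I xs).
Proof.
split.
- by move=> J idJ _ _; apply: ideal0.
- by move=> x y gx gy J idJ IJ Jxs; apply: idealD; [| apply: gx | apply: gy].
- by move=> a x gx J idJ IJ Jxs; apply: idealM => //; apply: gx.
Qed.

Lemma gen_mem I xs x : x \in xs -> gen I xs x.
Proof. by move=> xxs J _ _; apply. Qed.

Lemma gen_sum n (g : 'I_n -> R) (x : R) :
  gen (eq 0) (codom g) x -> exists a : 'I_n -> R, x = \sum_i a i * g i.
Proof.
move=> gx; apply: (gx (fun y => exists a : 'I_n -> R, y = \sum_i a i * g i)) => [|y <-|y /codomP[i ->]]; last first.
- exists (fun j => (j == i)%:R); rewrite (bigD1 i) //= eqxx mul1r big1 ?addr0 //.
  by move=> j /negbTE->; rewrite mul0r.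
- by exists (fun=> 0); rewrite big1 // => i _; rewrite mul0r.
split.
- by exists (fun=> 0); rewrite big1 // => i _; rewrite mul0r.
- move=> y z [a ->] [b ->]; exists (fun i => a i + b i).
  by rewrite -big_split; apply: eq_bigr => i _; rewrite mulrDl.
- move=> c y [a ->]; exists (fun i => c * a i).
  by rewrite mulr_sumr; apply: eq_bigr => i _; rewrite mulrA.
Qed.

Lemma sum_gen n (g : 'I_n -> R) (a : 'I_n -> R) I :
  gen I (codom g) (\sum_i a i * g i).
Proof.
apply: ideal_sum; first exact: gen_ideal.
by move=> i _; apply: (idealM (gen_ideal _ _)); apply: gen_mem; apply: codom_f.
Qed.

Section Noetherian.
Hypothesis noethR : noetherian R.

Lemma noetherian_fg I : is_ideal I -> exists n (g : 'I_n -> R),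
  (forall i, I (g i)) /\ forall x, I x -> exists a : 'I_n -> R, x = \sum_i a i * g i.
Proof.
move=> idI; have [|s Is] := noethR (I := [pred x : R^o | `[< I x >]]).
  split=> [|a x y /asboolP Ix /asboolP Iy]; apply/asboolP; first exact: ideal0.
  by apply: idealD => //; apply: (idealM idI).
exists (size s), (fun i => s`_i); split=> [i|x Ix].
  have : s`_i \in span (mem s).
    apply/asboolP; exists 1, (fun=> 1), (fun=> s`_i); split=> [_|].
      exact: mem_nth.
    by rewrite big_ord1 scale1r.
  by rewrite -Is => /asboolP.
have : x \in span (mem s) by rewrite -Is; apply/asboolP.
by move=> /span_seqP.
Qed.

(** Noetherian induction.  A counterexample without larger counterexample cannot exist,
    for otherwise dependent choice would give a strictly increasing sequence of ideals;
    the generators of its union all occur at some stage. *)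
Lemma noetherian_ideal_ind (T : (R -> Prop) -> Prop) :
  (forall I, is_ideal I ->
     (forall J, is_ideal J -> incl I J -> ~ incl J I -> T J) -> T I) ->
  forall I, is_ideal I -> T I.
Proof.
move=> step I0 idI0; apply: contrapT => nTI0.
pose bad := {I | is_ideal I /\ ~ T I}.
have next (b : bad) : {b' : bad | incl (sval b) (sval b') /\ ~ incl (sval b') (sval b)}.
  case: b => I [idI nTI] /=; apply: cid; apply: contrapT => nex.
  apply: nTI; apply: step => // J idJ IJ nJI; apply: contrapT => nTJ.
  by apply: nex; exists (exist _ J (conj idJ nTJ)).
pose st := fix st n : bad := if n is m.+1 then sval (next (st m)) else exist _ I0 (conj idI0 nTI0).
have stS n : incl (sval (st n)) (sval (st n.+1)) by case: (svalP (next (st n))).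
have st_le m n : (m <= n)%N -> incl (sval (st m)) (sval (st n)).
  elim: n => [|n IHn]; first by rewrite leqn0 => /eqP->.
  by rewrite leq_eqVlt => /predU1P[->//|/IHn mn] x /mn; apply: stS.
pose U x := exists n, sval (st n) x.
have idU : is_ideal U.
  split; first by exists 0; apply: ideal0.
    move=> x y [m xm] [n yn]; exists (maxn m n).
    case: (svalP (st (maxn m n))) => idm _; apply: idealD => //.
      by apply: st_le xm; apply: leq_maxl.
    by apply: st_le yn; apply: leq_maxr.
  by move=> a x [m xm]; exists m; case: (svalP (st m)) => idm _; apply: idealM.
have [n [g [Ug genU]]] := noetherian_fg idU.
have [f fP] := choice Ug.
pose N := \max_i f i.
case: (svalP (next (st N))) => _; apply=> x xN.
have /genU[a ->] : U x by exists N.+1.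
case: (svalP (st N)) => idN _; apply: ideal_sum => // i _; apply: idealM => //.
by apply: st_le (fP i); apply: leq_bigmax.
Qed.
End Noetherian.

Lemma prod_sub_ideal I (T : finType) (F G : T -> R) : is_ideal I ->
  (forall i, I (F i - G i)) -> I (\prod_i F i - \prod_i G i).
Proof.
move=> idI IFG; elim/big_rec2: _ => [|i x y _ Ixy].
  by rewrite subrr; apply: ideal0.
have -> : F i * y - G i * x = y * (F i - G i) + G i * (y - x) by ring.
by apply: idealD => //; apply: idealM.
Qed.

Lemma det_sub_ideal I n (X Y : 'M[R]_n) : is_ideal I ->
  (forall i j, I (X i j - Y i j)) -> I (\det X - \det Y).
Proof.
move=> idI IXY; rewrite /determinant -sumrB; apply: ideal_sum => // s _.
by rewrite -mulrBr; apply: idealM => //; apply: prod_sub_ideal.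
Qed.

(** Nakayama's lemma in the localisation at P, by the determinant trick: the matrix of
    the relations s * g i - sum_j q j * g j has a determinant which is congruent modulo
    P to the product of the s, hence outside P, and Cramer's rule multiplies each g i by
    it into J. *)
Lemma local_nakayama P J n (g : 'I_n -> R) : is_prime P -> is_ideal J ->
  (forall i, exists s (q : 'I_n -> R),
     [/\ ~ P s, forall j, P (q j) & J (s * g i - \sum_j q j * g j)]) ->
  exists2 s, ~ P s & forall i, J (s * g i).
Proof.
move=> prP idJ /choice[s /choice[q Hq]].
pose Q := \matrix_(i, j) q i j; pose D := diag_mx (\row_i s i).
have adjE i : \det (D - Q) * g i =
    \sum_k \adj (D - Q) i k * (s k * g k - \sum_j q k j * g j).
  pose G := \col_j g j.
  have -> : \det (D - Q) * g i = ((\det (D - Q))%:M *m G) i 0.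
    by rewrite mul_scalar_mx !mxE.
  rewrite -mul_adj_mx -mulmxA mxE; apply: eq_bigr => k _; congr (_ * _).
  rewrite mulmxBl mul_diag_mx !mxE; congr (_ - _).
  by apply: eq_bigr => j _; rewrite !mxE.
exists (\det (D - Q)); last first.
  move=> i; rewrite adjE; apply: ideal_sum => // k _; apply: idealM => //.
  by case: (Hq k).
move=> PX; apply: (@prime_not_prod P _ s prP) => [i|]; first by case: (Hq i).
rewrite -[X in P X](subrK (\det (D - Q))); apply: idealD => //; first exact: prime_is_ideal.
have -> : \prod_i s i = \det D by rewrite det_diag; apply: eq_bigr => i _; rewrite mxE.
apply: det_sub_ideal => [|i j]; first exact: prime_is_ideal.
by rewrite !mxE opprB addrC subrK; case: (Hq i).
Qed.

(** The product of the multipliers of the generators serves all elements. *)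
Lemma local_incl_uniform P I J n (g : 'I_n -> R) : is_prime P -> is_ideal J ->
  (forall x, I x -> exists a : 'I_n -> R, x = \sum_i a i * g i) ->
  (forall i, exists2 s, ~ P s & J (s * g i)) ->
  exists2 s, ~ P s & forall x, I x -> J (s * x).
Proof.
move=> prP idJ genI HJ.
have /choice[s sP] : forall i, exists s, ~ P s /\ J (s * g i).
  by move=> i; have [s] := HJ i; exists s.
exists (\prod_i s i); first by apply: prime_not_prod => // i; case: (sP i).
move=> x /genI[a ->]; rewrite mulr_sumr; apply: ideal_sum => // i _.
have -> : \prod_i s i * (a i * g i) = (a i * \prod_(j | j != i) s j) * (s i * g i).
  by rewrite (bigD1 i) //=; ring.
by apply: idealM => //; case: (sP i).
Qed.
End Ideals.

(** * Lengths and the principal ideal theorem *)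

Section Length.
Variables (R : comPzRingType) (V : lmodType R) (P : R -> Prop).
Hypothesis prP : is_prime P.
Implicit Types C N : V -> Prop.

Record is_submod C : Prop := IsSubmod {
  submod0 : C 0;
  submodD : forall u v, C u -> C v -> C (u + v);
  submodZ : forall a v, C v -> C (a *: v) }.

Lemma submodN C v : is_submod C -> C v -> C (- v).
Proof. by move=> smC Cv; rewrite -scaleN1r; apply: submodZ. Qed.

Lemma submodB C u v : is_submod C -> C u -> C v -> C (u - v).
Proof. by move=> smC Cu Cv; apply: submodD => //; apply: submodN. Qed.

(** N has finite length modulo N', locally at P.  The length is witnessed by a bounded
    monotone integer function d on submodules which can agree on two nested submodules
    only when these agree on N, modulo N' and up to multipliers outside P.  Such
    functions add up along filtrations, so that no chains of submodules have to be
    manipulated. *)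
Definition finite_colength N' N : Prop := exists (l : nat) (d : (V -> Prop) -> nat),
  (forall C, (d C <= l)%N) /\
  forall C C', is_submod C -> is_submod C' -> (forall v, C v -> C' v) ->
    (d C <= d C')%N /\
    (d C = d C' -> forall v, C' v -> N v ->
       exists s c, [/\ ~ P s, C c & N' (s *: v - c)]).

Lemma finite_colength_trans N'' N' N :
  finite_colength N'' N' -> finite_colength N' N -> finite_colength N'' N.
Proof.
move=> [l1 [d1 [d1l H1]]] [l2 [d2 [d2l H2]]].
exists (l1 + l2)%N, (fun C => d1 C + d2 C)%N; split=> [C|C C' smC smC' CC'].
  exact: leq_add.
have [le1 eq1] := H1 _ _ smC smC' CC'; have [le2 eq2] := H2 _ _ smC smC' CC'.
split=> [|E v C'v Nv]; first exact: leq_add.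
have [E1 E2] : d1 C = d1 C' /\ d2 C = d2 C' by lia.
have [s [c [Ps Cc N'c]]] := eq2 E2 v C'v Nv.
have C'w : C' (s *: v - c) by apply: submodB => //; [apply: submodZ | apply: CC'].
have [t [b [Pt Cb N''b]]] := eq1 E1 _ C'w N'c.
exists (t * s), (t *: c + b); split; first exact: prime_notM.
  by apply: submodD => //; apply: submodZ.
by rewrite opprD addrA -scalerA -scalerBr.
Qed.

(** N / N' is locally a cyclic module killed by P, that is, zero or the residue field at
    P; the function d tells whether a submodule hits the generator. *)
Lemma finite_colength_cyclic N' N v0 : is_submod N' ->
  (forall v, N v -> exists a, N' (v - a *: v0)) ->
  (forall q, P q -> N' (q *: v0)) -> finite_colength N' N.
Proof.
move=> smN' genN PN'.
pose hit C := exists s c, [/\ ~ P s, C c & N' (s *: v0 - c)].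
exists 1%N, (fun C => `[< hit C >] : nat); split=> [C|C C' smC smC' CC'].
  exact: leq_b1.
have hitCC' : hit C -> hit C'.
  by move=> [s [c [Ps Cc N'c]]]; exists s, c; split=> //; apply: CC'.
split=> [|E v C'v /genN[a N'v]].
  by have [/hitCC' hC'|//] := asboolP (hit C); rewrite (asboolT hC').
have [[s [c [Ps Cc N'c]]]|nhC] := pselect (hit C).
  exists s, (a *: c); split=> //; first exact: submodZ.
  have -> : s *: v - a *: c = s *: (v - a *: v0) + a *: (s *: v0 - c).
    by rewrite !scalerBr !scalerA [a * s]mulrC addrA subrK.
  by apply: submodD => //; apply: submodZ.
have nhC' : ~ hit C'.
  by move=> hC'; move: E; rewrite (asboolT hC') (asboolF nhC).
have [Pa|nPa] := pselect (P a); last first.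
  case: nhC'; exists a, v; split=> //.
  by rewrite -opprB; apply: submodN.
exists 1, 0; split; [exact: prime1 | exact: submod0 |].
rewrite scale1r subr0 -[v](subrK (a *: v0)).
by apply: submodD => //; apply: PN'.
Qed.

Lemma finite_colength_gen n (vs : 'I_n -> V) N' N : is_submod N' ->
  (forall v, N v -> exists a : 'I_n -> R, N' (v - \sum_i a i *: vs i)) ->
  (forall q i, P q -> N' (q *: vs i)) -> finite_colength N' N.
Proof.
elim: n vs N' => [|n IHn] vs N' smN' genN PN'.
  exists 0%N, (fun=> 0%N); split=> // C C' smC smC' CC'; split=> // _ v _.
  move=> /genN[a]; rewrite big_ord0 subr0 => N'v.
  exists 1, 0; split; [exact: prime1 | exact: submod0 |].
  by rewrite scale1r subr0.
pose N1 v := exists a, N' (v - a *: vs ord0).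
have smN1 : is_submod N1.
  split.
  - by exists 0; rewrite scale0r subr0; apply: submod0.
  - move=> u v [a Na] [b Nb]; exists (a + b).
    by rewrite scalerDl opprD addrACA; apply: submodD.
  - move=> c v [a Na]; exists (c * a).
    by rewrite -scalerA -scalerBr; apply: submodZ.
apply: (@finite_colength_trans _ N1).
  by apply: (@finite_colength_cyclic _ _ (vs ord0)) => // q; apply: PN'.
apply: (IHn (fun i => vs (lift ord0 i))) => // [v /genN[a N'a]|q i Pq].
  exists (fun i => a (lift ord0 i)), (a ord0).
  by move: N'a; rewrite big_ord_recl opprD addrA addrAC.
by exists 0; rewrite scale0r subr0; apply: PN'.
Qed.
End Length.

Section IdealPowers.
Variable R : comPzRingType.
Implicit Types I J K : R -> Prop.

Inductive prod_ideal I J : R -> Prop :=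
| prod_ideal0 : prod_ideal I J 0
| prod_idealS a b x : I a -> J b -> prod_ideal I J x -> prod_ideal I J (a * b + x).

Fixpoint ipow I n : R -> Prop :=
  if n is m.+1 then prod_ideal I (ipow I m) else fun=> True.

Lemma prod_ideal_ideal I J : is_ideal I -> is_ideal (prod_ideal I J).
Proof.
move=> idI; split; first exact: prod_ideal0.
  move=> x y IJx IJy; elim: IJx => [|a b z Ia Jb _ IJz]; first by rewrite add0r.
  by rewrite -addrA; apply: prod_idealS.
move=> c x; elim=> [|a b z Ia Jb _ IJz]; first by rewrite mulr0; apply: prod_ideal0.
by rewrite mulrDr mulrA; apply: prod_idealS => //; apply: idealM.
Qed.

Lemma prod_ideal_mem I J a b : I a -> J b -> prod_ideal I J (a * b).
Proof. by move=> Ia Jb; rewrite -[_ * _]addr0; do !constructor. Qed.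

Lemma prod_ideal_sub I J K : is_ideal K ->
  (forall a b, I a -> J b -> K (a * b)) -> incl (prod_ideal I J) K.
Proof.
move=> idK IJK x; elim=> [|a b z Ia Jb _ Kz]; first exact: ideal0.
by apply: idealD => //; apply: IJK.
Qed.

Lemma ipow_ideal I n : is_ideal I -> is_ideal (ipow I n).
Proof. by case: n => [|n] idI //=; exact: prod_ideal_ideal. Qed.

Lemma ipowS_sub I n : is_ideal I -> incl (ipow I n.+1) (ipow I n).
Proof.
move=> idI; apply: prod_ideal_sub; first exact: ipow_ideal.
by move=> a b _ Ib; apply: idealM => //; apply: ipow_ideal.
Qed.

Lemma ipowD I m n : is_ideal I ->
  incl (ipow I (m + n)) (prod_ideal (ipow I m) (ipow I n)).
Proof.
move=> idI; elim: m => [|m IHm].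
  by move=> x Ix; rewrite -[x]mul1r; apply: (@prod_ideal_mem (ipow I 0)).
rewrite addSn; apply: prod_ideal_sub.
  by apply: prod_ideal_ideal; apply: ipow_ideal.
move=> a b Ia /IHm; elim=> [|c d y Ic Id _ IHy].
  by rewrite mulr0; apply: prod_ideal0.
by rewrite mulrDr mulrA; apply: prod_idealS => //; apply: prod_ideal_mem.
Qed.
End IdealPowers.

Section PrincipalIdealTheorem.
Variable R : comPzRingType.
Hypothesis noethR : noetherian R.
Implicit Types (I J P Q : R -> Prop).

Lemma ideal_submod (I : R -> Prop) : is_ideal I <-> is_submod (V := R^o) I.
Proof. by split=> -[? ? ?]; split. Qed.

Section Minimal.
Variables (P Q' : R -> Prop) (x : R).
Hypotheses (prP : is_prime P) (prQ' : is_prime Q').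
Hypothesis minQ' : forall T, is_prime T -> incl P T -> incl T Q' -> T x -> incl Q' T.
Hypotheses (PQ' : incl P Q') (Q'x : Q' x).

(** By noetherian induction only prime ideals I matter, and these are Q' itself or not
    contained in Q'. *)
Lemma minimal_prime_pow I : is_ideal I -> incl P I -> I x ->
  exists s n, ~ Q' s /\ forall z, ipow Q' n z -> I (s * z).
Proof.
move=> idI; move: I idI; apply: (noetherian_ideal_ind noethR) => I idI IH PI Ix.
have [[s Is nQs]|IQ'] := pselect (exists2 s, I s & ~ Q' s).
  by exists s, 0%N; split=> // z _; apply: ideal_mulr.
have {}IQ' : incl I Q' by move=> y Iy; apply: contrapT => nQy; apply: IQ'; exists y.
have I1 : ~ I 1 by move/IQ'; apply: prime1.
have [prI|nprI] := pselect (is_prime I).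
  exists 1, 1%N; split=> [|z Q'z]; first exact: prime1.
  rewrite mul1r; apply: (minQ' prI) => //.
  move: Q'z; apply: prod_ideal_sub; first exact: prime_is_ideal.
  by move=> a b Q'a _; apply: ideal_mulr => //; apply: prime_is_ideal.
have [a [b [Iab nIa nIb]]] : exists a b, [/\ I (a * b), ~ I a & ~ I b].
  apply: contrapT => nex; apply: nprI; split=> // a b Iab.
  by have [|nIa] := pselect (I a); [left | right; apply: contrapT => nIb; apply: nex; exists a, b].
have powI c : ~ I c -> exists s n, ~ Q' s /\ forall z, ipow Q' n z -> adjoin I c (s * z).
  move=> nIc; apply: IH.
  - exact: adjoin_ideal.
  - exact: adjoin_incl.
  - by move=> sub; apply: nIc; apply: sub; apply: adjoin_mem.
  - by move=> y /PI; apply: adjoin_incl.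
  - exact: adjoin_incl.
have [s [m [nQs Hs]]] := powI a nIa; have [t [n [nQt Ht]]] := powI b nIb.
exists (s * t), (m + n)%N; split=> [|z /ipowD]; first exact: prime_notM.
move=> /(_ (prime_is_ideal prQ')); elim=> [|c d y Q'c Q'd _ Iz].
  by rewrite mulr0; apply: ideal0.
rewrite mulrDr; apply: idealD => //.
have [u Iu] := Hs _ Q'c; have [v Iv] := Ht _ Q'd.
have -> : s * t * (c * d) = (t * d) * (s * c - u * a) + (u * a) * (t * d - v * b) + u * v * (a * b).
  by ring.
apply: idealD => //; last exact: idealM.
by apply: idealD => //; apply: idealM.
Qed.

(** The local ring at Q' modulo P + (x) is artinian, because it is killed by a power of
    its maximal ideal. *)
Lemma minimal_prime_colength :
  finite_colength (V := R^o) Q' (adjoin P x) (fun=> True).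
Proof.
have idP := prime_is_ideal prP; have idQ' := prime_is_ideal prQ'.
have [||s [n [nQs Hs]]] := minimal_prime_pow (adjoin_ideal x idP).
- exact: adjoin_incl.
- exact: adjoin_mem.
suff : finite_colength (V := R^o) Q' (ipow Q' n) (fun=> True).
  move=> [l [d [dl Hd]]]; exists l, d; split=> // C C' smC smC' CC'.
  have [le_d eq_d] := Hd _ _ smC smC' CC'; split=> // E v C'v _.
  have [t [c [Q't Cc powc]]] := eq_d E v C'v I.
  exists (s * t), (s *: c); split; [exact: prime_notM|exact: submodZ|].
  by rewrite -scalerA -scalerBr; apply: Hs.
elim: n {s nQs Hs} => [|n IHn].
  exists 0%N, (fun=> 0%N); split=> // C C' smC smC' CC'; split=> // _ v _ _.
  by exists 1, 0; split; [exact: prime1 | exact: submod0 |].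
apply: finite_colength_trans IHn => //.
have idn : is_ideal (ipow Q' n) by apply: ipow_ideal.
have [k [g [powg geng]]] := noetherian_fg noethR idn.
apply: (@finite_colength_gen R R^o Q' prQ' k g).
- by apply/ideal_submod; apply: prod_ideal_ideal.
- move=> v /geng[a ->]; exists a.
  by rewrite subrr; apply: prod_ideal0.
- move=> q i Q'q; exact: (prod_ideal_mem Q'q (powg i)).
Qed.
End Minimal.

(** Krull's principal ideal theorem.  If Q' were minimal over P + (x), let sy n be the
    n-th symbolic power of Q modulo P.  The ideals sy n + (x) become stationary at Q' by
    finite length, so Nakayama's lemma at Q' gives sy n = sy n.+1; then Nakayama's lemma
    at Q shows that a power of Q is contained in P. *)
Lemma krull_principal P Q Q' x : is_prime P -> is_prime Q -> is_prime Q' ->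
  incl P Q -> ~ incl Q P -> incl Q Q' -> Q' x -> ~ Q x ->
  exists T, [/\ is_prime T, incl P T, incl T Q', T x & ~ incl Q' T].
Proof.
move=> prP prQ prQ' PQ nQP QQ' Q'x nQx; apply: contrapT => nex.
have minQ' T : is_prime T -> incl P T -> incl T Q' -> T x -> incl Q' T.
  by move=> *; apply: contrapT => nQ'T; apply: nex; exists T.
have PQ' : incl P Q' by move=> y /PQ; apply: QQ'.
have idP := prime_is_ideal prP; have idQ := prime_is_ideal prQ.
have idQ' := prime_is_ideal prQ'.
pose sy n y := exists t z, [/\ ~ Q t, ipow Q n z & P (t * y - z)].
have ids n : is_ideal (sy n).
  have idn := ipow_ideal n idQ; split.
  - exists 1, 0; split; [exact: prime1|exact: ideal0|].
    by rewrite mulr0 subr0; apply: ideal0.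
  - move=> a b [t [z [nQt Qz Pz]]] [t' [z' [nQt' Qz' Pz']]].
    exists (t * t'), (t' * z + t * z'); split; first exact: prime_notM.
      by apply: idealD => //; apply: idealM.
    have -> : t * t' * (a + b) - (t' * z + t * z') = t' * (t * a - z) + t * (t' * b - z').
      by ring.
    by apply: idealD => //; apply: idealM.
  - move=> c a [t [z [nQt Qz Pz]]]; exists t, (c * z); split=> //; first exact: idealM.
    have -> : t * (c * a) - c * z = c * (t * a - z) by ring.
    exact: idealM.
have syS n : incl (sy n.+1) (sy n).
  move=> y [t [z [nQt Qz Pz]]]; exists t, z; split=> //.
  exact: ipowS_sub Qz.
have sy_sat n t y : ~ Q t -> sy n (t * y) -> sy n y.
  move=> nQt [u [z [nQu Qz Pz]]]; exists (u * t), z; split=> //; first exact: prime_notM.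
  by rewrite -mulrA.
have Psy n : incl P (sy n).
  move=> y Py; exists 1, 0; split; [exact: prime1|apply: ideal0; exact: ipow_ideal|].
  by rewrite mul1r subr0.
pose L n := adjoin (sy n) x.
have idL n : is_ideal (L n) by apply: adjoin_ideal.
have LS n : incl (L n.+1) (L n).
  by move=> y [a sya]; exists a; apply: syS.
have [l [d [dl Hd]]] := minimal_prime_colength prP prQ' minQ'.
(* The lengths of the L n modulo P + (x) decrease, so that two consecutive ones agree. *)
have HdL n := Hd _ _ ((ideal_submod _).1 (idL n.+1)) ((ideal_submod _).1 (idL n)) (@LS n).
have [n dn] : exists n, d (L n.+1) = d (L n).
  apply: contrapT => /forallNP ne.
  have H n : (d (L n) + n <= l)%N.
    elim: n => [|n IHn]; first by rewrite addn0.
    have := ne n; have [] := HdL n; lia.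
  by have := H l.+1; lia.
have [_ /(_ dn) Heq] := HdL n.
(* x is not in Q, so division by x stays inside the symbolic power. *)
have Hsy y : sy n y -> exists s a, [/\ ~ Q' s, sy n.+1 (s * y - a * x) & sy n a].
  move=> syy; have Ly : L n y by apply: adjoin_incl.
  have [s [c [nQ's [a sya] [b Pb]]]] := Heq y Ly I.
  have H1 : sy n.+1 (s * y - (a + b) * x).
    have -> : s * y - (a + b) * x = (c - a * x) + (s * y - c - b * x) by ring.
    by apply: (idealD (ids n.+1)) => //; exact: (Psy _ _ Pb).
  exists s, (a + b); split=> //.
  apply: (sy_sat _ x) => //.
  have -> : x * (a + b) = s * y - (s * y - (a + b) * x) by ring.
  by apply: idealB => //; [apply: idealM | apply: syS].
have [k [g [syg geng]]] := noetherian_fg noethR (ids n).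
have [|s nQ's Hs] := @local_nakayama R Q' (sy n.+1) k g prQ' (ids n.+1).
  move=> i; have [s [a [nQ's H1 sya]]] := Hsy _ (syg i).
  have [q Eq] := geng _ sya.
  exists s, (fun j => x * q j); split=> //.
    by move=> j; apply: ideal_mulr.
  suff -> : \sum_j x * q j * g j = a * x by [].
  by rewrite Eq mulr_suml; apply: eq_bigr => j _; ring.
have nQs : ~ Q s by move/QQ'.
have sy_eq y : sy n y -> sy n.+1 y.
  move=> /geng[a ->]; apply: ideal_sum => // i _; apply: idealM => //.
  exact: sy_sat (Hs i).
(* In the localisation at Q, the n-th power of Q / P equals the next one, so that
   Nakayama's lemma makes it vanish. *)
have idn := ipow_ideal n idQ.
have [k' [g' [powg' geng']]] := noetherian_fg noethR idn.
have [|t nQt Ht] := @local_nakayama R Q P k' g' prQ idP.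
  move=> i; have /sy_eq[t [z [nQt Qz Pz]]] : sy n (g' i).
    exists 1, (g' i); split=> //; first exact: prime1.
    by rewrite mul1r subrr; apply: ideal0.
  have [q [Qq Eq]] : exists q : 'I_k' -> R, (forall j, Q (q j)) /\ z = \sum_j q j * g' j.
    elim: Qz => [|a b y Qa /geng'[c ->] _ [q [Qq ->]]].
      by exists (fun=> 0); split=> [_|]; [exact: ideal0 | rewrite big1 // => j _; rewrite mul0r].
    exists (fun j => a * c j + q j); split=> [j|].
      by apply: idealD => //; apply: ideal_mulr.
    by rewrite mulr_sumr -big_split; apply: eq_bigr => j _ /=; ring.
  by exists t, q; rewrite -Eq.
have QnP : incl (ipow Q n) P.
  move=> z /geng'[a ->]; apply: ideal_sum => // i _; apply: idealM => //.
  by have /(primeM prP)[/PQ|] := Ht i.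
apply: nQP => y Qy.
have /QnP : ipow Q n (y ^+ n).
  by elim: (n) => [//|m IHm]; rewrite exprS; apply: prod_ideal_mem.
elim: (n) => [/(prime1 prP)//|m IHm].
by rewrite exprS => /(primeM prP)[].
Qed.
End PrincipalIdealTheorem.

(** * Chains of primes and regular sequences *)

Section Height.
Variable R : comPzRingType.
Hypothesis noethR : noetherian R.
Implicit Types (I J P Q : R -> Prop) (C : nat -> R -> Prop).

Definition prime_chain k C : Prop :=
  (forall i, (i <= k)%N -> is_prime (C i)) /\
  forall i, (i < k)%N -> incl (C i) (C i.+1) /\ ~ incl (C i.+1) (C i).

Lemma prime_chain_incl k C i j : prime_chain k C -> (i <= j <= k)%N -> incl (C i) (C j).
Proof.
move=> [_ chC]; elim: j => [|j IHj]; first by rewrite leqn0 => /andP[/eqP-> _] x.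
move=> /andP[]; rewrite leq_eqVlt => /predU1P[-> _ x //|ij] jk x Cx.
have ijk : (i <= j <= k)%N by lia.
exact: (chC j jk).1 _ (IHj ijk _ Cx).
Qed.

Lemma insert_prime P Q Q' x : is_prime P -> is_prime Q -> is_prime Q' ->
  incl P Q -> ~ incl Q P -> incl Q Q' -> ~ incl Q' Q -> Q' x ->
  exists T, [/\ is_prime T, incl P T, ~ incl T P, incl T Q' & ~ incl Q' T /\ T x].
Proof.
move=> prP prQ prQ' PQ nQP QQ' nQ'Q Q'x.
have [Qx|nQx] := pselect (Q x); first by exists Q.
have [T [prT PT TQ' Tx nQ'T]] := krull_principal noethR prP prQ prQ' PQ nQP QQ' Q'x nQx.
by exists T; split=> // TP; apply: nQx; apply: PQ; apply: TP.
Qed.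

(** Given x in the last prime of a chain, all the primes after the first can be moved so
    as to contain x: from the top down, krull_principal replaces C i.+1 by a prime which
    contains x and lies between C i and C i.+2. *)
Lemma move_prime_chain k C x : prime_chain k.+1 C -> C k.+1 x ->
  exists C', [/\ prime_chain k.+1 C', C' 0 = C 0, C' k.+1 = C k.+1 & C' 1 x].
Proof.
elim: k C => [|k IHk] C chC Ckx; first by exists C.
have [prC sC] := chC.
have [s1 n1] := sC k (leqnSn _); have [s2 n2] := sC k.+1 (leqnn _).
have [prk prk1 prk2] : [/\ is_prime (C k), is_prime (C k.+1) & is_prime (C k.+2)].
  by split; apply: prC; lia.
have [T [prT CT nTC TC [nCT Tx]]] := insert_prime prk prk1 prk2 s1 n1 s2 n2 Ckx.
pose D i := if i == k.+1 then T else C i.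
have chD : prime_chain k.+1 D.
  split=> i ik; rewrite /D; first by case: eqP => // _; apply: prC; lia.
  have -> : (i == k.+1) = false by lia.
  by case: eqP => [[->]|_]; [split | apply: sC; lia].
have [|C' [[prC' sC'] C'0 C'k C'1]] := IHk D chD; first by rewrite /D eqxx.
exists (fun i => if i == k.+2 then C k.+2 else C' i); split=> //=.
- split=> i ik; first by case: eqP => // ne; apply: prC'; lia.
  have -> : (i == k.+2) = false by lia.
  rewrite eqSS; case: eqP => [->|ne]; last by apply: sC'; lia.
  by rewrite C'k /D eqxx.
- by rewrite eqxx.
Qed.

Variable p : R -> Prop.
Hypothesis prp : is_prime p.

Definition locally_gen I xs : Prop := local_incl p p (gen I xs).

Lemma locally_gen_cons I x xs : is_ideal I ->
  locally_gen I (x :: xs) -> locally_gen (adjoin I x) xs.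
Proof. by move=> idI gp y /gp[s nps gs]; exists s => //; apply: gen_cons. Qed.

(** The chain of a ring modulo x loses at most one prime.  The top of the chain is first
    replaced by p, which contains x. *)
Lemma prime_chain_top k C I x : prime_chain k.+1 C -> incl (C k.+1) p -> incl I (C 0) ->
  p x -> exists C', [/\ prime_chain k C', incl (C 0) (C' 0), ~ incl (C' 0) (C 0), incl (C' k) p & C' 0 x].
Proof.
move=> [prC sC] Cp IC px.
pose D i := if i == k.+1 then p else C i.
have chD : prime_chain k.+1 D.
  split=> i ik; rewrite /D; first by case: eqP => // _; apply: prC; lia.
  have -> : (i == k.+1) = false by lia.
  have [s1 n1] := sC i ik.
  case: eqP => [[ik1]|_]; last by apply: sC; lia.
  rewrite -ik1 in Cp; split=> [y /s1/Cp//|pC].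
  by apply: n1 => y /Cp/pC.
have [|C' [[prC' sC'] C'0 C'k C'1]] := move_prime_chain chD (x := x).
  by rewrite /D eqxx.
have [s1 n1] := sC' 0 isT; rewrite C'0 in s1 n1.
exists (fun i => C' i.+1); split=> //; last by rewrite C'k /D eqxx.
by split=> i ik; [apply: prC'; lia | apply: sC'; lia].
Qed.

(** Krull's height theorem, by induction on the number of generators: prime_chain_top
    passes to the quotient by the first one. *)
Lemma prime_chain_height xs I k C : is_ideal I -> prime_chain k C ->
  incl (C k) p -> incl I (C 0) -> (forall x, x \in xs -> p x) -> locally_gen I xs ->
  (k <= size xs)%N.
Proof.
elim: xs I k C => [|x xs IHxs] I [|k] C idI chC Cp IC pxs genI //=.
  have [prC sC] := chC; have [_] := sC 0 isT; case=> y C1y.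
  have C1k : incl (C 1) (C k.+1) by apply: (prime_chain_incl chC); rewrite /=.
  have C0k : incl (C 0) (C k.+1) by apply: (prime_chain_incl chC); rewrite /=.
  have [s nps /(gen_nil idI)/IC] := genI _ (Cp _ (C1k _ C1y)).
  case/primeM=> [|C0s|//]; first exact: prC.
  by case: nps; apply: Cp; apply: C0k.
have px : p x by apply: pxs; rewrite inE eqxx.
have [C' [chC' CC' _ C'p C'x]] := prime_chain_top chC Cp IC px.
apply: (IHxs (adjoin I x) _ C') => //; first exact: adjoin_ideal.
- apply: adjoin_sub => //; first by apply: prime_is_ideal; apply: chC'.1.
  by move=> y /IC/CC'.
- by move=> y yxs; apply: pxs; rewrite inE yxs orbT.
- exact: locally_gen_cons.
Qed.

(** The list xs is a regular sequence on the localisation at p of the quotient by I. *)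
Fixpoint locally_regular I xs : Prop := if xs is x :: xs' then
    (forall a, I (a * x) -> exists2 s, ~ p s & I (s * a)) /\ locally_regular (adjoin I x) xs'
  else True.

(** A regular local ring is a domain and its regular systems of parameters are regular
    sequences.  Modulo the first generator x, the shifted chain starts by induction at I
    + (x), locally at p; so this ideal is prime, and C 0, which is contained in it and
    does not contain x, satisfies C 0 = I + x C 0, whence C 0 = I by Nakayama's lemma.
    *)
Lemma prime_chain_regular xs I C : is_ideal I -> prime_chain (size xs) C ->
  incl (C (size xs)) p -> incl I (C 0) -> (forall x, x \in xs -> p x) ->
  locally_gen I xs -> local_incl p (C 0) I /\ locally_regular I xs.
Proof.
elim: xs I C => [|x xs IHxs] I C idI chC Cp IC pxs genI.
  split=> // y /Cp/genI[s nps gs]; exists s => //; exact: gen_nil.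
have px : p x by apply: pxs; rewrite inE eqxx.
have pxs' y : y \in xs -> p y by move=> yxs; apply: pxs; rewrite inE yxs orbT.
have idIx := adjoin_ideal x idI.
have genIx := locally_gen_cons idI genI.
have prC0 : is_prime (C 0) by apply: chC.1.
have idC0 := prime_is_ideal prC0.
(* If C 0 contained x, the chain would be too long for the remaining generators. *)
have [Cx|nCx] := pselect (C 0 x).
  have := prime_chain_height idIx chC Cp (adjoin_sub idC0 IC Cx) pxs' genIx.
  by rewrite ltnn.
have C0p : incl (C 0) p.
  move=> y Cy; apply: Cp; apply: (prime_chain_incl chC) Cy; exact: leqnn.
have [C' [chC' CC' _ C'p C'x]] := prime_chain_top chC Cp IC px.
have idC' : is_ideal (C' 0) by apply: prime_is_ideal; apply: chC'.1.
have [|locC' regC'] := IHxs _ C' idIx chC' C'p _ pxs' genIx.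
  by apply: adjoin_sub => // y /IC/CC'.
have [n [g [Cg geng]]] := noetherian_fg noethR idC0.
have [|s nps Hs] := @local_nakayama R p I n g prp idI.
  move=> i; have [s nps [a Ia]] := locC' _ (CC' _ (Cg i)).
  have /geng[q Eq] : C 0 a.
    have : C 0 (a * x).
      have -> : a * x = s * g i - (s * g i - a * x) by ring.
      by apply: idealB => //; [apply: idealM | apply: IC].
    by case/(primeM prC0).
  exists s, (fun j => x * q j); split=> // [j|].
    by apply: ideal_mulr => //; apply: prime_is_ideal.
  suff -> : \sum_j x * q j * g j = a * x by [].
  by rewrite Eq mulr_suml; apply: eq_bigr => j _; ring.
have locC : local_incl p (C 0) I.
  move=> y /geng[a ->]; exists s => //; rewrite mulr_sumr; apply: ideal_sum => // i _.
  by rewrite mulrCA; apply: idealM.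
split=> //; split=> // a /IC/(primeM prC0)[Ca|//].
exact: locC.
Qed.

(** A generator with a coefficient outside p could be discarded, against
    prime_chain_height. *)
Lemma prime_chain_independent n (g : 'I_n -> R) C : prime_chain n C -> incl (C n) p ->
  (forall i, p (g i)) -> locally_gen (eq 0) (codom g) ->
  forall a : 'I_n -> R, \sum_i a i * g i = 0 -> forall i, p (a i).
Proof.
move=> chC Cp pg gen_g a sum0 i; apply: contrapT => npa.
have idC0 : is_ideal (C 0) by apply: prime_is_ideal; apply: chC.1.
suff : (n <= size (image g (predC1 i)))%N.
  by rewrite size_image cardC1 card_ord; rewrite -ltnS prednK ?ltnn //; apply: leq_ltn_trans (ltn_ord i).
apply: (prime_chain_height (zero_ideal R) chC Cp).
- by move=> _ <-; apply: ideal0.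
- by move=> x /imageP[j _ ->].
- move=> y /gen_g[s nps gs]; exists (a i * s); first exact: prime_notM.
  rewrite -mulrA; apply: (gs (fun z => gen (eq 0) (image g (predC1 i)) (a i * z))) => [|z <-|z /codomP[j ->]].
  + have idg := @gen_ideal R (eq 0) (image g (predC1 i)); split.
    * by rewrite mulr0; apply: (ideal0 idg).
    * by move=> u v gu gv; rewrite mulrDr; apply: (idealD idg).
    * by move=> b u gu; rewrite mulrCA; apply: (idealM idg).
  + by rewrite mulr0; apply: ideal0; apply: gen_ideal.
  have [->|ji] := eqVneq j i; last first.
    apply: (idealM (gen_ideal _ _)); apply: gen_mem; apply/imageP.
    by exists j; rewrite ?inE.
  have -> : a i * g i = - \sum_(k | k != i) a k * g k.
    by move: sum0; rewrite (bigD1 i) //= => /eqP; rewrite addr_eq0 => /eqP.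
  apply: (idealN (gen_ideal _ _)).
  apply: (ideal_sum _ (gen_ideal _ _)) => k ki.
  by apply: (idealM (gen_ideal _ _)); apply: gen_mem; apply/imageP; exists k; rewrite ?inE.
Qed.
End Height.

(** * Primes and generators of the localisation at the augmentation ideal *)

Section Augmentation.
Variables (O : idomainType) (A : comAlgType O) (lam : {rmorphism A -> O}).

(** The augmentation ideal as a Prop-valued predicate. *)
Definition augp : A -> Prop := fun a => lam a = 0.

Lemma augp_prime : is_prime augp.
Proof.
rewrite /augp; split.
- split=> [|x y|a x]; rewrite ?rmorph0 ?rmorphD ?rmorphM //.
    by move=> -> ->; rewrite addr0.
  by move=> ->; rewrite mulr0.
- by rewrite rmorph1; apply/eqP; rewrite oner_neq0.
- move=> x y; rewrite rmorphM => /eqP; rewrite mulf_eq0.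
  by case/orP=> /eqP; [left | right].
Qed.

Let S : mulrClosed A := aug_compl lam.

Lemma aug_complP a : reflect (~ augp a) (a \in S).
Proof. by apply: (iffP idP) => [/eqP|/eqP]. Qed.

Definition loc_embed (a : A) : loc_ring S := lfrac (a : A^o) (den_one S).

Lemma loc_embedD a b : loc_embed (a + b) = loc_embed a + loc_embed b.
Proof.
rewrite /loc_embed lfracD; apply/lfrac_eq; exists 1; first exact: rpred1.
by rewrite !denE !scale1r !mulr1 !scale1r.
Qed.

Lemma loc_mulE (a b : A^o) s t :
  (lfrac a s : loc_ring S) * lfrac b t = lfrac ((a : A) * b : A^o) (den_mul s t).
Proof. exact: loc_scaleE. Qed.

Lemma loc_embedM a b : loc_embed (a * b) = loc_embed a * loc_embed b.
Proof.
rewrite /loc_embed loc_mulE; apply/lfrac_eq; exists 1; first exact: rpred1.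
by rewrite !denE !mulr1.
Qed.

Lemma lfrac_split (a : A^o) s :
  (lfrac a s : loc_ring S) = (lfrac (1 : A^o) s : loc_ring S) * loc_embed a.
Proof.
rewrite /loc_embed loc_mulE; apply/lfrac_eq; exists 1; first exact: rpred1.
by rewrite !denE !mulr1 mul1r.
Qed.

Lemma lfrac_den (a : A^o) s : loc_embed (den s) * (lfrac a s : loc_ring S) = loc_embed a.
Proof.
rewrite /loc_embed loc_mulE; apply/lfrac_eq; exists 1; first exact: rpred1.
rewrite !denE !mul1r !scale1r.
by rewrite -[LHS]scale1r scale1r.
Qed.

Lemma loc_invertible (a : A^o) s : invertible (lfrac a s : loc_ring S) <-> ~ augp a.
Proof.
split=> [[x]|na].
  elim/locP: x => b t; rewrite loc_mulE => /lfrac_eq[u Su].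
  rewrite denE => E pa.
  have : ~ augp (u * (den (den_mul s t) * 1)).
    apply/aug_complP; rewrite !rpredM ?rpred1 //; exact: den_in.
  apply; rewrite /augp; transitivity (lam (u * (1 * (a * b)))); last first.
    by rewrite !rmorphM pa mul0r !mulr0.
  by congr (lam _); exact: (esym E).
have Sa : (a : A) \in S by apply/aug_complP.
exists (lfrac (den s : A^o) (exist _ (a : A) Sa)).
rewrite loc_mulE; apply/lfrac_eq; exists 1; first exact: rpred1.
rewrite !denE; congr (_ *: _).
by change (1 * (a * den s) = (den s * a) * 1 :> A); ring.
Qed.

Variable c : nat.

(** The numerators of generators of the maximal ideal of the localisation. *)
Lemma regular_loc_gen : regular_local_ring (loc_ring S) c ->
  exists g : 'I_c -> A, (forall i, augp (g i)) /\ locally_gen augp (eq 0) (codom g).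
Proof.
case=> _ _ _ [s [szs Hs]].
pose g (i : 'I_c) : A := (lrep (s`_i : loc_ring S)).1.
pose e (i : 'I_c) := (lrep (s`_i : loc_ring S)).2.
have gE (i : 'I_c) : s`_i = lfrac (g i : A^o) (e i) :> loc_ring S by rewrite /g /e lrepK.
exists g; split=> [i|y py].
  apply: contrapT => npg.
  have : s`_i \in nonunits (loc_ring S).
    rewrite Hs; apply/asboolP; exists 1, (fun=> 1), (fun=> s`_i); split=> [_|].
      by apply: mem_nth; rewrite szs.
    by rewrite big_ord1 scale1r.
  by move=> /asboolP; apply; rewrite gE; apply/loc_invertible.
have : loc_embed y \in nonunits (loc_ring S).
  by apply/asboolP => /loc_invertible.
rewrite Hs => /span_seqP[a Ea].
pose good (x : loc_ring S) := exists z t, gen (eq 0) (codom g) z /\ x = lfrac (z : A^o) t.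
have [z [t [gz E]]] : good (loc_embed y).
  rewrite Ea; elim/big_ind: _.
  - by exists 0, (den_one S); split=> //; apply: ideal0; apply: gen_ideal.
  - move=> _ _ [z [t [gz ->]]] [z' [t' [gz' ->]]]; rewrite lfracD.
    exists (den t' * z + den t * z'), (den_mul t t'); split=> //.
    by apply: (idealD (gen_ideal _ _)); apply: (idealM (gen_ideal _ _)).
  - move=> i _; have ic : (i < c)%N by rewrite -szs.
    rewrite (gE (Ordinal ic)); elim/locP: (a i) => b t.
    have -> : (lfrac b t : loc_ring S) *: (lfrac (g (Ordinal ic) : A^o) (e (Ordinal ic)) : (loc_ring S)^o) =
      lfrac ((b : A) * g (Ordinal ic) : A^o) (den_mul t (e (Ordinal ic))) by exact: loc_mulE.
    eexists _, _; split; last reflexivity.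
    by apply: (idealM (gen_ideal _ _)); apply: gen_mem; apply: codom_f.
move/lfrac_eq: E => [u Su E].
exists (u * den t).
  by apply/aug_complP; rewrite rpredM // den_in.
have -> : u * den t * y = u * z.
  rewrite -mulrA -[LHS]/(u *: (den t *: (y : A^o))) E denE.
  by rewrite scale1r.
by apply: (idealM (gen_ideal _ _)).
Qed.

(** The contraction of a maximal chain of primes of the localisation. *)
Lemma regular_loc_chain : regular_local_ring (loc_ring S) c ->
  exists C : nat -> A -> Prop, prime_chain c C /\ incl (C c) augp.
Proof.
case=> _ _ [[C [prC sC]] _] _.
exists (fun i a => loc_embed a \in C i); split; last first.
  move=> a Ca; have [[_ clC] nC1 _] := prC c (leqnn c); apply: contrapT => na.
  have [x Ex] := (loc_invertible (a : A^o) (den_one S)).2 na.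
  move/negP: nC1; apply; rewrite -Ex mulrC.
  have C0 : 0 \in C c by case: (prC c (leqnn c)) => -[].
  by have := clC x _ _ Ca C0; rewrite addr0.
split=> i ic.
  have [[C0 clC] nC1 CM] := prC i ic; split.
  - split.
    + by have -> : loc_embed 0 = 0 by [].
    + move=> x y Cx Cy; rewrite loc_embedD.
      by have := clC 1 _ _ Cx Cy; rewrite scale1r.
    + move=> a x Cx; rewrite loc_embedM.
      by have := clC (loc_embed a) _ _ Cx C0; rewrite addr0.
  - by move/negP: nC1.
  - by move=> x y; rewrite loc_embedM => /CM.
have [sub [x xC nxC]] := sC i ic; split=> [y /sub //|subC].
have clC j : (j <= c)%N -> forall z y : loc_ring S, y \in C j -> z * y \in C j.
  move=> jc z y Cy; have [[C0 cl] _ _] := prC j jc.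
  by have := cl z _ _ Cy C0; rewrite addr0.
move/negP: nxC; apply; move: xC; elim/locP: x => a s xC.
rewrite lfrac_split; apply: (clC _ _); first exact: ltnW.
by apply: subC; rewrite -(lfrac_den a s); apply: (clC _ _).
Qed.
End Augmentation.

(** * Derivations dual to a basis of the cotangent space *)

Section Derivations.
Variables (O : idomainType) (A : comAlgType O) (lam : {rmorphism A -> O}).
Hypotheses (hO : dvr O) (noethA : noetherian A) (lamK : forall x : O, lam x%:A = x).
Variable c : nat.
Variable g : 'I_c -> A.
Local Notation p := (augp lam).
Hypotheses (pg : forall i, p (g i)) (gen_g : locally_gen p (eq 0) (codom g)).
Hypothesis ind_g : forall a : 'I_c -> A, \sum_i a i * g i = 0 -> forall i, p (a i).

Definition derivation (D : A -> O) : Prop :=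
  (forall a b, D (a + b) = D a + D b) /\
  (forall a b, D (a * b) = lam a * D b + lam b * D a).

Lemma augp_sub a : p (a - (lam a)%:A).
Proof. by rewrite /augp rmorphB /= lamK subrr. Qed.

(** The ideal p is finitely generated and contains all differences a - lam a. *)
Lemma uniform_denominator : exists2 s, ~ p s &
  forall a, exists al : 'I_c -> A, s * (a - (lam a)%:A) = \sum_i al i * g i.
Proof.
have prp := augp_prime lam; have idp := prime_is_ideal prp.
have [n [h [ph genh]]] := noetherian_fg noethA idp.
have [|s nps Hs] := local_incl_uniform prp (gen_ideal (eq 0) (codom g)) genh.
  by move=> i; apply: gen_g.
by exists s => // a; apply: gen_sum; apply: Hs; apply: augp_sub.
Qed.

(** The coordinate functions on p / p ^ 2 with respect to the local basis g, multiplied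
    by the common denominator lam s.  They are well defined because the g i are
    independent modulo p, and uniqueness of the coordinates makes them derivations. *)
Lemma cotangent_coordinates : exists s (X : 'I_c -> A -> O), [/\ ~ p s,
  forall i, derivation (X i),
  forall i j, X i (g j) = lam s * (i == j)%:R,
  forall i x, X i x%:A = 0 &
  forall a, p a -> (forall i, X i a = 0) -> prod_ideal p p (s * a)].
Proof.
have [s nps /choice[al alE]] := uniform_denominator.
have uniq a (b : 'I_c -> A) : s * (a - (lam a)%:A) = \sum_i b i * g i ->
    forall i, lam (al a i) = lam (b i).
  rewrite alE => E i; apply/eqP; rewrite -subr_eq0 -rmorphB; apply/eqP.
  apply: (ind_g (a := fun i => al a i - b i)).
  by under eq_bigr do rewrite mulrBl; rewrite sumrB E subrr.
exists s, (fun i a => lam (al a i)); split=> // [i|i j|i x|a pa X0].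
- split=> a b.
    rewrite (uniq (a + b) (fun i => al a i + al b i)) /=; first by rewrite rmorphD.
    under eq_bigr do rewrite mulrDl.
    by rewrite big_split /= -!alE rmorphD scalerDl; ring.
  rewrite (uniq (a * b) (fun i => a * al b i + (lam b)%:A * al a i)) /=.
    by rewrite rmorphD !rmorphM lamK.
  under eq_bigr do rewrite mulrDl -!mulrA.
  rewrite big_split /= -!mulr_sumr -!alE rmorphM.
  have -> : (lam a * lam b)%:A = (lam a)%:A * (lam b)%:A :> A.
    by rewrite -scalerAl mul1r scalerA.
  ring.
- rewrite (uniq (g j) (fun i => s * (i == j)%:R)).
    by rewrite /= rmorphM rmorph_nat.
  rewrite pg scale0r subr0 (bigD1 j) //= eqxx mulr1 big1 ?addr0 // => k /negbTE->.
  by rewrite mulr0 mul0r.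
- rewrite (uniq x%:A (fun=> 0)); first by rewrite rmorph0.
  by rewrite lamK subrr mulr0 big1 // => k _; rewrite mul0r.
have -> : s * a = s * (a - (lam a)%:A) by rewrite pa scale0r subr0.
rewrite alE; apply: ideal_sum => [|i _].
  exact: prod_ideal_ideal (prime_is_ideal (augp_prime lam)).
by apply: prod_ideal_mem => //; exact: X0.
Qed.

(** The ideal generated by the set E is generated by a single member of E: if a
    generates it and every member were a nonunit multiple of a, so would be a itself. *)
Lemma dvr_generator (E : O -> Prop) (e0 : O) : E e0 -> e0 != 0 ->
  exists e, [/\ E e, e != 0 & forall x, E x -> exists t, x = e * t].
Proof.
move=> Ee0 nze0; have [locO _ pidO] := hO.
pose I (x : O) := forall J, is_ideal J -> (forall y, E y -> J y) -> J x.
have idI : is_ideal I.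
  split=> [J idJ _|x y Ix Iy J idJ EJ|a x Ix J idJ EJ]; first exact: ideal0.
    by apply: (idealD idJ); [exact: Ix | exact: Iy].
  by apply: (idealM idJ); exact: Ix.
have [|a Ha] := pidO [pred x : O^o | `[< I x >]].
  split=> [|b x y /asboolP Ix /asboolP Iy]; apply/asboolP; first exact: ideal0.
  by apply: (idealD idI) => //; apply: (idealM idI).
have Ia : I a.
  apply/asboolP; rewrite -[`[< _ >]]/(a \in [pred x : O^o | `[< I x >]]) Ha.
  apply/asboolP; exists 1, (fun=> 1), (fun=> a); split=> [_|]; first by rewrite inE.
  by rewrite big_ord1 scale1r.
have aE x : E x -> exists t, x = a * t.
  move=> Ex; have : x \in [pred x : O^o | `[< I x >]].
    by apply/asboolP => J _ EJ; exact: EJ.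
  rewrite Ha => /asboolP[n [b [t [ta ->]]]]; exists (\sum_i b i).
  rewrite mulr_sumr; apply: eq_bigr => i _.
  by have := ta i; rewrite inE => /eqP->; rewrite mulrC.
have nza : a != 0.
  by have [t E0] := aE _ Ee0; apply: contraNneq nze0 => a0; rewrite E0 a0 mul0r.
have [e [Ee [t Et [u tu]]]] : exists e, E e /\ exists2 t, e = a * t & invertible t.
  apply: contrapT => nex.
  have [n0 nD] := locO.
  have : exists2 t, ~ invertible t & a = a * t.
    apply: (Ia (fun x => exists2 t, ~ invertible t & x = a * t)).
      split.
      - by exists 0; [apply/asboolP | rewrite mulr0].
      - move=> x y [t nt ->] [u nu ->]; exists (t + u); last by rewrite mulrDr.
        have /asboolP := nD 1 t u (asboolT nt) (asboolT nu).
        by rewrite scale1r.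
      - move=> b x [t nt ->]; exists (b * t); last by rewrite mulrCA.
        have /asboolP := nD b t 0 (asboolT nt) n0.
        by rewrite addr0.
    move=> y Ey; have [t Et] := aE y Ey; exists t => // it.
    by apply: nex; exists y; split=> //; exists t.
  case=> t nt Eat; apply: nt; exists 1; rewrite mulr1.
  by apply: (mulfI nza); rewrite -Eat mulr1.
exists e; split=> // [|x Ex].
  rewrite Et mulf_neq0 //; apply: contra_eq_neq tu => ->.
  by rewrite mul0r eq_sym oner_neq0.
have [v ->] := aE x Ex; exists (u * v).
by rewrite Et mulrA -[a * t * u]mulrA tu mulr1.
Qed.

(** The matrices of coordinates of families in p have determinants in O.  A family f
    whose determinant delta divides all others is a basis of the torsion-free quotient
    of p / p ^ 2: by Cramer's rule the coordinates of a with respect to f are quotients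
    by delta of determinants of other families, hence lie in O. *)
Lemma dual_derivations : exists (f : 'I_c -> A) (D : 'I_c -> A -> O), [/\
  forall i, p (f i), locally_gen p (eq 0) (codom f),
  forall i, derivation (D i) & forall i j, D i (f j) = (i == j)%:R].
Proof.
have prp := augp_prime lam; have idp := prime_is_ideal prp.
have [s [X [nps derX Xg XK kerX]]] := cotangent_coordinates.
pose mx (v : 'I_c -> A) := \matrix_(i, j) X j (v i).
pose E x := exists2 v, (forall i, p (v i)) & x = \det (mx v).
have lams : lam s != 0 by apply/eqP.
have [||delta [[f pf Ed] nzd Hd]] := @dvr_generator E (\det (mx g)); first by exists g.
  have -> : mx g = (lam s)%:M.
    by apply/matrixP=> i j; rewrite !mxE Xg mulr_natr eq_sym.
  by rewrite det_scalar expf_neq0.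

have X0 i : X i 0 = 0.
  by have := (derX i).1 0 0; rewrite addr0 => /eqP; rewrite -subr_eq subrr => /eqP.
have Xsum i (T : finType) (F : T -> A) : X i (\sum_k F k) = \sum_k X i (F k).
  by elim/big_rec2: _ => // k x y _ <-; rewrite (derX i).1.
have Xp i a b : p b -> X i (a * b) = lam a * X i b.
  by move=> pb; rewrite (derX i).2 pb mul0r addr0.
(* Replacing f i by a - lam a in the family multiplies delta by an element of O. *)
have Dex i a : exists t, \sum_j X j a * cofactor (mx f) i j = delta * t.
  pose v k := if k == i then a - (lam a)%:A else f k.
  have -> : \sum_j X j a * cofactor (mx f) i j = \det (mx v).
    rewrite (expand_det_row _ i); apply: eq_bigr => j _.
    rewrite mxE /v eqxx; congr (_ * _).
      by rewrite (derX j).1 -scaleNr XK addr0.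
    rewrite /cofactor; congr (_ * \det _).
    by apply/matrixP=> k l; rewrite !mxE eq_sym (negbTE (neq_lift _ _)).
  apply: Hd; exists v => // k; rewrite /v.
  by case: eqP => // _; apply: augp_sub.
have /choice[D DE] : forall i, exists Di : A -> O, forall a,
    \sum_j X j a * cofactor (mx f) i j = delta * Di a.
  by move=> i; have /choice[Di] := Dex i; exists Di.
exists f, D; split=> //.
(* Cramer's rule: X a is the combination of the X (f i) with coefficients D i a, so
   that h k minus the same combination of the f i lies in p ^ 2 locally. *)
- have XD a j : X j a = \sum_i D i a * X j (f i).
    pose xa := \row_k X k a; pose da := \row_i D i a.
    have E1 : xa *m \adj (mx f) = delta *: da.
      apply/rowP=> i; rewrite !mxE -DE; apply: eq_bigr => k _.
      by rewrite !mxE.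
    have : delta *: xa = delta *: (da *m mx f).
      by rewrite scalemxAl -E1 -mulmxA mul_adj_mx -Ed mul_mx_scalar.
    move=> /rowP/(_ j); rewrite !mxE => /(mulfI nzd) ->.
    by apply: eq_bigr => i _; rewrite !mxE.
  have [n [h [ph genh]]] := noetherian_fg noethA idp.
  have [|t npt Ht] := @local_nakayama A p (gen (eq 0) (codom f)) n h prp (gen_ideal _ _).
    move=> k; pose b := h k - \sum_i (D i (h k))%:A * f i.
    have pb : p b.
      apply: idealB => //; apply: ideal_sum => // i _; exact: idealM.
    have Xb j : X j b = 0.
      have XN x : X j (- x) = - X j x.
        by apply/eqP; rewrite -addr_eq0 -(derX j).1 addNr X0.
      rewrite (derX j).1 XN Xsum {1}XD; apply/eqP; rewrite subr_eq0; apply/eqP.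
      by apply: eq_bigr => i _; rewrite Xp // lamK.
    have [q [pq Eq]] : exists q : 'I_n -> A, (forall j, p (q j)) /\ s * b = \sum_j q j * h j.
      have := kerX b pb Xb; elim=> [|x y z px /genh[r ->] _ [q [pq ->]]].
        by exists (fun=> 0); split=> [_|]; [exact: ideal0 | rewrite big1 // => j _; rewrite mul0r].
      exists (fun j => x * r j + q j); split=> [j|].
        by apply: idealD => //; apply: ideal_mulr.
      by rewrite mulr_sumr -big_split; apply: eq_bigr => j _ /=; ring.
    exists s, q; split=> //; rewrite -Eq.
    have -> : s * h k - s * b = \sum_i (s * (D i (h k))%:A) * f i.
      rewrite -mulrBr /b opprB addrC subrK mulr_sumr.
      by apply: eq_bigr => i _; ring.
    exact: sum_gen.
  move=> y py; have [u npu Hu] := local_incl_uniform prp (gen_ideal (eq 0) (codom f)) genh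
    (fun i => ex_intro2 _ _ t npt (Ht i)).
  by exists u => //; apply: Hu.
- move=> i; split=> a b; apply: (mulfI nzd); rewrite -DE.
    rewrite mulrDr -!DE -big_split; apply: eq_bigr => j _ /=.
    by rewrite (derX j).1 mulrDl.
  rewrite mulrDr !(mulrCA delta) -!DE !mulr_sumr -big_split; apply: eq_bigr => j _ /=.
  by rewrite (derX j).2; ring.
move=> i j; apply: (mulfI nzd); rewrite -DE.
have := mul_mx_adj (mx f) => /matrixP/(_ j i); rewrite -Ed !mxE => E1.
rewrite mulr_natr eq_sym -E1; apply: eq_bigr => k _.
by rewrite !mxE.
Qed.
End Derivations.

Section Quotient.
Variables (O : idomainType) (A B : comAlgType O).
Variables (lamA : {rmorphism A -> O}) (lamB : {rmorphism B -> O}).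
Variable phi : {lrmorphism A -> B}.
Hypotheses (phi_lam : forall a, lamB (phi a) = lamA a).
Hypothesis phi_surj : forall b, exists a, phi a = b.

Lemma pullback_prime (P : B -> Prop) : is_prime P -> is_prime (fun a => P (phi a)).
Proof.
move=> [[P0 PD PM] P1 PP]; split.
- split=> [|x y|a x]; rewrite ?rmorph0 ?rmorphD ?rmorphM //; [exact: PD | exact: PM].
- by rewrite rmorph1.
- by move=> x y; rewrite rmorphM; apply: PP.
Qed.

Lemma pullback_chain k (C : nat -> B -> Prop) : prime_chain k C ->
  prime_chain k (fun i a => C i (phi a)).
Proof.
move=> [prC sC]; split=> i ik; first exact: pullback_prime (prC i ik).
have [s1 n1] := sC i ik; split=> [a|sub]; first exact: s1.
by apply: n1 => b; have [a <-] := phi_surj b; apply: sub.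
Qed.

(** O is torsion free, so that a derivation vanishes on the torsion ideal ker phi. *)
Lemma derivation_descent (D : A -> O) : derivation lamA D ->
  (forall a, phi a = 0 -> exists2 s, ~ augp lamA s & s * a = 0) ->
  exists2 D' : B -> O, derivation lamB D' & forall a, D' (phi a) = D a.
Proof.
move=> [DD DM] torJ.
have D0 : D 0 = 0.
  by have := DD 0 0; rewrite addr0 => /eqP; rewrite -subr_eq subrr => /eqP.
have DJ a : phi a = 0 -> D a = 0.
  move=> phia; have [s /eqP nps sa] := torJ a phia.
  have := DM s a; rewrite sa D0 -phi_lam -[lamA a]phi_lam phia rmorph0 mul0r addr0.
  by rewrite phi_lam => /esym/eqP; rewrite mulf_eq0 (negbTE nps) => /eqP.
have DN a : D (- a) = - D a by apply/eqP; rewrite -addr_eq0 -DD addNr D0.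
have [r rK] := choice phi_surj.
have rE a : D (r (phi a)) = D a.
  by apply/eqP; rewrite -subr_eq0 -DN -DD DJ // rmorphB /= rK subrr.
exists (D \o r) => //; split=> a b /=.
  by rewrite -DD -[RHS]rE rmorphD /= !rK.
by rewrite -[in lamB a](rK a) -[in lamB b](rK b) !phi_lam -DM -[RHS]rE rmorphM /= !rK.
Qed.
End Quotient.

(** * Complexes of free modules, cones and cochains *)

Record complex (R : comPzRingType) := Complex {
  crk : nat -> nat;
  cdf : forall i, 'M[R]_(crk i.+1, crk i) }.

Section Complexes.
Variable R : comPzRingType.
Implicit Types C D : complex R.

Definition is_complex C := forall i, cdf C i.+1 *m cdf C i = 0.

Definition chain_map C D (t : forall i, 'M[R]_(crk C i, crk D i)) :=
  forall i, cdf C i *m t i = t i.+1 *m cdf D i.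

Section Cone.
Variables (C D : complex R) (t : forall i, 'M[R]_(crk C i, crk D i)).

Definition cone_rk i : nat := if i is n.+1 then (crk C n + crk D n.+1)%N else crk D 0.

Definition cone_df i : 'M[R]_(cone_rk i.+1, cone_rk i) :=
  match i with
  | 0 => col_mx (t 0) (cdf D 0)
  | n.+1 => block_mx (- cdf C n) (t n.+1) 0 (cdf D n.+1)
  end.

(** The mapping cone, with C n and D n.+1 in degree n.+1.  Row vectors are multiplied by
    the differentials on the right. *)
Definition cone : complex R := Complex cone_df.

Hypotheses (cC : is_complex C) (cD : is_complex D) (tP : chain_map t).

Lemma cone_complex : is_complex cone.
Proof.
case=> [|n] /=.
  rewrite -[LHS]/(block_mx _ _ _ _ *m col_mx _ _) mul_block_col.
  by rewrite mulNmx tP addNr mul0mx add0r cD col_mx0.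
rewrite -[LHS]/(block_mx _ _ _ _ *m block_mx _ _ _ _) mulmx_block.
rewrite !mul0mx !mulmx0 !add0r !addr0 cD mulNmx mulmxN opprK cC.
by rewrite mulNmx tP addNr block_mx0.
Qed.
End Cone.

(** In degree 0 every vector counts as a cycle, so that this says that a complex has
    torsion homology, H_0 included. *)
Definition cycles_torsion (S : R -> Prop) C i : Prop :=
  match i with
  | 0 => forall v : 'rV_(crk C 0), exists s w, S s /\ s *: v = w *m cdf C 0
  | n.+1 => forall v : 'rV_(crk C n.+1), v *m cdf C n = 0 ->
      exists s w, S s /\ s *: v = w *m cdf C n.+1
  end.

Lemma cycles_torsion_sub (S S' : R -> Prop) C i : (forall s, S s -> S' s) ->
  cycles_torsion S C i -> cycles_torsion S' C i.
Proof.
move=> SS'; case: i => [|i] H v; last move=> vd.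
  by have [s [w [Ss E]]] := H v; exists s, w; split=> //; apply: SS'.
by have [s [w [Ss E]]] := H v vd; exists s, w; split=> //; apply: SS'.
Qed.

Definition mul_closed (S : R -> Prop) := S 1 /\ forall s t, S s -> S t -> S (s * t).

Section ConeTorsion.
Variables (S : R -> Prop) (C D : complex R) (t : forall i, 'M[R]_(crk C i, crk D i)).
Hypotheses (S1 : S 1) (SM : forall s t, S s -> S t -> S (s * t)) (tP : chain_map t).

Lemma cone_cycles0 :
  (forall y : 'rV_(crk D 0), exists x w, y = x *m t 0 + w *m cdf D 0) ->
  cycles_torsion S (cone t) 0.
Proof.
move=> H y; have [x [w ->]] := H y; exists 1, (row_mx x w); split=> //.
by rewrite scale1r -[RHS]/(row_mx _ _ *m col_mx _ _) mul_row_col.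
Qed.

Lemma cone_cycles1 :
  (forall x : 'rV_(crk C 0), (exists y, x *m t 0 = y *m cdf D 0) ->
     exists s w, S s /\ s *: x = w *m cdf C 0) ->
  cycles_torsion S D 1 -> cycles_torsion S (cone t) 1.
Proof.
move=> HC HD v; rewrite -[v]hsubmxK; set x := lsubmx v; set y := rsubmx v.
rewrite -[X in X = 0]/(row_mx _ _ *m col_mx _ _) mul_row_col => E.
have [|s [w [Ss Es]]] := HC x.
  by exists (- y); rewrite mulNmx; apply/eqP; rewrite -addr_eq0 E.
have [|s' [w' [Ss' Es']]] := HD (s *: y + w *m t 1).
  rewrite mulmxDl -mulmxA -tP mulmxA -Es -!scalemxAl -scalerDr addrC E.
  by rewrite scaler0.
exists (s' * s), (row_mx (- (s' *: w)) w'); split; first exact: SM.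
rewrite -[RHS]/(row_mx _ _ *m block_mx _ _ _ _) mul_row_block mulmx0 addr0.
rewrite mulNmx mulmxN opprK -Es' !mulNmx -!scalemxAl -Es scale_row_mx !scalerA.
by rewrite scalerDr scalerA addrC addrK.
Qed.

Lemma cone_cycles n : cycles_torsion S C n.+1 -> cycles_torsion S D n.+2 ->
  cycles_torsion S (cone t) n.+2.
Proof.
move=> HC HD v; rewrite -[v]hsubmxK; set x := lsubmx v; set y := rsubmx v.
rewrite -[X in X = 0]/(row_mx _ _ *m block_mx _ _ _ _) mul_row_block mulmx0 addr0.
move=> /eqP; rewrite row_mx_eq0 => /andP[/eqP E1 /eqP E2].
have [|s [w [Ss Es]]] := HC x.
  by apply/eqP; rewrite -oppr_eq0 -mulmxN E1.
have [|s' [w' [Ss' Es']]] := HD (s *: y + w *m t n.+2).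
  rewrite mulmxDl -mulmxA -tP mulmxA -Es -!scalemxAl -scalerDr addrC E2.
  by rewrite scaler0.
exists (s' * s), (row_mx (- (s' *: w)) w'); split; first exact: SM.
rewrite -[RHS]/(row_mx _ _ *m block_mx _ _ _ _) mul_row_block mulmx0 addr0.
rewrite mulNmx mulmxN opprK -Es' !mulNmx -!scalemxAl -Es scale_row_mx !scalerA.
by rewrite scalerDr scalerA addrC addrK.
Qed.
End ConeTorsion.

(** The multipliers of the finitely many rows are multiplied together. *)
Lemma common_denominator (S : R -> Prop) m n k (Z : 'M[R]_(m, n)) (d : 'M[R]_(k, n)) :
  mul_closed S ->
  (forall i, exists s w, S s /\ s *: row i Z = w *m d) ->
  exists s h, S s /\ s *: Z = h *m d.
Proof.
move=> [S1 SM] /choice[s /choice[w sw]].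
exists (\prod_i s i), (\matrix_i ((\prod_(j | j != i) s j) *: w i)); split.
  by elim/big_ind: _ => // i _; case: (sw i).
apply/row_matrixP=> i; rewrite row_mul rowK linearZ -scalemxAl.
by rewrite -(sw i).2 scalerA mulrC (bigD1 i).
Qed.

(** The rows of s * a - d h are cycles, so that multiples of them are boundaries. *)
Lemma homotopy_of_torsion S C a n : mul_closed S -> is_complex C ->
  (exists s h, S s /\ (s * a) *: cdf C n = cdf C n *m h *m cdf C n) ->
  cycles_torsion S C n.+1 ->
  exists s h h', S s /\ (s * a)%:M = cdf C n *m h + h' *m cdf C n.+1.
Proof.
move=> clS cC [s [h [Ss E]]] torC.
have [|s' [h' [Ss' E']]] :=
    @common_denominator S _ _ _ ((s * a)%:M - cdf C n *m h) (cdf C n.+1) clS.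
  move=> i; apply: torC; rewrite -row_mul mulmxBl mul_scalar_mx E.
  by rewrite subrr row0.
exists (s' * s), (s' *: h), h'; split; first by case: clS => _; apply.
by rewrite -E' -scalemxAr -scalerDr addrC subrK scale_scalar_mx mulrA.
Qed.

(** If the homology of C is torsion and a kills H_0 up to S, some multiple of a is
    homotopic to zero in each degree.  The induction only carries the identity obtained
    from the homotopy relation by multiplying it with the differential, which eliminates
    the previous component of the homotopy. *)
Lemma torsion_homotopy S C a n : mul_closed S -> is_complex C ->
  (forall v : 'rV_(crk C 0), exists s w, S s /\ s *: (a *: v) = w *m cdf C 0) ->
  (forall i, (i <= n)%N -> cycles_torsion S C i.+1) ->
  exists s h h', S s /\ (s * a)%:M = cdf C n *m h + h' *m cdf C n.+1.
Proof.
move=> clS cC tor0 torC; apply: homotopy_of_torsion => //; last exact: torC.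
elim: n torC => [|n IHn] torC.
  have [|s [h [Ss E]]] := @common_denominator S _ _ _ a%:M (cdf C 0) clS.
    by move=> i; have [s [w [Ss E]]] := tor0 (row i 1%:M); exists s, w;
      rewrite -scalemx1 linearZ.
  exists s, h; split=> //.
  by rewrite -mulmxA -E -scalemxAr mul_mx_scalar scalerA.
have /IHn IH : forall i, (i <= n)%N -> cycles_torsion S C i.+1 by move=> i /leqW; apply: torC.
have [s [h [h' [Ss E]]]] := homotopy_of_torsion clS cC IH (torC n (leqnSn n)).
exists s, h'; split=> //.
have := congr1 (mulmx (cdf C n.+1)) E.
by rewrite mul_mx_scalar mulmxDr mulmxA cC mul0mx add0r mulmxA.
Qed.
End Complexes.

Section Cochains.
Variables (R : comPzRingType) (M : lmodType R).
Implicit Types (W : M -> Prop) (C : complex R).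

Lemma hom_mapM m n k (d : 'M[R]_(m, n)) (e : 'M[R]_(n, k)) (f : {ffun 'I_k -> M}) :
  hom_map (d *m e) f = hom_map d (hom_map e f).
Proof.
apply/ffunP=> i; rewrite !ffunE; under eq_bigr do rewrite mxE scaler_suml.
rewrite exchange_big /=; apply: eq_bigr => j _; rewrite ffunE scaler_sumr.
by apply: eq_bigr => l _; rewrite scalerA.
Qed.

Lemma hom_mapD m n (d e : 'M[R]_(m, n)) (f : {ffun 'I_n -> M}) :
  hom_map (d + e) f = hom_map d f + hom_map e f.
Proof.
apply/ffunP=> i; rewrite !ffunE -big_split; apply: eq_bigr => j _.
by rewrite mxE scalerDl.
Qed.

Lemma hom_mapZ m n a (d : 'M[R]_(m, n)) (f : {ffun 'I_n -> M}) :
  hom_map (a *: d) f = a *: hom_map d f.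
Proof.
apply/ffunP=> i; rewrite !ffunE scaler_sumr; apply: eq_bigr => j _.
by rewrite mxE scalerA.
Qed.

Lemma hom_mapN m n (d : 'M[R]_(m, n)) (f : {ffun 'I_n -> M}) :
  hom_map (- d) f = - hom_map d f.
Proof. by rewrite -scaleN1r hom_mapZ scaleN1r. Qed.

Lemma hom_map1 n (f : {ffun 'I_n -> M}) : hom_map 1%:M f = f.
Proof.
apply/ffunP=> i; rewrite ffunE (bigD1 i) //= mxE eqxx scale1r big1 ?addr0 // => j.
by rewrite mxE eq_sym => /negbTE->; rewrite scale0r.
Qed.

Lemma hom_map0 m n (f : {ffun 'I_n -> M}) : hom_map (0 : 'M[R]_(m, n)) f = 0.
Proof. by rewrite -(scale0r (0 : 'M[R]_(m, n))) hom_mapZ scale0r. Qed.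

Definition all_in n W (f : {ffun 'I_n -> M}) : Prop := forall k, W (f k).

(** Cochains that are coboundaries modulo W.  In degree 0 the only coboundary is 0. *)
Definition coboundary W C i : {ffun 'I_(crk C i) -> M} -> Prop :=
  match i with
  | 0 => fun g => all_in W g
  | j.+1 => fun g => exists v, all_in W (g - hom_map (cdf C j) v)
  end.

Section Submodule.
Variable W : M -> Prop.
Hypothesis smW : is_submod W.

Lemma all_in0 n : all_in W (0 : {ffun 'I_n -> M}).
Proof. by move=> k; rewrite ffunE; apply: submod0. Qed.

Lemma all_inD n (f g : {ffun 'I_n -> M}) : all_in W f -> all_in W g -> all_in W (f + g).
Proof. by move=> Wf Wg k; rewrite ffunE; apply: submodD. Qed.

Lemma all_inZ n a (f : {ffun 'I_n -> M}) : all_in W f -> all_in W (a *: f).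
Proof. by move=> Wf k; rewrite ffunE; apply: submodZ. Qed.

Lemma all_inB n (f g : {ffun 'I_n -> M}) : all_in W f -> all_in W g -> all_in W (f - g).
Proof. by move=> Wf Wg; apply: all_inD => //; rewrite -scaleN1r; apply: all_inZ. Qed.

Lemma all_in_hom m n (d : 'M[R]_(m, n)) (f : {ffun 'I_n -> M}) :
  all_in W f -> all_in W (hom_map d f).
Proof.
move=> Wf k; rewrite ffunE; elim/big_ind: _ => [|x y|i _].
- exact: submod0.
- exact: submodD.
- exact: submodZ.
Qed.

Lemma coboundaryD C i (f g : {ffun 'I_(crk C i) -> M}) :
  coboundary W f -> coboundary W g -> coboundary W (f + g).
Proof.
case: i f g => [|i] f g /=; first exact: all_inD.
move=> [u Wu] [v Wv]; exists (u + v).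
by rewrite linearD opprD addrACA; apply: all_inD.
Qed.

Lemma coboundaryZ C i a (f : {ffun 'I_(crk C i) -> M}) :
  coboundary W f -> coboundary W (a *: f).
Proof.
case: i f => [|i] f /=; first exact: all_inZ.
by move=> [u Wu]; exists (a *: u); rewrite linearZ -scalerBr; apply: all_inZ.
Qed.

Lemma coboundary_in C i (f : {ffun 'I_(crk C i) -> M}) :
  all_in W f -> coboundary W f.
Proof. by case: i f => [//|i] f Wf; exists 0; rewrite linear0 subr0. Qed.

(** A homotopy from s to 0 on C turns s times a cocycle into a coboundary; the values
    are taken modulo W instead of in a quotient module. *)
Lemma cocycle_torsion S C n (g : {ffun 'I_(crk C n) -> M}) :
  mul_closed S -> is_complex C -> (forall i, (i <= n)%N -> cycles_torsion S C i) ->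
  all_in W (hom_map (cdf C n) g) -> exists2 s, S s & coboundary W (s *: g).
Proof.
move=> clS cC; case: n g => [|n] g torC Wg.
  have [|s [h [Ss E]]] := @common_denominator _ S _ _ _ 1%:M (cdf C 0) clS.
    by move=> i; apply: (torC 0).
  exists s => //=; rewrite -[g]hom_map1 -hom_mapZ E hom_mapM.
  exact: all_in_hom.
have [|s [h [h' [Ss E]]]] := torsion_homotopy (a := 1) (n := n) clS cC _ (fun i => torC i.+1).
  by move=> v; rewrite scale1r; apply: (torC 0%N).
exists s => //; exists (hom_map h g).
have -> : s *: g = hom_map (s * 1)%:M g by rewrite -scalemx1 hom_mapZ hom_map1 mulr1.
rewrite E hom_mapD !hom_mapM addrC addKr.
exact: all_in_hom.
Qed.
End Submodule.
End Cochains.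

Section Depth.
Variables (R : comPzRingType) (M : lmodType R).

Lemma span_sub (S : {pred M}) (T : M -> Prop) : is_submod T ->
  (forall v, v \in S -> T v) -> forall v, v \in span S -> T v.
Proof.
move=> smT ST _ /asboolP[n [a [t [St ->]]]]; elim/big_ind: _ => [|x y|i _].
- exact: submod0.
- exact: submodD.
- by apply: submodZ => //; apply: ST.
Qed.

Lemma smul_submod (I : {pred R}) (N : {pred M}) : is_submod (fun m => m \in smul I N).
Proof. by split=> [|u v|a v]; [exact: rpred0 | exact: rpredD | exact: rpredZ]. Qed.

Lemma smul_mem (I : {pred R}) (N : {pred M}) a m :
  a \in I -> m \in N -> a *: m \in smul I N.
Proof.
move=> Ia Nm; apply/asboolP; exists 1, (fun=> 1), (fun=> a *: m); split=> [_|].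
  by apply/asboolP; exists a, m.
by rewrite big_ord1 scale1r.
Qed.

Lemma smul_sub (I : {pred R}) (N : {pred M}) (T : M -> Prop) : is_submod T ->
  (forall a m, a \in I -> m \in N -> T (a *: m)) -> forall m, m \in smul I N -> T m.
Proof.
move=> smT IT; apply: span_sub => // v /asboolP[a [m [Ia Nm ->]]].
exact: IT.
Qed.

Variable s : seq R.
Let W k (m : M) := m \in smul (mem (take k s)) predT.

Let smW k : is_submod (W k). Proof. exact: smul_submod. Qed.

Lemma seq_smulS k m : (k < size s)%N -> W k.+1 m <-> exists m', W k (m - s`_k *: m').
Proof.
move=> ks.
have inS a : (a \in mem (take k.+1 s)) = (a == s`_k) || (a \in mem (take k s)).
  by rewrite (take_nth 0 ks) -[LHS]/(a \in rcons _ _) mem_rcons inE.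
split=> [|[m' Wm]].
  move: m; apply: smul_sub; first split.
  - by exists 0; rewrite scaler0 subr0; apply: (submod0 (smW k)).
  - move=> u v [u' Wu] [v' Wv]; exists (u' + v').
    by rewrite scalerDr opprD addrACA; apply: (submodD (smW k)).
  - move=> a v [v' Wv]; exists (a *: v').
    by rewrite scalerA mulrC -scalerA -scalerBr; apply: (submodZ (smW k)).
  move=> a m; rewrite inS => /predU1P[->|ain] _.
    by exists m; rewrite subrr; apply: (submod0 (smW k)).
  by exists 0; rewrite scaler0 subr0; apply: smul_mem.
rewrite -[m](subrK (s`_k *: m')); apply: (submodD (smW k.+1)).
  move: Wm; apply: (smul_sub (smW k.+1)) => a v ain _; apply: smul_mem => //.
  by rewrite inS ain orbT.
apply: smul_mem => //.
by rewrite inS eqxx.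
Qed.

Hypothesis regs : forall i, (i < size s)%N -> forall m : M, W i (s`_i *: m) -> W i m.

Variable E : complex R.
Hypothesis cE : is_complex E.
Hypothesis exE : forall i, (i <= 1)%N -> cycles_torsion (eq 1) E i.
Hypothesis torE : forall y, y \in s -> forall i,
  cycles_torsion (fun x => exists n, x = y ^+ n) E i.

(** Vanishing of cohomology below degree n + 2 with values in M modulo the first k
    elements of a regular sequence, when n further elements remain.  Some power of the
    next element y kills a given class; if y ^ N.+1 * g is the coboundary of v, then v
    is a cocycle modulo y, hence by induction a coboundary up to y * v', and regularity
    of y shows that y ^ N * g is the coboundary of v'. *)
Lemma depth_coboundary n k i (g : {ffun 'I_(crk E i) -> M}) :
  (i < n.+2)%N -> (k + n <= size s)%N ->
  all_in (W k) (hom_map (cdf E i) g) -> coboundary (W k) g.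
Proof.
have closed1 : mul_closed (eq (1 : R)) by split=> // _ _ <- <-; rewrite mulr1.
elim: n k i g => [|n IHn] k i g lei lek Wg.
  have [|s1 <-] := cocycle_torsion (smW k) closed1 cE _ Wg.
    by move=> j ji; apply: exE; lia.
  by rewrite scale1r.
case: i g lei Wg => [|i] g lei Wg; first by apply: (IHn k 0%N g) => //; lia.
have ks : (k < size s)%N by lia.
have [||y] := cocycle_torsion (S := fun x => exists n, x = s`_k ^+ n) (smW k) _ cE _ Wg.
- by split; [exists 0%N | move=> _ _ [a ->] [b ->]; exists (a + b)%N; rewrite exprD].
- by move=> j _; apply: torE; apply: mem_nth.
case=> N ->; elim: N => [|N IHN]; first by rewrite scale1r.
case=> v Wv; apply: IHN.
(* The coboundary of v is s`_k ^ N.+1 *: g modulo W k, so v is a cocycle modulo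
   W k.+1, to which the induction hypothesis applies in one degree less. *)
have Wv1 : all_in (W k.+1) (hom_map (cdf E i) v).
  move=> j; apply/(seq_smulS _ ks); exists ((s`_k ^+ N *: g) j).
  have := submodN (smW k) (Wv j).
  by rewrite !ffunE opprB scalerA -exprS.
have [w [Ww dw]] : exists w, all_in (W k.+1) (v - w) /\ hom_map (cdf E i) w = 0.
  have : coboundary (W k.+1) v by apply: IHn => //; lia.
  case: i {g lei Wg Wv Wv1} v => [|i] v /= => [Wv|[w Ww]].
    by exists 0; rewrite subr0 linear0.
  exists (hom_map (cdf E i) w); split=> //.
  by rewrite -hom_mapM cE hom_map0.
have /choice[v' Wv'] : forall j, exists m', W k ((v - w) j - s`_k *: m').
  by move=> j; apply/(seq_smulS _ ks)/Ww.
exists (finfun v') => j; apply: (regs ks).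
have -> : s`_k *: (s`_k ^+ N *: g - hom_map (cdf E i) (finfun v')) j =
    (s`_k ^+ N.+1 *: g - hom_map (cdf E i) v) j + hom_map (cdf E i) (v - w - s`_k *: finfun v') j.
  rewrite !linearB /= dw subr0 linearZ !ffunE scalerBr scalerA -exprS.
  by rewrite addrA subrK.
apply: (submodD (smW k)); first exact: Wv.
apply: (all_in_hom (smW k)) => l; rewrite !ffunE.
by have := Wv' l; rewrite !ffunE.
Qed.
End Depth.

(** * Resolutions up to torsion and their base change *)

Section Resolutions.
Variables (O : idomainType) (A : comAlgType O) (lam : {rmorphism A -> O}).
Hypothesis lamK : forall x : O, lam x%:A = x.
Implicit Types C D K : complex A.

(** A homomorphism from a free module to O is given by the column eps of its values on
    the basis, applied after lam. *)
Record augmented C (eps : 'cV[O]_(crk C 0)) : Prop := Augmented {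
  aug_complex : is_complex C;
  aug_diff : map_mx lam (cdf C 0) *m eps = 0;
  aug_surj : exists v : 'rV_(crk C 0), map_mx lam v *m eps = 1 }.

(** C resolves O up to multipliers in S; exact resolutions are the case of S = eq 1. *)
Record resolution_up_to (S : A -> Prop) C eps : Prop := ResolutionUpTo {
  res_aug : @augmented C eps;
  res_exact0 : forall v : 'rV_(crk C 0), map_mx lam v *m eps = 0 ->
    exists s w, S s /\ s *: v = w *m cdf C 0;
  res_exact : forall i, cycles_torsion S C i.+1 }.

Lemma resolution_up_to_sub (S S' : A -> Prop) C eps : (forall s, S s -> S' s) ->
  @resolution_up_to S C eps -> @resolution_up_to S' C eps.
Proof.
move=> SS' [aC ex0 ex]; split=> // [v /ex0[s [w [Ss E]]]|i].
  by exists s, w; split=> //; apply: SS'.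
exact: cycles_torsion_sub (ex i).
Qed.

Definition free_complex (F : free_resolution (residue lam)) : complex A :=
  Complex (fr_diff F).

Definition free_eps (F : free_resolution (residue lam)) : 'cV[O]_(fr_rank F 0) :=
  \col_i (fr_aug F (delta_mx 0 i) : O).

Lemma free_epsE (F : free_resolution (residue lam)) (v : 'rV_(fr_rank F 0)) :
  map_mx lam v *m free_eps F = (fr_aug F v : O)%:M.
Proof.
apply/matrixP=> i j; rewrite !ord1 mxE [in RHS]mxE eqxx mulr1n.
rewrite [v in RHS]row_sum_delta linear_sum; apply: eq_bigr => k _.
by rewrite linearZ !mxE.
Qed.

Lemma free_resolutionP (F : free_resolution (residue lam)) :
  resolution_up_to (eq 1) (free_eps F : 'cV_(crk (free_complex F) 0)).
Proof.
split; first split.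
- move=> i; apply/row_matrixP=> j; rewrite row0 row_mul.
  apply/(@fr_exact _ _ F i); exists (row j 1%:M).
  by rewrite -row_mul mul1mx.
- apply/row_matrixP=> j; rewrite row0 row_mul -map_row.
  rewrite -[LHS]/(map_mx lam (row j (fr_diff F 0)) *m free_eps F) free_epsE.
  suff -> : fr_aug F (row j (fr_diff F 0)) = 0 by rewrite raddf0.
  by apply/fr_exact0; exists (row j 1%:M); rewrite -row_mul mul1mx.
- have [v Ev] := @fr_aug_surj _ _ F (1 : O); exists v.
  by rewrite free_epsE Ev.
- move=> v; rewrite -[LHS]/(map_mx lam v *m free_eps F) free_epsE => /matrixP/(_ 0 0).
  rewrite !mxE eqxx mulr1n => E0; have [w Ew] := (fr_exact0 (f := F) v).1 E0.
  by exists 1, w; rewrite scale1r.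
- move=> i v /fr_exact[w Ew].
  by exists 1, w; rewrite scale1r.
Qed.

(** The comparison theorem of projective resolutions.  Each component is chosen together
    with the property that allows the choice of the next one. *)
Lemma lift_augmentation C D (eC : 'cV_(crk C 0)) (eD : 'cV_(crk D 0)) :
  augmented eC -> resolution_up_to (eq 1) eD ->
  exists t : forall i, 'M_(crk C i, crk D i),
    chain_map t /\ map_mx lam (t 0) *m eD = eC.
Proof.
move=> [cC dC _] [[cD dD [v0 Ev0]] ex0 ex].
pose good i : 'M_(crk C i, crk D i) -> Prop := match i with
  | 0 => fun t => map_mx lam t *m eD = eC
  | n.+1 => fun t => cdf C n.+1 *m t *m cdf D n = 0 end.
have rows m n k (Z : 'M[A]_(m, n)) (d : 'M[A]_(k, n)) :
    (forall i, exists s w, 1 = s /\ s *: row i Z = w *m d) -> exists h, Z = h *m d.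
  move=> H; have [|s [h [<-]]] := common_denominator (S := eq 1) _ H.
    by split=> // _ _ <- <-; rewrite mulr1.
  by rewrite scale1r => ->; exists h.
have next i (t : {t | @good i t}) :
    {t' : {t' | @good i.+1 t'} | cdf C i *m sval t = sval t' *m cdf D i}.
  case: t => t gt /=; apply: cid.
  have [t' Et'] : exists t', cdf C i *m t = t' *m cdf D i.
    apply: rows => j; case: i t gt j => [|i] t gt j.
      apply: ex0; rewrite map_row -row_mul map_mxM -mulmxA gt dC.
      by rewrite row0.
    by apply: ex; rewrite -row_mul gt row0.
  have gt' : @good i.+1 t' by rewrite /= -mulmxA -Et' mulmxA cC mul0mx.
  by exists (exist _ t' gt').
have [t0 gt0] : exists t0, @good 0 t0.
  exists (\matrix_i ((eC i 0)%:A *: v0)); apply/row_matrixP=> i.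
  rewrite row_mul -map_row rowK map_mxZ lamK -scalemxAl Ev0.
  by apply/rowP=> j; rewrite !mxE !ord1 eqxx mulr1.
pose st := fix st i : {t | @good i t} :=
  if i is n.+1 then sval (next n (st n)) else exist _ t0 gt0.
exists (fun i => sval (st i)); split=> // i; exact: (svalP (next i (st i))).
Qed.
End Resolutions.

Section MapComplex.
Variables (R R' : comPzRingType) (f : {rmorphism R -> R'}).

Definition map_complex (C : complex R) : complex R' :=
  @Complex R' (crk C) (fun i => map_mx f (cdf C i)).

Lemma map_complexP C : is_complex C -> is_complex (map_complex C).
Proof. by move=> cC i; rewrite /= -map_mxM cC raddf0. Qed.
End MapComplex.

Section BaseChange.
Variables (O : idomainType) (A B : comAlgType O).
Variables (lamA : {rmorphism A -> O}) (lamB : {rmorphism B -> O}).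
Variable phi : {lrmorphism A -> B}.
Hypotheses (phi_lam : forall a, lamB (phi a) = lamA a).
Hypothesis phi_surj : forall b, exists a, phi a = b.
Hypothesis torJ : forall a, phi a = 0 -> exists2 s, ~ augp lamA s & s * a = 0.

Lemma map_phi_lam m n (X : 'M[A]_(m, n)) : map_mx lamB (map_mx phi X) = map_mx lamA X.
Proof. by rewrite -map_mx_comp; apply: eq_map_mx => a /=. Qed.

Lemma phi_surj_mx m n (Y : 'M[B]_(m, n)) : exists X : 'M[A]_(m, n), map_mx phi X = Y.
Proof.
have [r rK] := choice phi_surj.
by exists (map_mx r Y); apply/matrixP=> i j; rewrite !mxE rK.
Qed.

(** A matrix over A that vanishes over B has entries in ker phi, and their annihilators
    multiply to a common one. *)
Lemma torsion_mx m n (X : 'M[A]_(m, n)) : map_mx phi X = 0 ->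
  exists2 s, ~ augp lamA s & s *: X = 0.
Proof.
move=> X0; have /choice[s Hs] : forall ij : 'I_m * 'I_n, exists s,
    ~ augp lamA s /\ s * X ij.1 ij.2 = 0.
  move=> [i j]; have [|s] := torJ (a := X i j); last by exists s.
  by move/matrixP: X0 => /(_ i j); rewrite !mxE.
exists (\prod_ij s ij).
  by apply: prime_not_prod => [|ij]; [exact: augp_prime | case: (Hs ij)].
apply/matrixP=> i j; rewrite !mxE (bigD1 (i, j)) //= -mulrA [_ * X i j]mulrC mulrA.
by rewrite (Hs (i, j)).2 mul0r.
Qed.

Variables (C : complex A) (eps : 'cV[O]_(crk C 0)).
Local Notation phiC := (map_complex phi C).
Local Notation notpA := (fun s => ~ augp lamA s).
Local Notation notpB := (fun s => ~ augp lamB s).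

Lemma map_augmented : augmented lamA eps -> augmented lamB (eps : 'cV_(crk phiC 0)).
Proof.
move=> [cC dC [v Ev]]; split; first exact: map_complexP.
  by rewrite /= map_phi_lam.
by exists (map_mx phi v); rewrite map_phi_lam.
Qed.

Lemma phi_notp s : notpA s -> notpB (phi s).
Proof. by rewrite /augp phi_lam. Qed.

Lemma map_exact0 (S : A -> Prop) : resolution_up_to lamA S eps ->
  forall v : 'rV_(crk phiC 0), map_mx lamB v *m eps = 0 ->
  exists s w, S s /\ phi s *: v = w *m cdf phiC 0.
Proof.
move=> [_ ex0 _] v; have [v' <-] := phi_surj_mx v.
rewrite map_phi_lam => /ex0[s [w [Ss E]]].
by exists s, (map_mx phi w); split=> //=; rewrite -map_mxM -E map_mxZ.
Qed.

(** A cycle over B lifts to A with boundary in ker phi; a multiple of the lift is then a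
    cycle over A. *)
Lemma map_resolution : resolution_up_to lamA notpA eps ->
  resolution_up_to lamB notpB (eps : 'cV_(crk phiC 0)).
Proof.
move=> resC; have [aC _ ex] := resC; split=> [|v Ev|i v]; first exact: map_augmented.
  have [s [w [nps E]]] := map_exact0 resC Ev.
  by exists (phi s), w; split=> //; apply: phi_notp.
have [v' <-] := phi_surj_mx v.
rewrite /= -map_mxM => /torsion_mx[s nps]; rewrite scalemxAl => /ex[t [w [npt E]]].
exists (phi (t * s)), (map_mx phi w); split.
  by apply: phi_notp; apply: prime_notM => //; exact: augp_prime.
by rewrite -map_mxM -E scalerA map_mxZ.
Qed.

(** A positive homology class of C over B is killed by some b outside p_B.  It is also
    killed by p_B, because an element of p_A acts on the resolution over A by a
    null-homotopic map.  Now some power of y lies in p_B + (b). *)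
Lemma map_resolution_nonunit (y : B) : resolution_up_to lamA (eq 1) eps ->
  (forall b, ~ augp lamB b -> exists n x, lamB (y ^+ n) = lamB (x * b)) ->
  forall i, cycles_torsion (fun x => exists n, x = y ^+ n) phiC i.+1.
Proof.
move=> resC pow_y i v dv.
have [|_ _ /(_ i v dv)[b [w [npb E]]]] := map_resolution.
  apply: resolution_up_to_sub resC => _ <-; exact: prime1 (augp_prime lamA).
have [n [x Enx]] := pow_y b npb.
have pz : augp lamB (y ^+ n - x * b) by rewrite /augp rmorphB /= Enx subrr.
have [a Ea] := phi_surj (y ^+ n - x * b).
have pa : augp lamA a by rewrite /augp -phi_lam Ea.
have [[cC _ _] ex0 ex] := resC.
have [|u||s [h [h' [<- Eh]]]] := torsion_homotopy (S := eq 1) (a := a) (n := i) _ cC.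
- by split=> // _ _ <- <-; rewrite mulr1.
- by apply: ex0; rewrite map_mxZ pa scale0r mul0mx.
- by move=> j _; apply: ex.
exists (y ^+ n), (v *m map_mx phi h' + x *: w); split; first by exists n.
have Ev : phi a *: v = v *m map_mx phi h' *m cdf phiC i.+1.
  rewrite -mul_mx_scalar -[_%:M]map_scalar_mx -[a]mul1r Eh map_mxD !map_mxM mulmxDr.
  by rewrite mulmxA dv mul0mx add0r mulmxA.
by rewrite mulmxDl -scalemxAl -E -Ev scalerA -scalerDl Ea subrK.
Qed.
End BaseChange.

(** * The Koszul complex *)

Section Koszul.
Variables (O : idomainType) (A : comAlgType O) (lam : {rmorphism A -> O}).
Local Notation p := (augp lam).
Local Notation notp := (fun s => ~ augp lam s).
Implicit Types (K : complex A) (I : A -> Prop).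

Definition scalar_chain K (x : A) : forall i, 'M_(crk K i, crk K i) := fun=> x%:M.

Lemma scalar_chainP K x : chain_map (scalar_chain K x).
Proof. by move=> i; rewrite /scalar_chain mul_mx_scalar mul_scalar_mx. Qed.

Definition unit_complex : complex A :=
  @Complex A (fun i => (i == 0)%N) (fun i => 0).

(** Iterated cones of multiplications: the tensor product of K with the Koszul complex
    of xs. *)
Fixpoint koszul_on K (xs : seq A) : complex A :=
  if xs is x :: xs' then koszul_on (cone (scalar_chain K x)) xs' else K.

(** K resolves A / I locally at p, where beta : K_0 -> A induces the augmentation, and
    all its differentials vanish modulo p. *)
Record resolves K I (beta : 'cV[A]_(crk K 0)) : Prop := Resolves {
  rsv_complex : is_complex K;
  rsv_surj : exists v : 'rV_(crk K 0), v *m beta = 1;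
  rsv_image : forall v : 'rV_(crk K 1), I ((v *m cdf K 0 *m beta) 0 0);
  rsv_exact0 : forall v : 'rV_(crk K 0), I ((v *m beta) 0 0) ->
    exists s w, notp s /\ s *: v = w *m cdf K 0;
  rsv_exact : forall i, cycles_torsion notp K i.+1;
  rsv_min : forall i a b, p (cdf K i a b) }.

Lemma notp_closed : mul_closed notp.
Proof.
split; first exact: prime1 (augp_prime lam).
by move=> s t; apply: prime_notM; exact: augp_prime.
Qed.

Lemma unit_resolves : resolves (K := unit_complex) (eq 0) (1 : 'M_1).
Proof.
split=> //=.
- by move=> i; rewrite mul0mx.
- by exists 1; rewrite mulmx1.
- by move=> v; rewrite mulmx0 mul0mx mxE.
- move=> v; rewrite mulmx1 => v0; exists 1, 0; split; first exact: notp_closed.1.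
  by rewrite mul0mx scale1r; apply/rowP=> j; rewrite (ord1 j) mxE -v0.
- move=> i v _; exists 1, 0; split; first exact: notp_closed.1.
  by apply/rowP=> -[].
- by move=> i a b; rewrite /augp mxE rmorph0.
Qed.

(** The cone of multiplication by x on a resolution of A / I resolves A / (I + (x)),
    when x is regular on A / I. *)
Lemma cone_resolves K I beta x : is_ideal I -> p x -> incl I p ->
  (forall a, I (a * x) -> exists2 s, notp s & I (s * a)) ->
  resolves I beta -> resolves (K := cone (scalar_chain K x)) (adjoin I x) beta.
Proof.
move=> idI px Ip regx [cK [v0 Ev0] imK ex0 exK minK].
have [S1 SM] := notp_closed.
have tP := scalar_chainP K x.
split.
- exact: cone_complex.
- by exists v0.
- move=> v /=; rewrite -[v]hsubmxK -[X in X *m beta]/(row_mx _ _ *m col_mx _ _).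
  rewrite mul_row_col mulmxDl mul_mx_scalar -scalemxAl mxE [X in X + _]mxE.
  by exists ((lsubmx v *m beta) 0 0); rewrite [x * _]mulrC addrAC subrr add0r.
- move=> v /= [a Ia]; have [|s [w [nps E]]] := ex0 (v - (a * x) *: v0).
    suff -> : ((v - (a * x) *: v0) *m beta) 0 0 = (v *m beta) 0 0 - a * x by [].
    by rewrite mulmxBl -scalemxAl Ev0 mxE; congr (_ + _); rewrite !mxE eqxx mulr1.
  exists s, (row_mx ((s * a) *: v0) w); split=> //.
  rewrite -[RHS]/(row_mx _ _ *m col_mx _ _) mul_row_col -E mul_mx_scalar.
  by rewrite scalerBr !scalerA [x * _]mulrC mulrA addrC subrK.
- case=> [|i]; last exact: cone_cycles.
  apply: cone_cycles1 => // y [z Ez].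
  have Iy : I ((y *m beta) 0 0 * x).
    have := imK z; rewrite -Ez mul_mx_scalar -scalemxAl mxE mulrC.
    by [].
  have [s nps Is] := regx _ Iy.
  have [|t [w [npt E]]] := ex0 (s *: y); first by rewrite -scalemxAl mxE.
  by exists (t * s), w; split; [exact: SM | rewrite -scalerA].
- have idp := prime_is_ideal (augp_prime lam).
  have pscal m (i j : 'I_m) : p ((x%:M : 'M_m) i j).
    by rewrite mxE; case: eqP => _; [rewrite mulr1n | rewrite mulr0n; exact: ideal0].
  case=> [|i] a b /=.
    rewrite -[X in p X]/(col_mx _ _ a b) mxE.
    by case: (fintype.split a) => j; [exact: pscal | exact: minK].
  rewrite -[X in p X]/(block_mx _ _ _ _ a b) mxE.
  case: (fintype.split a) => j; rewrite mxE; case: (fintype.split b) => k.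
  + by rewrite mxE; apply: idealN.
  + exact: pscal.
  + by rewrite mxE; apply: ideal0.
  + exact: minK.
Qed.

(** The top degree n of K is a free module of rank one with basis top; this is stated
    without an equality of ranks, which would not hold definitionally for iterated
    cones. *)
Definition top_spans K n (top : 'rV[A]_(crk K n)) : Prop :=
  (forall v, exists a, v = a *: top) /\
  forall m, (n < m)%N -> forall v : 'rV[A]_(crk K m), v = 0.

Lemma cone_top_spans K n top x : top_spans (K := K) (n := n) top ->
  top_spans (K := cone (scalar_chain K x)) (n := n.+1) (row_mx top 0).
Proof.
move=> [spn van]; split=> [v|[//|m] nm v].
  have [a Ea] := spn (lsubmx v); exists a; rewrite -[LHS]hsubmxK Ea.
  by rewrite (van _ (ltnSn n) (rsubmx v)) scale_row_mx scaler0.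
by rewrite -[LHS]hsubmxK (van m nm (lsubmx v)) (van m.+1 (leqW nm) (rsubmx v)) row_mx0.
Qed.

(** The product of the augmentation with the classes of the derivations D 0, D 1, ... in
    cohomology with values in O.  Applying a derivation to the relation d d = 0 shows
    that the entrywise derivative of the differential anticommutes with the
    differential, so that it acts on cohomology; this action is multiplication by the
    class of the derivation. *)
Fixpoint dprod K (D : nat -> A -> O) (w0 : 'cV[O]_(crk K 0)) i : 'cV[O]_(crk K i) :=
  if i is n.+1 then map_mx (D n) (cdf K n) *m dprod D w0 n else w0.

Lemma derivation0 D : derivation lam D -> D 0 = 0.
Proof.
by move=> [DD _]; have := DD 0 0; rewrite addr0 => /eqP; rewrite -subr_eq subrr => /eqP.
Qed.

Lemma derivation_scalar D m x : derivation lam D ->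
  map_mx D (x%:M : 'M_m) = (D x)%:M.
Proof.
move=> derD; apply/matrixP=> i j; rewrite !mxE; case: eqP => _ //.
by rewrite !mulr0n derivation0.
Qed.

Lemma derivation_mx0 D m n : derivation lam D -> map_mx D (0 : 'M_(m, n)) = 0.
Proof. by move=> derD; apply/matrixP=> i j; rewrite !mxE derivation0. Qed.

(** The derivative of the block x vanishes, so that the product does not see the new
    summand. *)
Lemma cone_dprod K D (w0 : 'cV[O]_(crk K 0)) x n : (forall i, derivation lam (D i)) ->
  (forall i, (i < n)%N -> D i x = 0) -> forall i, (i < n)%N ->
  dprod (K := cone (scalar_chain K x)) D w0 i.+1 = col_mx 0 (dprod D w0 i.+1).
Proof.
move=> derD Dx; elim=> [|i IHi] lin.
  rewrite -[LHS]/(map_mx (D 0) (col_mx x%:M (cdf K 0)) *m w0).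
  rewrite map_col_mx derivation_scalar // Dx // mul_col_mx.
  by rewrite -scalemx1 scale0r mul0mx.
rewrite -[LHS]/(map_mx (D i.+1) (block_mx _ _ _ _) *m dprod (K := cone (scalar_chain K x)) D w0 i.+1).
rewrite IHi; last exact: ltnW.
rewrite map_block_mx mul_block_col !mulmx0 !add0r derivation_scalar // Dx //.
by rewrite -scalemx1 scale0r mul0mx.
Qed.

(** The derivation D n with D n x = 1 turns the block x of the differential of the cone
    into an identity block, which carries the value at the top of K to the value at the
    top of the cone. *)
Lemma cone_dprod_top K D (w0 : 'cV[O]_(crk K 0)) x n top : (forall i, derivation lam (D i)) ->
  (forall i, (i < n)%N -> D i x = 0) -> D n x = 1 ->
  map_mx lam top *m dprod (K := K) D w0 n = 1 ->
  map_mx lam (row_mx top 0 : 'rV_(crk (cone (scalar_chain K x)) n.+1)) *m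
    dprod (K := cone (scalar_chain K x)) D w0 n.+1 = 1.
Proof.
move=> derD Dx Dnx <-; have := cone_dprod (K := K) w0 derD Dx.
case: n top Dx Dnx => [|n] top Dx Dnx Hd.
  rewrite -[dprod (K := cone _) D w0 1]/(map_mx (D 0) (col_mx x%:M (cdf K 0)) *m w0).
  rewrite map_col_mx derivation_scalar // Dnx mul_col_mx map_row_mx.
  rewrite -[LHS]/(row_mx _ _ *m col_mx _ _) mul_row_col map_mx0 mul0mx addr0.
  by rewrite mul1mx.
rewrite -[dprod (K := cone _) D w0 n.+2]/(map_mx (D n.+1) (block_mx _ _ _ _) *m dprod (K := cone _) D w0 n.+1).
rewrite (Hd n) // map_block_mx mul_block_col !mulmx0 !add0r derivation_scalar // Dnx.
rewrite map_row_mx map_mx0 -[LHS]/(row_mx _ _ *m col_mx _ _) mul_row_col mul0mx addr0.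
by rewrite mul1mx.
Qed.

(** The invariant carried along the iterated cones. *)
Definition koszul_data (D : nat -> A -> O) K I n : Prop :=
  exists beta top, [/\ resolves (K := K) I beta, top_spans (K := K) (n := n) top &
    map_mx lam top *m dprod D (map_mx lam beta) n = 1].

Lemma koszul_on_data D K I n xs : (forall i, derivation lam (D i)) ->
  is_ideal I -> incl I p ->
  (forall x, x \in xs -> p x) -> locally_regular p I xs ->
  (forall i k, (k < size xs)%N -> (i <= n + k)%N -> D i xs`_k = (i == n + k)%N%:R) ->
  koszul_data D K I n -> koszul_data D (koszul_on K xs) (gen I xs) (n + size xs).
Proof.
move=> derD; elim: xs K I n => [|x xs IHxs] K I n idI Ip pxs regxs Dxs [beta [top [rK tK dK]]].
  rewrite addn0; exists beta, top; split=> //.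
  have eqI : gen I [::] = I.
    by apply/funext=> y; apply/propext; split=> [/(gen_nil idI)//|Iy J _ IJ _]; apply: IJ.
  by rewrite eqI.
have px : p x by apply: pxs; rewrite inE eqxx.
have [regx regxs'] := regxs.
have idIx := adjoin_ideal x idI.
have -> : gen I (x :: xs) = gen (adjoin I x) xs.
  apply/funext=> y; apply/propext; split=> [/(gen_cons idI)//|gy J idJ IJ Jxs].
  apply: gy => // [z|z zxs]; last by apply: Jxs; rewrite inE zxs orbT.
  by apply: adjoin_sub => //; apply: Jxs; rewrite inE eqxx.
rewrite /= addnS -addSn; apply: IHxs => //.
- by apply: adjoin_sub => //; exact: prime_is_ideal (augp_prime lam).
- by move=> y yxs; apply: pxs; rewrite inE yxs orbT.
- by move=> i k kxs ik; have := Dxs i k.+1; rewrite addnS -addSn; apply.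
exists beta, (row_mx top 0); split.
- exact: cone_resolves.
- exact: cone_top_spans.
- apply: cone_dprod_top => // [i lin|].
    by have := Dxs i 0%N; rewrite addn0 (ltn_eqF lin); apply=> //; exact: ltnW.
  by have := Dxs n 0%N; rewrite addn0 eqxx; apply.
Qed.
End Koszul.

(** * Comparison of the cohomology of two resolutions *)

Section ColumnCochains.
Variables (R : comPzRingType) (M : lmodType R).

(** Cochains on a direct sum of two free modules. *)
Definition fcol m n (f : {ffun 'I_m -> M}) (g : {ffun 'I_n -> M}) :
    {ffun 'I_(m + n) -> M} :=
  [ffun i => match fintype.split i with inl j => f j | inr j => g j end].

Lemma fcolP m n (h : {ffun 'I_(m + n) -> M}) :
  h = fcol [ffun i => h (lshift n i)] [ffun i => h (rshift m i)].
Proof.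
apply/ffunP=> i; rewrite ffunE -{1}(splitK i).
by case: (fintype.split i) => j; rewrite ffunE.
Qed.

Lemma hom_map_col m n k (X : 'M[R]_(m, k)) (Y : 'M[R]_(n, k)) (f : {ffun 'I_k -> M}) :
  hom_map (col_mx X Y) f = fcol (hom_map X f) (hom_map Y f).
Proof.
apply/ffunP=> i; rewrite !ffunE.
by case E : (fintype.split i) => [j|j]; rewrite ffunE; apply: eq_bigr => l _; rewrite mxE E.
Qed.

Lemma hom_map_row m n k (X : 'M[R]_(m, n)) (Y : 'M[R]_(m, k))
    (f : {ffun 'I_n -> M}) (g : {ffun 'I_k -> M}) :
  hom_map (row_mx X Y) (fcol f g) = hom_map X f + hom_map Y g.
Proof.
apply/ffunP=> i; rewrite !ffunE big_split_ord /=; congr (_ + _); apply: eq_bigr => j _.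
  by rewrite row_mxEl ffunE (unsplitK (inl j)).
by rewrite row_mxEr ffunE (unsplitK (inr j)).
Qed.

Lemma hom_map_block m n k l (X : 'M[R]_(m, n)) Y Z (T : 'M[R]_(k, l)) f g :
  hom_map (block_mx X Y Z T) (fcol f g) =
  fcol (hom_map X f + hom_map Y g) (hom_map Z f + hom_map T g).
Proof. by rewrite [LHS]hom_map_col !hom_map_row. Qed.

Lemma all_in_fcol (W : M -> Prop) m n (f : {ffun 'I_m -> M}) (g : {ffun 'I_n -> M}) :
  all_in W (fcol f g) <-> all_in W f /\ all_in W g.
Proof.
split=> [Wfg|[Wf Wg] i]; last by rewrite ffunE; case: (fintype.split i).
split=> i.
  by have := Wfg (lshift n i); rewrite ffunE (unsplitK (inl i)).
by have := Wfg (rshift m i); rewrite ffunE (unsplitK (inr i)).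
Qed.

Lemma fcolB m n (f f' : {ffun 'I_m -> M}) (g g' : {ffun 'I_n -> M}) :
  fcol f g - fcol f' g' = fcol (f - f') (g - g').
Proof. by apply/ffunP=> i; rewrite !ffunE; case: (fintype.split i) => j; rewrite !ffunE. Qed.
End ColumnCochains.

Section Evaluation.
Variables (O : idomainType) (A : comAlgType O) (lam : {rmorphism A -> O}).
Hypothesis lamK : forall x : O, lam x%:A = x.
Variable M : lmodType A.
Local Notation p := (augp lam).
Local Notation notp := (fun s => ~ augp lam s).

(** p M, as a Prop-valued predicate. *)
Definition augM : M -> Prop := fun m => m \in smul (aug_ideal lam) (@predT M).
Local Notation W := augM.

Lemma augM_submod : is_submod W. Proof. exact: smul_submod. Qed.
Let smW := augM_submod.

Lemma augM_mem a m : lam a = 0 -> W (a *: m).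
Proof. by move=> la; apply: smul_mem => //; rewrite inE; apply/eqP. Qed.

Lemma augM_all n a (f : {ffun 'I_n -> M}) : lam a = 0 -> all_in W (a *: f).
Proof. by move=> la k; rewrite ffunE; apply: augM_mem. Qed.

Lemma augM_hom m n (d : 'M[A]_(m, n)) (f : {ffun 'I_n -> M}) :
  map_mx lam d = 0 -> all_in W (hom_map d f).
Proof.
move=> d0 i; rewrite ffunE; elim/big_ind: _ => [|x y|j _].
- exact: submod0 smW.
- exact: (submodD smW).
- by apply: augM_mem; move/matrixP: d0 => /(_ i j); rewrite !mxE.
Qed.

Section TwoResolutions.
Variables (K D : complex A) (eK : 'cV[O]_(crk K 0)) (eD : 'cV[O]_(crk D 0)).
Variable rho : forall i, 'M[A]_(crk K i, crk D i).
Hypotheses (rhoP : chain_map rho) (rho_eps : map_mx lam (rho 0) *m eD = eK).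

(** Both complexes resolve O up to multipliers outside p, so the cone of a map between
    them has torsion homology. *)
Lemma cone_acyclic i : resolution_up_to lam notp eK -> resolution_up_to lam notp eD ->
  cycles_torsion notp (cone rho) i.
Proof.
move=> [[cK dK [v0 Ev0]] ex0K exK] [[cD dD _] ex0D exD].
have [S1 SM] := notp_closed lam.
case: i => [|[|i]]; last exact: cone_cycles.
  move=> y; pose a := (map_mx lam y *m eD) 0 0.
  have [|s [w [nps E]]] := ex0D (y - a%:A *: (v0 *m rho 0)).
    rewrite map_mxB map_mxZ lamK map_mxM mulmxBl -scalemxAl -mulmxA rho_eps Ev0.
    by rewrite -[1]/(1%:M) scalemx1 /a -mx11_scalar subrr.
  exists s, (row_mx ((s * a%:A) *: v0) w); split=> //.
  rewrite -[RHS]/(row_mx _ _ *m col_mx _ _) mul_row_col -E scalerBr scalerA.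
  by rewrite -scalemxAl addrC subrK.
apply: cone_cycles1 => // x [y Ey]; apply: ex0K.
rewrite -rho_eps mulmxA -map_mxM Ey map_mxM -mulmxA dD mulmx0.
by [].
Qed.

(** A cocycle u modulo p M with value in p M at the top of K pulls back to zero on K
    modulo p M, as top generates K_n.  So (0, u) is a cocycle on the cone of rho, which
    has torsion homology. *)
Lemma ev_injective n (top : 'rV[A]_(crk K n)) (u : {ffun 'I_(crk D n) -> M}) :
  resolution_up_to lam notp eK -> resolution_up_to lam notp eD ->
  (forall v, exists a, v = a *: top) ->
  all_in W (hom_map (cdf D n) u) -> all_in W (hom_map (top *m rho n) u) ->
  exists2 s, ~ p s & coboundary W (s *: u).
Proof.
move=> resK resD spn Wdu Wtop.
have Wrho : all_in W (hom_map (rho n) u).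
  move=> i; have [a Ea] := spn (delta_mx 0 i).
  have -> : hom_map (rho n) u i = hom_map (row i 1%:M *m rho n) u 0.
    by rewrite -row_mul mul1mx !ffunE; apply: eq_bigr => j _; rewrite mxE.
  rewrite row1 Ea -scalemxAl hom_mapZ.
  exact: all_inZ.
have cE : is_complex (cone rho).
  by apply: cone_complex => //; [case: resK => -[] | case: resD => -[]].
have torE i : (i <= n)%N -> cycles_torsion notp (cone rho) i.
  by move=> _; apply: cone_acyclic.
case: n top u spn Wdu Wtop Wrho torE => [|n] top u spn Wdu Wtop Wrho torE.
  have [|s nps Wsu] := cocycle_torsion (C := cone rho) (n := 0) (g := u) smW (notp_closed lam) cE torE.
    by rewrite -[hom_map _ _]/(hom_map (col_mx (rho 0) (cdf D 0)) u) hom_map_col; apply/all_in_fcol.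
  by exists s.
have [|s nps] := cocycle_torsion (C := cone rho) (n := n.+1) (g := fcol 0 u) smW (notp_closed lam) cE torE.
  rewrite -[hom_map _ _]/(hom_map (block_mx _ _ _ _) (fcol 0 u)) hom_map_block.
  by rewrite !linear0 !add0r; apply/all_in_fcol.
have -> : s *: fcol 0 u = fcol 0 (s *: u) :> {ffun 'I_(crk K n + crk D n.+1) -> M}.
  by apply/ffunP=> i; rewrite !ffunE; case: (fintype.split i) => j; rewrite !ffunE ?scaler0.
move=> Hs; exists s => //; move: Hs; case: n {top spn Wdu Wtop Wrho torE} u => [|n] u [v].
  rewrite -[hom_map _ _]/(hom_map (col_mx _ _) v) hom_map_col fcolB.
  by move=> /all_in_fcol[_ Wv]; exists v.
rewrite [v](@fcolP _ _ (crk K n)) -[hom_map _ _]/(hom_map (block_mx _ _ _ _) (fcol _ _)).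
rewrite hom_map_block fcolB => /all_in_fcol[_]; rewrite hom_map0 add0r => Wv.
by eexists; exact: Wv.
Qed.

Variable Ds : nat -> A -> O.
Hypothesis derD : forall i, derivation lam (Ds i).

Lemma derivation_mulmx i m n k (X : 'M[A]_(m, n)) (Y : 'M[A]_(n, k)) :
  map_mx (Ds i) (X *m Y) = map_mx lam X *m map_mx (Ds i) Y + map_mx (Ds i) X *m map_mx lam Y.
Proof.
have [DD DM] := derD i.
apply/matrixP=> a b; rewrite !mxE -big_split /=.
have -> : forall (F : 'I_n -> A), Ds i (\sum_j F j) = \sum_j Ds i (F j).
  move=> F; elim/big_rec2: _ => [|j x y _ <-]; first exact: derivation0 (derD i).
  by rewrite DD.
by apply: eq_bigr => j _; rewrite DM !mxE [lam _ * Ds i (X a j)]mulrC.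
Qed.

(** The differential and its derivative anticommute. *)
Lemma dprod_cocycle i : augmented lam eD -> map_mx lam (cdf D i) *m dprod Ds eD i = 0.
Proof.
move=> [cD dD _]; elim: i => [//|i IHi] /=; rewrite mulmxA.
have := derivation_mulmx i (cdf D i.+1) (cdf D i); rewrite cD.
rewrite (derivation_mx0 _ _ (derD i)) => /esym/eqP; rewrite addr_eq0 => /eqP->.
by rewrite mulNmx -mulmxA IHi mulmx0 oppr0.
Qed.

(** The derivative of the relation between rho and the differentials, applied to a
    cocycle, is an equality without correction terms because the differentials of K
    vanish under lam. *)
Lemma dprod_chain i : augmented lam eD -> (forall j, map_mx lam (cdf K j) = 0) ->
  map_mx lam (rho i) *m dprod Ds eD i = dprod Ds eK i.
Proof.
move=> augD minK; elim: i => [//|i IHi] /=; rewrite -IHi mulmxA.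
have := congr1 (map_mx (Ds i)) (rhoP i); rewrite !derivation_mulmx minK mul0mx add0r.
move/(congr1 (mulmx^~ (dprod Ds eD i))); rewrite !mulmxDl -!mulmxA.
by rewrite dprod_cocycle // mulmx0 addr0.
Qed.

(** The product of the classes of the derivations takes the value 1 at the top of K;
    multiplying it by m gives theta. *)
Lemma ev_surjective n (top : 'rV[A]_(crk K n)) (m : M) :
  augmented lam eD -> (forall j, map_mx lam (cdf K j) = 0) ->
  map_mx lam top *m dprod Ds eK n = 1 ->
  exists theta : {ffun 'I_(crk D n) -> M},
    all_in W (hom_map (cdf D n) theta) /\
    all_in W (hom_map (top *m rho n) theta - [ffun=> m]).
Proof.
move=> augD minK topK; pose u := dprod Ds eD n.
have [z zE] : exists z : 'cV[A]_(crk D n), map_mx lam z = u.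
  by exists (\col_i (u i 0)%:A); apply/colP=> i; rewrite !mxE lamK.
have thetaE k (d : 'M[A]_(k, crk D n)) :
    hom_map d (hom_map z [ffun=> m]) = hom_map (d *m z) [ffun=> m].
  by rewrite hom_mapM.
exists (hom_map z [ffun=> m]); rewrite !thetaE; split.
  by apply: augM_hom; rewrite map_mxM zE dprod_cocycle.
rewrite -[X in _ - X]hom_map1 -hom_mapN -hom_mapD; apply: augM_hom.
rewrite map_mxB -mulmxA !map_mxM zE dprod_chain // topK map_scalar_mx rmorph1.
by rewrite -[1]/(1%:M) subrr.
Qed.
End TwoResolutions.
End Evaluation.

Section Comparison.
Variables (O : idomainType) (B : comAlgType O) (lam : {rmorphism B -> O}).
Hypothesis lamK : forall x : O, lam x%:A = x.
Variable M : lmodType B.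
Local Notation p := (augp lam).
Local Notation notp := (fun s => ~ augp lam s).
Local Notation W := (@augM O B lam M).

Variables (C D K : complex B) (eC : 'cV[O]_(crk C 0)) (eD : 'cV[O]_(crk D 0)).
Variable (eK : 'cV[O]_(crk K 0)).
Variable tau : forall i, 'M[B]_(crk C i, crk D i).
Variable rho : forall i, 'M[B]_(crk K i, crk C i).
Hypotheses (tauP : chain_map tau) (tau_eps : map_mx lam (tau 0) *m eD = eC).
Hypotheses (rhoP : chain_map rho) (rho_eps : map_mx lam (rho 0) *m eC = eK).
Hypotheses (resC : resolution_up_to lam notp eC) (resD : resolution_up_to lam notp eD).
Hypothesis resK : resolution_up_to lam notp eK.
Hypothesis minK : forall j, map_mx lam (cdf K j) = 0.
Variables (c : nat) (top : 'rV[B]_(crk K c)).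
Hypothesis spn : forall v, exists a, v = a *: top.
Variable Ds : nat -> B -> O.
Hypotheses (derD : forall i, derivation lam (Ds i)).
Hypothesis topK : map_mx lam top *m dprod Ds eK c = 1.

Let smW : is_submod W. Proof. exact: augM_submod. Qed.
Let rho' i := rho i *m tau i.

Let rho'P : chain_map rho'.
Proof. by move=> i; rewrite /rho' mulmxA rhoP -!mulmxA tauP. Qed.

Let rho'_eps : map_mx lam (rho' 0) *m eD = eK.
Proof. by rewrite /rho' map_mxM -mulmxA tau_eps. Qed.

(** A cocycle and its image under tau have the same value at the top of K, so that
    injectivity follows from ev_injective for the composite map from K to D. *)
Lemma comparison_injective (u : {ffun 'I_(crk D c) -> M}) s : ~ p s ->
  all_in W (hom_map (cdf D c) u) -> coboundary (C := C) W (s *: hom_map (tau c) u) ->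
  exists2 t, ~ p t & coboundary (C := D) W (t *: u).
Proof.
move=> nps Wdu cobu.
have Wtop : all_in W (hom_map (top *m rho' c) (s *: u)).
  have -> : hom_map (top *m rho' c) (s *: u) = hom_map (top *m rho c) (s *: hom_map (tau c) u).
    by rewrite mulmxA hom_mapM linearZ.
  case: (c) top u {Wdu} cobu => [|n] t u /=; first exact: all_in_hom.
  case=> v Wv; rewrite -[s *: _](subrK (hom_map (cdf C n) v)) linearD /=.
  apply: all_inD => //; first exact: all_in_hom.
  rewrite -hom_mapM -mulmxA -rhoP mulmxA hom_mapM; apply: augM_hom.
  by rewrite map_mxM minK mulmx0.
have [|t npt Ht] := ev_injective lamK rho'P rho'_eps resK resD spn (u := s *: u) _ Wtop.
  by rewrite linearZ; exact: all_inZ.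
exists (t * s); first by apply: prime_notM => //; exact: augp_prime.
by rewrite -scalerA.
Qed.

(** The cocycle on D which has the same value as u at the top of K differs from u by
    torsion after pullback, by ev_injective on C. *)
Lemma comparison_surjective (u : {ffun 'I_(crk C c) -> M}) :
  all_in W (hom_map (cdf C c) u) ->
  exists u' : {ffun 'I_(crk D c) -> M}, all_in W (hom_map (cdf D c) u') /\
    exists2 s, ~ p s & coboundary (C := C) W (s *: (u - hom_map (tau c) u')).
Proof.
move=> Wdu; pose m := hom_map (top *m rho c) u 0.
have [|theta [Wdt Wt]] := ev_surjective lamK rho'P rho'_eps derD m _ minK topK.
  by case: resD.
exists theta; split=> //.
apply: (ev_injective lamK rhoP rho_eps resK resC spn) => //.
  rewrite linearB /= -hom_mapM tauP hom_mapM; apply: all_inB => //.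
  exact: all_in_hom.
rewrite linearB /= -hom_mapM -mulmxA.
have -> : hom_map (top *m rho c) u = [ffun=> m] by apply/ffunP=> i; rewrite [RHS]ffunE (ord1 i).
by rewrite -opprB -scaleN1r; apply: all_inZ.
Qed.
End Comparison.

Section DepthComparison.
Variables (R : comPzRingType) (M : lmodType R) (C D : complex R).
Variable tau : forall i, 'M[R]_(crk C i, crk D i).
Hypotheses (cC : is_complex C) (cD : is_complex D) (tauP : chain_map tau).
Variables (s : seq R) (c : nat).
Hypothesis regs : forall i, (i < size s)%N -> forall m : M,
  s`_i *: m \in smul (mem (take i s)) predT -> m \in smul (mem (take i s)) predT.
Hypothesis cs : (c <= size s)%N.
Hypothesis exD : forall i, cycles_torsion (eq 1) D i.+1.
Hypothesis tau0 : forall y : 'rV_(crk D 0), exists x w, y = x *m tau 0 + w *m cdf D 0.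
Hypothesis exC0 : forall x : 'rV_(crk C 0), (exists y, x *m tau 0 = y *m cdf D 0) ->
  exists w, x = w *m cdf C 0.
Hypothesis torC : forall y, y \in s -> forall i,
  cycles_torsion (fun x => exists n, x = y ^+ n) C i.+1.

(** The pair (z, 0) is a cocycle of degree c + 1 on the cone of tau, where the
    cohomology with values in M vanishes. *)
Lemma comparison_depth (z : {ffun 'I_(crk C c) -> M}) : hom_map (cdf C c) z = 0 ->
  exists z' : {ffun 'I_(crk D c) -> M}, hom_map (cdf D c) z' = 0 /\
    coboundary (C := C) (eq 0) (z - hom_map (tau c) z').
Proof.
move=> dz.
have W0 (m : M) : m \in smul (mem (take 0 s)) predT -> 0 = m.
  rewrite take0; apply: smul_sub => //.
  by split=> // [_ _ <- <-|a _ <-]; rewrite ?addr0 ?scaler0.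
have closed_pow (y : R) : mul_closed (fun x => exists n, x = y ^+ n).
  by split; [exists 0%N | move=> _ _ [a ->] [b ->]; exists (a + b)%N; rewrite exprD].
have exE i : (i <= 1)%N -> cycles_torsion (eq 1) (cone tau) i.
  case: i => [_|[_|//]]; first exact: cone_cycles0.
  apply: cone_cycles1 => //; first by move=> _ _ <- <-; rewrite mulr1.
  by move=> x /exC0[w ->]; exists 1, w; rewrite scale1r.
have torE y : y \in s -> forall i, cycles_torsion (fun x => exists n, x = y ^+ n) (cone tau) i.
  move=> ys; have [S1 SM] := closed_pow y.
  have sub C' i : cycles_torsion (eq 1) C' i -> cycles_torsion (fun x => exists n, x = y ^+ n) C' i.
    by apply: cycles_torsion_sub => _ <-; exists 0%N.
  case=> [|[|i]]; [by apply: sub; apply: exE|by apply: sub; apply: exE|].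
  by apply: cone_cycles => //; [exact: torC | apply: sub; exact: exD].
have cE := cone_complex cC cD tauP.
have [|v] := depth_coboundary regs cE exE torE (n := c) (k := 0) (i := c.+1) (g := fcol z 0) (ltnSn _) cs.
  suff -> : hom_map (cdf (cone tau) c.+1) (fcol z 0) = 0.
    by apply: all_in0; exact: smul_submod.
  rewrite -[LHS]/(hom_map (block_mx _ _ _ _) (fcol z 0)) hom_map_block.
  rewrite !hom_mapN dz hom_map0 !linear0 ?oppr0 !addr0.
  by apply/ffunP=> i; rewrite !ffunE; case: (fintype.split i) => j; rewrite !ffunE.
have sub_eq0 m (f : {ffun 'I_m -> M}) : (forall k, 0 = (- f) k) -> f = 0.
  by move=> f0; apply/eqP; rewrite -oppr_eq0; apply/eqP/ffunP=> k; rewrite -f0 ffunE.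
case: (c) z dz v => [|n] z dz v.
  rewrite -[hom_map _ _]/(hom_map (col_mx _ _) v) hom_map_col fcolB sub0r.
  move=> /all_in_fcol[Wz WD]; exists v; split=> [|k]; last exact: W0.
  by apply: sub_eq0 => k; apply: W0.
rewrite [v](@fcolP _ _ (crk C n)) -[hom_map _ _]/(hom_map (block_mx _ _ _ _) (fcol _ _)).
rewrite hom_map_block fcolB hom_mapN hom_map0 !add0r => /all_in_fcol[Wz WD].
set v1 := [ffun _ => _] in Wz; set v2 := [ffun _ => _] in Wz WD.
exists v2; split.
  by apply: sub_eq0 => k; apply: W0.
exists (- v1) => k; apply: W0; have := Wz k.
by rewrite linearN opprD /= addrA addrAC.
Qed.
End DepthComparison.

(** * A presentation of the congruence module *)

(** The set X need not carry a module structure, so that modules over different rings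
    can be compared on a common set of cochains. *)
Lemma isomorphic_of_presentations (R : pzRingType) (U V : lmodType R) (X : Type)
    (f : X -> U) (g : X -> V) :
  (forall u, exists x, f x = u) -> (forall v, exists x, g x = v) ->
  (forall x y, f x = f y <-> g x = g y) ->
  (forall a x y, exists z, f z = a *: f x + f y /\ g z = a *: g x + g y) ->
  isomorphic U V.
Proof.
move=> /choice[r rK] /choice[s sK] fg lin.
pose h u := g (r u).
have hE x : h (f x) = g x by apply/fg; rewrite rK.
have h_lin : linear h.
  move=> a u v; have [z [fz gz]] := lin a (r u) (r v).
  by rewrite -[u in LHS]rK -[v in LHS]rK -fz hE gz.
pose hM := GRing.isLinear.Build R U V *:%R h h_lin.
pose hL : {linear U -> V} := HB.pack h hM.
exists hL, (fun v => f (s v)) => x /=.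
  by rewrite -[RHS]rK; apply/fg; rewrite sK.
by rewrite [LHS]hE sK.
Qed.

Lemma quotmod_surj (R : pzRingType) (V : lmodType R) (S : submodClosed V) (x : quotmod S) :
  exists v, quotmod_pi S v = x.
Proof. by exists (quotmod_repr x); exact: quotmod_reprK. Qed.

Section CokernelTorsionFree.
Variables (O : idomainType) (U V : lmodType O) (f : {linear U -> V}).

Definition coker_tf_pi (v : V) : coker (tf_map f) :=
  quotmod_pi (imgl (tf_map f)) (quotmod_pi (tors V) v).

Lemma coker_tf_pi_surj x : exists v, coker_tf_pi v = x.
Proof.
have [y <-] := quotmod_surj (S := imgl (tf_map f)) x.
by have [v <-] := quotmod_surj (S := tors V) y; exists v.
Qed.

Lemma coker_tf_pi_linear a u v : coker_tf_pi (a *: u + v) = a *: coker_tf_pi u + coker_tf_pi v.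
Proof. by rewrite /coker_tf_pi !linearP. Qed.

Lemma coker_tf_pi_eq u v : coker_tf_pi u = coker_tf_pi v <->
  exists a : O, a != 0 /\ exists x, a *: (u - v - f x) = 0.
Proof.
have tfE x : tf_map f (quotmod_pi (tors U) x) = quotmod_pi (tors V) (f x).
  exact: quot_mapE.
split=> [/quotmod_eq/asboolP[y]|[a [nza [x Ex]]]].
  have [x <-] := quotmod_surj (S := tors U) y.
  move=> /(etrans (esym (tfE x))); rewrite -raddfB => /esym/quotmod_eq/asboolP[a nza Ea].
  by exists a; split=> //; exists x.
apply/quotmod_eq/asboolP; exists (quotmod_pi (tors U) x).
apply: etrans (tfE x) _; rewrite -raddfB.
by apply/esym/quotmod_eq/asboolP; exists a.
Qed.
End CokernelTorsionFree.

Section SubquotientPi.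
Variables (R : pzRingType) (V : lmodType R) (Z B : submodClosed V).

Definition subquot_pi (v : V) (Zv : v \in Z) : subquot Z B :=
  quotmod_pi (in_sub Z B) (exist _ v Zv).

Lemma subquot_pi_surj x : exists v Zv, @subquot_pi v Zv = x.
Proof.
have [[v Zv] <-] := quotmod_surj (S := in_sub Z B) x.
by exists v, Zv.
Qed.

Lemma subquot_pi_linear a u v w Zu Zv Zw : w = a *: u + v ->
  @subquot_pi w Zw = a *: @subquot_pi u Zu + @subquot_pi v Zv.
Proof.
move=> E; rewrite /subquot_pi -linearP; congr (quotmod_pi _ _).
exact: val_inj.
Qed.

Lemma subquot_pi0 v Zv : @subquot_pi v Zv = 0 <-> v \in B.
Proof.
rewrite /subquot_pi -[X in _ = X](raddf0 (quotmod_pi (in_sub Z B))).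
by rewrite quotmod_eq subr0.
Qed.
End SubquotientPi.

Lemma subquot_map_pi (R : pzRingType) (U V : lmodType R) (f : {linear U -> V})
    (Z B : submodClosed U) (Z' B' : submodClosed V)
    (fZ : forall u, u \in Z -> f u \in Z') (fB : forall u, u \in B -> f u \in B')
    u (Zu : u \in Z) (Zfu : f u \in Z') :
  subquot_map fZ fB (subquot_pi B Zu) = subquot_pi B' Zfu.
Proof.
apply: etrans (quot_mapE _ _) _; congr (quotmod_pi _ _).
exact: val_inj.
Qed.

Section ExtPi.
Variables (O : idomainType) (A : comAlgType O) (lam : {rmorphism A -> O}).
Variables (F : free_resolution (residue lam)) (c : nat).

Section OneModule.
Variable X : lmodType A.

Definition cocycle (f : {ffun 'I_(fr_rank F c) -> X}) : Prop :=
  f \in cocycles (F := F) (i := c) (M := X).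

Definition ext_pi f (Zf : cocycle f) : ext_O F c X :=
  subquot_pi (Z := cocycles (F := F) (i := c) (M := X)) (coboundaries (F := F) (i := c) (M := X)) Zf.

Lemma ext_pi_surj (x : ext_O F c X) : exists f Zf, @ext_pi f Zf = x.
Proof.
exact: (subquot_pi_surj (Z := cocycles (F := F) (i := c) (M := X)) (B := coboundaries (F := F) (i := c) (M := X)) x).
Qed.

Lemma ext_pi_linear (a : O) u v w Zu Zv Zw : w = a%:A *: u + v ->
  @ext_pi w Zw = a *: @ext_pi u Zu + @ext_pi v Zv.
Proof. exact: subquot_pi_linear. Qed.

Lemma ext_pi0 f Zf : @ext_pi f Zf = 0 <-> f \in coboundaries (F := F) (i := c) (M := X).
Proof. exact: subquot_pi0. Qed.

End OneModule.

Lemma ext_map_pi (X Y : lmodType A) (g : {linear X -> Y}) f (Zf : cocycle f) (Zgf : cocycle (post_comp g f)) :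
  ext_map F c g (ext_pi Zf) = ext_pi Zgf.
Proof.
exact: subquot_map_pi.
Qed.
End ExtPi.


Section Presentation.
Variables (O : idomainType) (A : comAlgType O) (lam : {rmorphism A -> O}).
Variables (F : free_resolution (residue lam)) (c : nat) (M X : lmodType A).
Variables (q : {linear M -> X}) (W : M -> Prop).
Hypotheses (smW : is_submod W) (q0 : forall m, q m = 0 <-> W m).
Hypothesis q_surj : forall x, exists m, q m = x.
Local Notation C := (free_complex F).

Definition ext_O_map : {linear ext_O F c M -> ext_O F c X} :=
  restr_map (GRing.in_alg A) (ext_map F c q).

Lemma post_comp_surj n (f : {ffun 'I_n -> X}) : exists g, post_comp q g = f.
Proof.
have [r rK] := choice q_surj.
by exists (finfun (r \o f)); apply/ffunP=> k; rewrite !ffunE /= rK.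
Qed.

Lemma post_comp_eq0 n (f : {ffun 'I_n -> M}) : post_comp q f = 0 <-> all_in W f.
Proof.
split=> [/ffunP E k|Wf]; first by apply/q0; have := E k; rewrite !ffunE.
by apply/ffunP=> k; rewrite !ffunE; apply/q0.
Qed.

Lemma hom_map_post_comp m n (d : 'M[A]_(m, n)) (f : {ffun 'I_n -> M}) :
  hom_map d (post_comp q f) = post_comp q (hom_map d f).
Proof. by rewrite post_comp_hom. Qed.

Lemma post_comp_cocycle (f : {ffun 'I_(fr_rank F c) -> M}) :
  cocycle (post_comp q f) <-> all_in W (hom_map (cdf C c) f).
Proof.
rewrite -post_comp_eq0 -hom_map_post_comp.
by split=> [/eqP|E]; [| apply/eqP].
Qed.

Lemma post_comp_coboundary (f : {ffun 'I_(fr_rank F c) -> M}) :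
  post_comp q f \in coboundaries (F := F) (i := c) (M := X) <-> coboundary (C := C) W f.
Proof.
move: f; case: (c) => [|j] f /=.
  by rewrite -post_comp_eq0 inE; split=> [/eqP|->].
split=> [/asboolP[v]|[v]].
  have [g <-] := post_comp_surj v => E; exists g.
  by apply/post_comp_eq0; rewrite linearB /= -hom_map_post_comp -E subrr.
move=> /post_comp_eq0; rewrite linearB /= -hom_map_post_comp => /eqP.
rewrite subr_eq0 => /eqP E.
by apply/asboolP; exists (post_comp q v).
Qed.

(** Cochains with values in M which are cocycles modulo W represent the cocycles with
    values in X = M / W. *)
Definition mod_cocycle : Type :=
  {u : {ffun 'I_(fr_rank F c) -> M} | all_in W (hom_map (cdf C c) u)}.

Definition mod_cocycle_ext (u : mod_cocycle) : ext_O F c X :=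
  ext_pi ((post_comp_cocycle _).2 (svalP u)).

(** The element of the congruence module represented by a cocycle modulo W. *)
Definition psi (u : mod_cocycle) : coker (tf_map ext_O_map) :=
  coker_tf_pi ext_O_map (mod_cocycle_ext u).

Lemma psi_surj x : exists u, psi u = x.
Proof.
have [y <-] := coker_tf_pi_surj x.
have [f [Zf <-]] := ext_pi_surj y.
have [g Eg] := post_comp_surj f; subst f.
exists (exist _ g ((post_comp_cocycle _).1 Zf)).
congr (coker_tf_pi _ _); congr (ext_pi _); exact: Prop_irrelevance.
Qed.

Lemma psi_lin a u v : exists w, sval w = a%:A *: sval u + sval v /\ psi w = a *: psi u + psi v.
Proof.
have Zw : all_in W (hom_map (cdf C c) (a%:A *: sval u + sval v)).
  rewrite linearP; apply: (all_inD smW); last exact: (svalP v).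
  by apply: (all_inZ smW); exact: (svalP u).
exists (exist (fun w => all_in W (hom_map (cdf C c) w)) _ Zw); split=> //.
rewrite /psi -coker_tf_pi_linear; congr (coker_tf_pi _ _).
by apply: ext_pi_linear; rewrite linearP.
Qed.

(** The relations of the congruence module: classes that come from M, coboundaries, and
    torsion. *)
Lemma psi_eq u v : psi u = psi v <->
  exists a : O, a != 0 /\ exists z : {ffun 'I_(fr_rank F c) -> M},
    hom_map (cdf C c) z = 0 /\ coboundary (C := C) W (a%:A *: (sval u - sval v - z)).
Proof.
rewrite /psi coker_tf_pi_eq.
have key (a : O) z (Zz : cocycle z) :
    a *: (mod_cocycle_ext u - mod_cocycle_ext v - ext_O_map (ext_pi Zz)) = 0 <->
    coboundary (C := C) W (a%:A *: (sval u - sval v - z)).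
  have Zqz : cocycle (post_comp q z) by exact: ext_map_cocycles.
  have Zu := (post_comp_cocycle (sval u)).2 (svalP u).
  have Zv := (post_comp_cocycle (sval v)).2 (svalP v).
  have Zs : cocycle (post_comp q (sval u - sval v - z)).
    by rewrite !linearB /=; apply: rpredB => //; apply: rpredB.
  have Z0 : cocycle (0 : {ffun 'I_(fr_rank F c) -> X}) by exact: rpred0.
  have E0 : ext_pi Z0 = 0 by apply/ext_pi0; exact: rpred0.
  have Zas : cocycle (post_comp q (a%:A *: (sval u - sval v - z))).
    by rewrite linearZ; apply: rpredZ.
  rewrite -post_comp_coboundary -(ext_pi0 Zas).
  suff -> : ext_pi Zas = a *: (mod_cocycle_ext u - mod_cocycle_ext v - ext_O_map (ext_pi Zz)) by split.
  have Zuv : cocycle (post_comp q (sval u - sval v)) by rewrite linearB; apply: rpredB.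
  rewrite (@ext_pi_linear _ _ _ _ _ _ a _ _ _ Zs Z0 Zas); last by rewrite addr0 linearZ.
  rewrite E0 addr0; congr (_ *: _).
  have -> : ext_O_map (ext_pi Zz) = ext_pi Zqz by exact: ext_map_pi.
  have N1 : (-1)%:A = -1 :> A by rewrite scaleN1r.
  rewrite (@ext_pi_linear _ _ _ _ _ _ (-1) _ _ _ Zqz Zuv Zs); last first.
    by rewrite N1 scaleN1r linearB addrC.
  rewrite (@ext_pi_linear _ _ _ _ _ _ (-1) _ _ _ Zv Zu Zuv); last first.
    by rewrite N1 scaleN1r linearB addrC.
  have -> : mod_cocycle_ext u = ext_pi Zu by congr (ext_pi _); exact: Prop_irrelevance.
  have -> : mod_cocycle_ext v = ext_pi Zv by congr (ext_pi _); exact: Prop_irrelevance.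
  by rewrite !scaleN1r addrC [- _ + ext_pi Zu]addrC.
split=> -[a [nza]].
  case=> x; have [z [Zz <-]] := ext_pi_surj x => /key H.
  exists a; split=> //; exists z; split; last exact: H.
  by apply/eqP; exact: Zz.
case=> z [dz H]; have Zz : cocycle z by apply/eqP.
by exists a; split=> //; exists (ext_pi Zz); apply/key.
Qed.
End Presentation.

(** * Discrete valuation rings and the Koszul resolution of O *)

Section DiscreteValuationRing.
Variable O : idomainType.
Hypothesis hO : dvr O.

Lemma dvr_uniformizer : exists w : O, ~ invertible w /\
  forall x, ~ invertible x -> exists y, x = y * w.
Proof.
have [locO _ pidO] := hO; have [w Hw] := pidO _ locO.
exists w; split=> [|x nx].
  apply/asboolP; rewrite -[`[< _ >]]/(w \in nonunits O) Hw.
  apply/asboolP; exists 1, (fun=> 1), (fun=> w); split=> [_|]; first by rewrite inE.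
  by rewrite big_ord1 scale1r.
have : (x : O^o) \in nonunits O by apply/asboolP.
rewrite Hw => /asboolP[n [b [t [tw ->]]]]; exists (\sum_i b i).
rewrite mulr_suml; apply: eq_bigr => i _.
by have := tw i; rewrite inE => /eqP->.
Qed.

Lemma dvr_dvd_pow (t b : O) : ~ invertible t -> b != 0 -> exists n x, t ^+ n = x * b.
Proof.
have [w [nw wP]] := dvr_uniformizer; have [_ _ pidO] := hO.
move=> /wP[t' ->] nzb.
(* The ideal of the x with w ^ n * x in (b) for some n is generated by some d.  If d
   were a multiple of w, dividing it by w would stay in the ideal. *)
suff [n [x E]] : exists n x, w ^+ n = x * b.
  by exists n, (t' ^+ n * x); rewrite exprMn E mulrA.
pose I (x : O) := exists n y, w ^+ n * x = y * b.
have [|d Hd] := pidO [pred x : O^o | `[< I x >]].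
  split=> [|a x y /asboolP[n [z E]] /asboolP[m [v E']]]; apply/asboolP.
    by exists 0%N, 0; rewrite mulr0 mul0r.
  exists (n + m)%N, (w ^+ m * a * z + w ^+ n * v).
  have -> : a *: (x : O^o) = a * (x : O) by [].
  rewrite exprD mulrDr mulrDl -[w ^+ n * v * b]mulrA -E' -[_ * z * b]mulrA -E; ring.
have Id : I d.
  apply/asboolP; rewrite -[`[< _ >]]/(d \in [pred x : O^o | `[< I x >]]) Hd.
  apply/asboolP; exists 1, (fun=> 1), (fun=> d); split=> [_|]; first by rewrite inE.
  by rewrite big_ord1 scale1r.
have dE x : I x -> exists y, x = y * d.
  move=> Ix; have : x \in [pred x : O^o | `[< I x >]] by apply/asboolP.
  rewrite Hd => /asboolP[n [c [s [sd ->]]]]; exists (\sum_i c i).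
  rewrite mulr_suml; apply: eq_bigr => i _.
  by have := sd i; rewrite inE => /eqP->.
have [[d' dd']|nd] := pselect (invertible d).
  have [n [y E]] := Id; exists n, (y * d').
  by rewrite mulrAC -E -mulrA dd' mulr1.
have [d' Ed] := wP d nd.
have [|e Ee] := dE d'.
  have [n [y E]] := Id; exists n.+1, y.
  by rewrite -E Ed exprS; ring.
have /eqP : d' * (1 - e * w) = 0 by rewrite mulrBr mulr1 {1}Ee Ed; ring.
rewrite mulf_eq0 => /orP[/eqP d'0|/eqP E1]; last first.
  by case: nw; exists e; rewrite mulrC; apply/eqP; rewrite eq_sym -subr_eq0 E1.
have [|y Eb] := dE b; first by exists 0%N, 1.
by move: nzb; rewrite Eb Ed d'0 mul0r mulr0 eqxx.
Qed.
End DiscreteValuationRing.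

Section Augmentations.
Variables (O : idomainType) (A : comAlgType O) (lam : {rmorphism A -> O}).
Hypotheses (lamK : forall x : O, lam x%:A = x) (locA : local_ring A).

(** If lam y were a unit, so would be the scalar (lam y)%:A; but it is the difference of
    y and an element of the maximal ideal. *)
Lemma nonunit_lam y : y \in nonunits A -> ~ invertible (lam y).
Proof.
move=> ny [z lyz]; have [_ clA] := locA.
have nu : y - (lam y)%:A \in nonunits A.
  apply/asboolP => -[x Ex]; have := congr1 lam Ex.
  by rewrite rmorphM rmorphB /= lamK subrr mul0r rmorph1 => /esym/eqP; rewrite oner_eq0.
have : ((lam y)%:A : A^o) \in nonunits A.
  have -> : (lam y)%:A = (-1) *: (y - (lam y)%:A : A^o) + y.
    by rewrite scaleN1r opprB subrK.
  exact: clA.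
by move=> /asboolP; apply; exists z%:A; rewrite -scalerAl mul1r scalerA lyz scale1r.
Qed.

Variables (c : nat) (f : 'I_c -> A) (D : 'I_c -> A -> O).
Local Notation p := (augp lam).
Hypotheses (pf : forall i, p (f i)) (gen_f : locally_gen p (eq 0) (codom f)).
Hypotheses (derD : forall i, derivation lam (D i)).
Hypothesis Df : forall i j, D i (f j) = (i == j)%:R.
Hypothesis reg_f : locally_regular p (eq 0) (codom f).

(** The Koszul complex on f resolves A / (f), which agrees with O locally at p. *)
Lemma koszul_resolution : exists (K : complex A) (eps : 'cV[O]_(crk K 0))
    (top : 'rV[A]_(crk K c)) (Ds : nat -> A -> O), [/\
  resolution_up_to lam (fun s => ~ p s) eps, forall j, map_mx lam (cdf K j) = 0,
  forall v, exists a, v = a *: top, forall i, derivation lam (Ds i) &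
  map_mx lam top *m dprod Ds eps c = 1].
Proof.
(* Indices beyond c, which the top degree never meets, get the zero derivation. *)
pose Ds i : A -> O := if insub i is Some j then D j else fun=> 0.
have derDs i : derivation lam (Ds i).
  rewrite /Ds; case: insubP => [j _ _|_]; first exact: derD.
  by split=> a b; rewrite ?addr0 // !mulr0 addr0.
have prp := augp_prime lam; have idp := prime_is_ideal prp.
have Dsf i k : (k < size (codom f))%N -> (i <= 0 + k)%N ->
    Ds i (codom f)`_k = (i == 0 + k)%N%:R.
  rewrite size_codom card_ord !add0n => kc ik; have ic := leq_ltn_trans ik kc.
  rewrite /Ds insubT (nth_map (Ordinal ic)) -?cardE ?card_ord //.
  rewrite Df; congr (_%:R); congr (nat_of_bool _).
  by rewrite -val_eqE /= nth_enum_ord.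
have := @koszul_on_data O A lam Ds (unit_complex A) (eq 0) 0 (codom f)
    derDs (zero_ideal A) _ _ reg_f Dsf.
have -> : (0 + size (codom f) = c)%N by rewrite add0n size_codom card_ord.
case=> [_ <-|x /codomP[i ->]||beta [top [rK [spn _] dK]]].
- exact: ideal0.
- by [].
- exists 1, 1; split; first exact: unit_resolves.
    split=> [v|m m0 v].
      exists (v 0 0); rewrite scalemx1; exact: mx11_scalar.
    by case: m m0 v => [//|m] _ v; apply/rowP=> -[].
  by rewrite /= map_mx1 mulmx1.
set K := koszul_on _ _ in beta top rK spn dK.
have [cK [v0 Ev0] imK ex0 exK minK] := rK.
have min0 j : map_mx lam (cdf K j) = 0 by apply/matrixP=> a b; rewrite !mxE; exact: minK.
exists K, (map_mx lam beta), top, Ds; split=> //; split=> // [|v].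
  split=> //; first by rewrite min0 mul0mx.
  by exists v0; rewrite -map_mxM Ev0 map_mx1.
rewrite -map_mxM => /matrixP/(_ 0 0); rewrite mxE [RHS]mxE => pv.
have [s nps gs] := gen_f pv.
have [|t [w [npt E]]] := ex0 (s *: v); first by rewrite -scalemxAl mxE.
exists (t * s), w; split; first exact: prime_notM.
by rewrite -scalerA.
Qed.
End Augmentations.

(** * Invariance of the congruence module *)

Lemma quotmod_pi0 (R : pzRingType) (V : lmodType R) (S : submodClosed V) v :
  quotmod_pi S v = 0 <-> v \in S.
Proof. by rewrite -[X in _ = X](raddf0 (quotmod_pi S)) quotmod_eq subr0. Qed.

Lemma sval_inj (T : Type) (P : T -> Prop) (u v : {x : T | P x}) : sval u = sval v -> u = v.
Proof. by case: u v => [x p] [y q] /= E; apply: eq_exist. Qed.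

Section Surjection.
Variables (O : idomainType) (c : nat) (A B : comAlgType O).
Variables (lamA : {rmorphism A -> O}) (lamB : {rmorphism B -> O}).
Variable phi : {lrmorphism A -> B}.
Hypotheses (hO : dvr O) (hA : in_C lamA c) (hB : in_C lamB c).
Hypothesis phi_lam : forall a, lamB (phi a) = lamA a.
Hypothesis phi_surj : forall b, exists a, phi a = b.
Local Notation pA := (augp lamA).
Local Notation pB := (augp lamB).

Let lamKA := in_C_algebra hA.
Let lamKB := in_C_algebra hB.
Let prA := augp_prime lamA.

(** A maximal chain of the localisation of B, pulled back to A. *)
Lemma kernel_chain : exists C : nat -> A -> Prop,
  [/\ prime_chain c C, incl (C c) pA & forall a, phi a = 0 -> C 0 a].
Proof.
have [C [chC Cp]] := regular_loc_chain (in_C_regular hB).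
exists (fun i a => C i (phi a)); split.
- exact: pullback_chain.
- by move=> a /Cp; rewrite /augp phi_lam.
- by move=> a ->; apply: ideal0; apply: prime_is_ideal; apply: chC.1.
Qed.

Lemma chain_regular (xs : seq A) : size xs = c -> (forall x, x \in xs -> pA x) ->
  locally_gen pA (eq 0) xs ->
  (forall a, phi a = 0 -> exists2 s, ~ pA s & s * a = 0) /\ locally_regular pA (eq 0) xs.
Proof.
move=> szxs pxs genxs; have [C [chC Cp C0]] := kernel_chain.
rewrite -szxs in chC Cp.
have idC : is_ideal (C 0) by apply: prime_is_ideal; apply: chC.1.
have [|locC regxs] :=
  prime_chain_regular (in_C_noetherian hA) prA (zero_ideal A) chC Cp _ pxs genxs.
  by move=> _ <-; apply: ideal0.
by split=> // a /C0/locC[s nps E]; exists s.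
Qed.

(** The pulled back chain starts at 0 locally and contains the kernel. *)
Lemma kernel_torsion a : phi a = 0 -> exists2 s, ~ pA s & s * a = 0.
Proof.
have [g [pg gen_g]] := regular_loc_gen (in_C_regular hA).
have [|||torJ _] := @chain_regular (codom g); last exact: torJ.
- by rewrite size_codom card_ord.
- by move=> x /codomP[i ->].
- exact: gen_g.
Qed.

Lemma augmentation_coordinates : exists s (X : 'I_c -> A -> O), [/\ ~ pA s,
  forall i, derivation lamA (X i), forall i x, X i x%:A = 0 &
  forall a, pA a -> (forall i, X i a = 0) -> prod_ideal pA pA (s * a)].
Proof.
have [g [pg gen_g]] := regular_loc_gen (in_C_regular hA).
have [C [chC Cp _]] := kernel_chain.
have ind_g := prime_chain_independent (in_C_noetherian hA) prA chC Cp pg gen_g.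
have [s [X [nps derX _ XK kerX]]] :=
  cotangent_coordinates (in_C_noetherian hA) lamKA pg gen_g ind_g.
by exists s, X.
Qed.

Lemma koszul_of_augmentation : exists (K : complex A) (eps : 'cV[O]_(crk K 0))
    (top : 'rV[A]_(crk K c)) (Ds : nat -> A -> O), [/\
  resolution_up_to lamA (fun s => ~ pA s) eps, forall j, map_mx lamA (cdf K j) = 0,
  forall v, exists a, v = a *: top, forall i, derivation lamA (Ds i) &
  map_mx lamA top *m dprod Ds eps c = 1].
Proof.
have [g [pg gen_g]] := regular_loc_gen (in_C_regular hA).
have [C [chC Cp _]] := kernel_chain.
have ind_g := prime_chain_independent (in_C_noetherian hA) prA chC Cp pg gen_g.
have [f [D [pf gen_f derD Df]]] :=
  dual_derivations hO (in_C_noetherian hA) lamKA pg gen_g ind_g.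
have [|||_ reg_f] := @chain_regular (codom f).
- by rewrite size_codom card_ord.
- by move=> x /codomP[i ->].
- exact: gen_f.
exact: koszul_resolution pf gen_f derD Df reg_f.
Qed.

Variables (FA : free_resolution (residue lamA)) (FB : free_resolution (residue lamB)).
Variable M : lmodType B.
Hypothesis hdepth : depth_ge M c.
Local Notation MA := (restr phi M : lmodType A).
Local Notation W := (@augM O B lamB M).
Local Notation CA := (free_complex FA).
Local Notation CB := (map_complex phi (free_complex FA)).
Local Notation D := (free_complex FB).
Local Notation eC := (free_eps FA : 'cV[O]_(crk (map_complex phi (free_complex FA)) 0)).
Local Notation eD := (free_eps FB : 'cV[O]_(crk (free_complex FB) 0)).
Local Notation notpB := (fun s => ~ pB s).

Let smW : is_submod W. Proof. exact: augM_submod. Qed.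

(** Cochains over A with values in a B-module are cochains over B on the base change of
    the complex. *)
Lemma hom_map_restr m n (d : 'M[A]_(m, n)) (f : {ffun 'I_n -> M}) :
  (hom_map d (f : {ffun 'I_n -> MA}) : {ffun 'I_m -> M}) = hom_map (map_mx phi d) f.
Proof. by apply/ffunP=> i; rewrite !ffunE; apply: eq_bigr => j _; rewrite mxE. Qed.

Lemma augM_restr (m : M) : @augM O A lamA MA m <-> W m.
Proof.
split.
  apply: (@smul_sub A MA _ _ W) => [|a v]; last first.
    by rewrite inE => /eqP la _; apply: augM_mem; rewrite phi_lam.
  split; [exact: (submod0 smW) | exact: (submodD smW) | move=> a v].
  exact: (submodZ smW).
have smA := augM_submod lamA MA.
apply: (@smul_sub B M _ _ (@augM O A lamA MA)) => [|b v].
  split; [exact: (submod0 smA) | exact: (submodD smA) | move=> b v].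
  by have [a <-] := phi_surj b; exact: (submodZ smA).
rewrite inE => /eqP lb _; have [a Ea] := phi_surj b; rewrite -Ea.
by apply: (augM_mem (M := MA)); rewrite -phi_lam Ea.
Qed.

Lemma coboundary_restr i (g : {ffun 'I_(crk CB i) -> M}) :
  coboundary (C := CA) (@augM O A lamA MA) g <-> coboundary (C := CB) W g.
Proof.
case: i g => [|i] g /=; first by split=> H k; apply/augM_restr; apply: H.
split=> -[v H]; exists v => k; apply/augM_restr; move: (H k);
  by rewrite -hom_map_restr.
Qed.

(** Modulo p M, elements of B act through O. *)
Lemma coboundary_scalar (C : complex B) i (g : {ffun 'I_(crk C i) -> M}) t :
  coboundary (C := C) W (t *: g) -> coboundary (C := C) W ((lamB t)%:A *: g).
Proof.
move=> H; rewrite -[(lamB t)%:A](subrK t) addrC scalerDl; apply: coboundaryD => //.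
by apply: coboundary_in => //; apply: augM_all; rewrite rmorphB /= lamKB subrr.
Qed.

Lemma coboundary_hom (C C' : complex B) (t : forall i, 'M[B]_(crk C i, crk C' i)) i
    (g : {ffun 'I_(crk C' i) -> M}) : chain_map t ->
  coboundary (C := C') W g -> coboundary (C := C) W (hom_map (t i) g).
Proof.
move=> tP; case: i g => [|i] g /=; first exact: all_in_hom.
move=> [v Wv]; exists (hom_map (t i) v).
by rewrite -hom_mapM tP hom_mapM -linearB; apply: all_in_hom.
Qed.

Let resFA := free_resolutionP FA.
Let resFB := free_resolutionP FB.

Let one_notp (A' : comAlgType O) (lam : {rmorphism A' -> O}) s : 1 = s -> ~ augp lam s.
Proof. by move=> <-; exact: prime1 (augp_prime lam). Qed.

Let resC : resolution_up_to lamB notpB eC.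
Proof.
apply: (map_resolution phi_lam phi_surj kernel_torsion).
exact: (resolution_up_to_sub (one_notp (lam := lamA)) resFA).
Qed.

Let resD : resolution_up_to lamB notpB eD.
Proof. exact: (resolution_up_to_sub (one_notp (lam := lamB)) resFB). Qed.

Lemma comparison_map : exists tau : forall i, 'M[B]_(crk CB i, crk D i),
  chain_map tau /\ map_mx lamB (tau 0) *m eD = eC.
Proof.
apply: (lift_augmentation lamKB _ resFB).
by case: resC.
Qed.

Variable tau : forall i, 'M[B]_(crk CB i, crk D i).
Hypotheses (tauP : chain_map tau) (tau_eps : map_mx lamB (tau 0) *m eD = eC).

(** This is the step that uses the depth of M. *)
Lemma depth_surjective (z : {ffun 'I_(crk CB c) -> M}) : hom_map (cdf CB c) z = 0 ->
  exists z' : {ffun 'I_(crk D c) -> M}, hom_map (cdf D c) z' = 0 /\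
    coboundary (C := CB) (eq 0) (z - hom_map (tau c) z').
Proof.
have [[cC dC [v0 Ev0]] _ _] := resC.
have [[cD dD _] ex0D exD] := resFB.
case: hdepth => [M0 dz|[s [cs snon [regs _]]]].
  exists 0; split; first by rewrite linear0.
  rewrite linear0 subr0; case: (c) z {dz} => [|j] z /=; first by move=> k; apply/esym/M0.
  by exists 0 => k; apply/esym/M0.
apply: (comparison_depth (tau := tau) cC cD tauP regs cs exD).
- move=> y; pose a := (map_mx lamB y *m eD) 0 0.
  have [|_ [w [<- E]]] := ex0D (y - a%:A *: (v0 *m tau 0)).
    rewrite map_mxB map_mxZ lamKB map_mxM mulmxBl -scalemxAl -mulmxA tau_eps Ev0.
    by rewrite -[1]/(1%:M) scalemx1 /a -mx11_scalar subrr.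
  exists (a%:A *: v0), w; rewrite -E scale1r -scalemxAl addrC subrK.
  by [].
- move=> x [y Ey].
  have [|_ [w [<-]]] := map_exact0 phi_lam phi_surj resFA (v := x).
    rewrite -tau_eps mulmxA -map_mxM Ey map_mxM -mulmxA.
    by rewrite -[map_mx lamB (cdf D 0) *m _]/(map_mx lamB (cdf D 0) *m eD) dD mulmx0.
  by rewrite rmorph1 scale1r => ->; exists w.
- move=> y /snon ny i; apply: (map_resolution_nonunit phi_lam phi_surj kernel_torsion resFA).
  move=> b /eqP nzb.
  have [n [x E]] := dvr_dvd_pow hO (nonunit_lam lamKB (in_C_local hB) ny) nzb.
  by exists n, x%:A; rewrite rmorphXn E rmorphM lamKB.
Qed.
Variables (K : complex B) (eK : 'cV[O]_(crk K 0)) (rho : forall i, 'M[B]_(crk K i, crk CB i)).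
Hypotheses (rhoP : chain_map rho) (rho_eps : map_mx lamB (rho 0) *m eC = eK).
Hypothesis resK : resolution_up_to lamB notpB eK.
Hypothesis minK : forall j, map_mx lamB (cdf K j) = 0.
Variable top : 'rV[B]_(crk K c).
Hypothesis spn : forall v, exists a, v = a *: top.
Variable Ds : nat -> B -> O.
Hypotheses (derD : forall i, derivation lamB (Ds i)).
Hypothesis topK : map_mx lamB top *m dprod Ds eK c = 1.

(** A relation on D is carried to one on C by tau.  Conversely, depth_surjective
    replaces the cocycle z by one that comes from D, and comparison_injective removes
    tau. *)
Lemma relation_comparison (u : {ffun 'I_(crk D c) -> M}) :
  all_in W (hom_map (cdf D c) u) ->
  (exists a : O, a != 0 /\ exists z : {ffun 'I_(crk CB c) -> M},
     hom_map (cdf CB c) z = 0 /\ coboundary (C := CB) W (a%:A *: (hom_map (tau c) u - z))) <->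
  (exists a : O, a != 0 /\ exists z : {ffun 'I_(crk D c) -> M},
     hom_map (cdf D c) z = 0 /\ coboundary (C := D) W (a%:A *: (u - z))).
Proof.
move=> Wdu; split=> -[a [nza [z [dz cob]]]]; last first.
  exists a; split=> //; exists (hom_map (tau c) z); split.
    by rewrite -hom_mapM tauP hom_mapM dz linear0.
  by rewrite -linearB -linearZ; apply: (coboundary_hom (i := c) tauP).
have [z' [dz' cobz]] := depth_surjective dz.
have cob' : coboundary (C := CB) W (a%:A *: hom_map (tau c) (u - z')).
  have -> : a%:A *: hom_map (tau c) (u - z') =
      a%:A *: (hom_map (tau c) u - z) + a%:A *: (z - hom_map (tau c) z').
    by rewrite -scalerDr linearB /= addrA subrK.
  apply: coboundaryD => //; apply: coboundaryZ => //.
  case: (c) (z - _) cobz {cob} => [|j] w /=.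
    by move=> w0 k; rewrite -w0; apply: submod0 smW.
  by move=> [v w0]; exists v => k; rewrite -w0; apply: submod0 smW.
have npa : ~ pB a%:A by rewrite /augp lamKB; apply/eqP.
have [|t npt] := comparison_injective lamKB tauP tau_eps rhoP rho_eps resD resK minK spn npa _ cob'.
  by rewrite linearB /= dz' subr0.
move=> /coboundary_scalar cobt.
exists (lamB t); split; first by apply/eqP.
by exists z'.
Qed.

Let qA0 m : mod_aug_pi lamA (m : MA) = 0 <-> @augM O A lamA MA m.
Proof. exact: (quotmod_pi0 (smul (aug_ideal lamA) (@predT MA))). Qed.

Let qB0 m : mod_aug_pi lamB (m : M) = 0 <-> W m.
Proof. exact: (quotmod_pi0 (smul (aug_ideal lamB) (@predT M))). Qed.

Let qA_surj x : exists m, mod_aug_pi lamA (m : MA) = x.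
Proof. exact: (quotmod_surj (S := smul (aug_ideal lamA) (@predT MA)) x). Qed.

Let qB_surj x : exists m, mod_aug_pi lamB (m : M) = x.
Proof. exact: (quotmod_surj (S := smul (aug_ideal lamB) (@predT M)) x). Qed.

Let push_cocycle (u : {ffun 'I_(crk D c) -> M}) : all_in W (hom_map (cdf D c) u) ->
  all_in (@augM O A lamA MA) (hom_map (cdf CA c) (hom_map (tau c) u : {ffun 'I_(crk CA c) -> MA})).
Proof.
move=> Wdu k; apply/augM_restr; rewrite [hom_map (cdf CA c) _]hom_map_restr.
rewrite -[map_mx phi _]/(cdf CB c) -hom_mapM tauP hom_mapM.
exact: (all_in_hom smW).
Qed.

Let psiB (u : mod_cocycle FB c W) : Psi FB c M := psi (F := FB) (c := c) qB0 u.
Let psiA (u : mod_cocycle FA c (@augM O A lamA MA)) : Psi FA c MA := psi (F := FA) (c := c) qA0 u.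
Let push (u : mod_cocycle FB c W) : mod_cocycle FA c (@augM O A lamA MA) :=
  exist (fun v => all_in (@augM O A lamA MA) (hom_map (cdf CA c) v)) _ (push_cocycle (svalP u)).

Let scale_restr n (a : O) (f : {ffun 'I_n -> M}) :
  ((a%:A : A) *: (f : {ffun 'I_n -> MA}) : {ffun 'I_n -> M}) = (a%:A : B) *: f.
Proof.
apply/ffunP=> i; rewrite !ffunE -[LHS]/(phi a%:A *: f i).
by rewrite linearZ /= rmorph1.
Qed.

Let psiA_eq (u v : mod_cocycle FA c (@augM O A lamA MA)) : psiA u = psiA v <->
  exists a : O, a != 0 /\ exists z : {ffun 'I_(crk CB c) -> M},
    hom_map (cdf CB c) z = 0 /\
    coboundary (C := CB) W (a%:A *: ((sval u : {ffun 'I_(crk CB c) -> M}) - sval v - z)).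
Proof.
rewrite /psiA (psi_eq qA0 qA_surj).
split=> -[a [nza [z [dz cob]]]]; exists a; split=> //; exists z; split.
- by rewrite -[LHS]hom_map_restr.
- by move/coboundary_restr: cob; rewrite -scale_restr.
- by rewrite -[RHS]dz -[RHS]hom_map_restr.
- by apply/coboundary_restr; move: cob; rewrite -scale_restr.
Qed.

Lemma Psi_isomorphic : isomorphic (Psi FA c MA) (Psi FB c M).
Proof.
have smA := augM_submod lamA MA.
apply: (@isomorphic_of_presentations O (Psi FA c MA) (Psi FB c M) (mod_cocycle FB c W)
  (fun u => psiA (push u)) psiB).
- move=> x; have [v <-] := psi_surj qA0 qA_surj x.
  have Wdv : all_in W (hom_map (cdf CB c) (sval v : {ffun 'I_(crk CB c) -> M})).
    by move=> k; apply/augM_restr; rewrite -[hom_map _ _]hom_map_restr; apply: (svalP v).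
  have [u [Wdu [s nps cob]]] :=
    comparison_surjective lamKB tauP tau_eps rhoP rho_eps resC resD resK minK spn derD topK Wdv.
  exists (exist (fun v => all_in W (hom_map (cdf D c) v)) u Wdu); apply/psiA_eq.
  exists (lamB s); split; first by apply/eqP.
  exists 0; split; first by rewrite linear0.
  move/coboundary_scalar: cob => /(coboundaryZ smW (-1)); congr (coboundary _).
  rewrite subr0 /= scalerA mulrC -scalerA; congr (_ *: _).
  by rewrite scaleN1r opprB.
- by move=> x; have [v <-] := psi_surj qB0 qB_surj x; exists v.
- move=> u v; rewrite psiA_eq /psiB (psi_eq qB0 qB_surj) -relation_comparison.
    by rewrite linearB.
  by rewrite linearB; apply: (all_inB smW); [exact: (svalP u) | exact: (svalP v)].
- move=> a u v; have [w [Ew psiw]] := psi_lin smW qB0 a u v.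
  exists w; split; last exact: psiw.
  have [w' [Ew' psiw']] := psi_lin smA qA0 a (push u) (push v).
  rewrite -[RHS]psiw'; congr (psiA _); apply: sval_inj.
  rewrite /= Ew Ew' /= linearP.
  by congr (_ + _); exact: (esym (scale_restr a _)).
Qed.
End Surjection.

(** * Lengths of modules and of torsion submodules *)

Section ModuleLength.
Variable R : pzRingType.
Implicit Types U V : lmodType R.

Definition bounded_chains U : Prop :=
  exists l, forall k, has_chain (@submod_closed R U) k -> (k <= l)%N.

Lemma has_chain_pullback U V (h : U -> V) k : linear h ->
  (forall v, exists u, h u = v) ->
  has_chain (@submod_closed R V) k -> has_chain (@submod_closed R U) k.
Proof.
move=> hlin hsurj [C [smC sC]].
have h0 : h 0 = 0 by have := hlin (-1) 0 0; rewrite scaleN1r addNr scaleN1r addNr.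
exists (fun i => [pred u | h u \in C i] : {pred U}); split=> i ik.
  have [C0 Clin] := smC i ik; split; first by rewrite inE h0.
  by move=> a u v; rewrite !inE hlin => Cu Cv; apply: Clin.
have [sub [v Cv nCv]] := sC i ik; split=> [u|].
  by rewrite !inE => /sub.
by have [u Eu] := hsurj v; exists u; rewrite inE Eu.
Qed.

Lemma mlength_max_chain U : bounded_chains U -> max_chain (@submod_closed R U) (mlength U).
Proof.
move=> [l bl].
have ex0 : exists k, `[< has_chain (@submod_closed R U) k >].
  exists 0%N; apply/asboolP; exists (fun=> pred1 0 : {pred U}); split=> // i _.
  by split=> [|a u v]; rewrite !inE // => /eqP-> /eqP->; rewrite scaler0 addr0.
have bl' k : `[< has_chain (@submod_closed R U) k >] -> (k <= l)%N by move=> /asboolP/bl.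
apply: classical_sets.xgetPex.
case: (ex_maxnP ex0 bl') => m /asboolP chm maxm; exists m; split=> // k chk.
by apply: maxm; apply/asboolP.
Qed.

Lemma mlength_surjective U V (h : U -> V) : linear h ->
  (forall v, exists u, h u = v) -> bounded_chains U -> (mlength V <= mlength U)%N.
Proof.
move=> hlin hsurj bU; have [_ maxU] := mlength_max_chain bU.
have [|chV _] := @mlength_max_chain V.
  have [l bl] := bU; exists l => k chk; apply: bl.
  exact: has_chain_pullback chk.
by apply: maxU; apply: has_chain_pullback chV.
Qed.

Lemma mlength_isomorphic U V : isomorphic U V -> mlength U = mlength V.
Proof.
move=> [f [g fK gK]]; rewrite /mlength.
have E k : has_chain (@submod_closed R U) k <-> has_chain (@submod_closed R V) k.
  split; last first.
    by apply: (has_chain_pullback (h := f)) => [|v]; [exact: linearP | exists (g v)].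
  apply: (has_chain_pullback (h := g)) => [a u v|u]; last by exists (f u).
  by apply: (can_inj fK); rewrite linearP !gK.
congr (classical_sets.xget _ _); apply/funext=> n; apply/propext.
by split=> -[/E chn maxn]; split=> // k /E; apply: maxn.
Qed.
End ModuleLength.

Lemma nonunit_prime (O : idomainType) : dvr O -> is_prime (fun x : O => ~ invertible x).
Proof.
move=> [[n0 nD] _ _]; split.
- split=> [|x y nx ny|a x nx]; first by apply/asboolP; exact: n0.
    by apply/asboolP; have := nD 1 x y (asboolT nx) (asboolT ny); rewrite scale1r.
  apply/asboolP; have := nD a x 0 (asboolT nx) n0; by rewrite addr0.
- by apply; exists 1; rewrite mulr1.
- move=> x y nxy; have [[x' Ex]|] := pselect (invertible x); last by left.
  right=> -[y' Ey]; apply: nxy; exists (x' * y').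
  by rewrite mulrACA Ex Ey mulr1.
Qed.

Section TorsionLength.
Variables (O : idomainType) (V : lmodType O).
Hypothesis hO : dvr O.
Variables (n : nat) (vs : 'I_n -> V) (sigma : O).
Hypothesis genV : forall v, exists a : 'I_n -> O, v = \sum_i a i *: vs i.
Hypotheses (nzs : sigma != 0) (sigma_tors : forall v, v \in tors V -> sigma *: v = 0).

(** V / w ^ m V has finite length, where w is a uniformizer and sigma divides w ^ m, and
    the torsion submodule of V embeds in it. *)
Lemma torsion_bounded_chains : bounded_chains (submod (tors V)).
Proof.
have [w [nw wP]] := dvr_uniformizer hO.
have prP := nonunit_prime hO.
have [m [x Em]] := dvr_dvd_pow hO nw nzs.
pose N k (v : V) := exists u, v = w ^+ k *: u.
have smN k : is_submod (N k).
  split; first by exists 0; rewrite scaler0.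
    by move=> _ _ [u ->] [v ->]; exists (u + v); rewrite scalerDr.
  by move=> a _ [u ->]; exists (a *: u); rewrite !scalerA mulrC.
have colN k : finite_colength (fun y => ~ invertible y) (N k) (fun _ : V => True).
  elim: k => [|k IHk].
    exists 0%N, (fun=> 0%N); split=> // C C' smC smC' CC'; split=> // _ v _ _.
    exists 1, 0; split; [exact: (prime1 prP) | exact: (submod0 smC) |].
    by exists v; rewrite !scale1r subr0.
  apply: (finite_colength_trans prP) IHk.
  apply: (finite_colength_gen prP (vs := fun i => w ^+ k *: vs i)) => // [v [u ->]|q i /wP[y ->]].
    have [a ->] := genV u; exists a.
    suff -> : w ^+ k *: (\sum_i a i *: vs i) - \sum_i a i *: (w ^+ k *: vs i) = 0.
      exact: (submod0 (smN k.+1)).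
    rewrite scaler_sumr -sumrB big1 // => i _.
    by rewrite !scalerA mulrC subrr.
  by exists (y *: vs i); rewrite !scalerA exprS; congr (_ *: _); ring.
have [l [d [dl Hd]]] := colN m.
exists l => k [C [smC sC]].
pose C' i (v : V) := exists u : submod (tors V), u \in C i /\ val u = v.
have smC' i : (i <= k)%N -> is_submod (C' i).
  move=> ik; have [C0 Clin] := smC i ik; split.
  - by exists 0.
  - move=> _ _ [u [Cu <-]] [v [Cv <-]]; exists (u + v); split=> //.
    by rewrite -[u]scale1r; apply: Clin.
  - move=> a _ [u [Cu <-]]; exists (a *: u); split=> //.
    by rewrite -[_ *: _]addr0; apply: Clin.
(* The torsion meets sigma V in 0, since sigma * v can be torsion only if v is, and
   then sigma kills v; hence strict inclusions of torsion submodules stay strict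
   modulo w ^ m V. *)
have lt_d i : (i < k)%N -> (d (C' i) < d (C' i.+1))%N.
  move=> ik; have [sub [u Cu nCu]] := sC i ik.
  have [le_d eq_d] : (d (C' i) <= d (C' i.+1))%N /\ (d (C' i) = d (C' i.+1) -> forall v, C' i.+1 v -> True ->
       exists s c, [/\ ~ ~ invertible s, C' i c & N m (s *: v - c)]).
    apply: Hd; [apply: smC'; exact: ltnW|exact: smC'|].
    by move=> _ [v [Cv <-]]; exists v; split=> //; apply: sub.
  rewrite ltn_neqAle le_d andbT; apply/eqP => /eq_d/(_ (val u)) [||s [_ [ns [c [Cc <-]] [t Et]]]] //.
    by exists u.
  have [s' ss'] : invertible s by apply: contrapT.
  suff E : s *: u = c.
    move/negP: nCu; apply; have [C0 Clin] := smC i (ltnW ik).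
    have -> : u = s' *: c + 0 by rewrite -E scalerA mulrC ss' scale1r addr0.
    exact: Clin.
  apply: val_inj; apply/eqP; rewrite -subr_eq0; apply/eqP.
  have tsc : val (s *: u - c) \in tors V := valP _.
  have E1 : val (s *: u) - val c = sigma *: (x *: t).
    by rewrite scalerA mulrC -Em -Et linearZ.
  rewrite E1; apply: sigma_tors.
  move: tsc; rewrite linearB /= E1 => /asboolP[a nza Ea].
  by apply/asboolP; exists (a * sigma); rewrite ?mulf_neq0 // -scalerA.
have H i : (i <= k)%N -> (i <= d (C' i))%N.
  elim: i => [//|i IHi] ik; exact: leq_ltn_trans (IHi (ltnW ik)) (lt_d i ik).
exact: leq_trans (H k (leqnn k)) (dl _).
Qed.
End TorsionLength.

(** * The torsion of the cotangent module *)

Section Cotangent.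
Variables (O : idomainType) (A : comAlgType O) (lam : {rmorphism A -> O}).
Hypothesis lamK : forall x : O, lam x%:A = x.
Local Notation p := (augp lam).

Definition cotO : lmodType O := restr (GRing.in_alg A) (cotangent lam).

Definition aug_sq (a : A) : Prop := (a : A^o) \in smul (aug_ideal lam) (aug_ideal lam : {pred A^o}).

Lemma aug_sqE a : aug_sq a <-> prod_ideal p p a.
Proof.
have idp := prime_is_ideal (augp_prime lam); split.
  apply: (@smul_sub A A^o _ _ (prod_ideal p p)).
    by apply/ideal_submod; apply: prod_ideal_ideal.
  move=> x y; rewrite !inE => /eqP px /eqP py; exact: prod_ideal_mem.
have sm := @smul_submod A A^o (aug_ideal lam) (aug_ideal lam : {pred A^o}).
apply: (@prod_ideal_sub A p p aug_sq); first exact/ideal_submod.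
by move=> x y px py; apply: smul_mem; rewrite inE; apply/eqP.
Qed.

Lemma aug_sub_in a : (a - (lam a)%:A : A^o) \in aug_ideal lam.
Proof. by rewrite inE rmorphB /= lamK subrr. Qed.

(** The universal derivation a |-> a - lam a modulo p ^ 2. *)
Definition dcot (a : A) : cotO :=
  subquot_pi (smul (aug_ideal lam) (aug_ideal lam : {pred A^o})) (aug_sub_in a).

Lemma dcot_linear x a b : dcot (x%:A * a + b) = x *: dcot a + dcot b.
Proof.
apply: subquot_pi_linear; rewrite rmorphD rmorphM lamK scalerDl.
have -> : (x * lam a)%:A = x%:A * (lam a)%:A :> A by rewrite -scalerAl mul1r scalerA.
by rewrite -[_ *: (_ : A^o)]/(x%:A * (a - (lam a)%:A)); ring.
Qed.

Lemma dcot0 a : p a -> dcot a = 0 <-> aug_sq a.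
Proof.
move=> pa; have : dcot a = 0 <-> aug_sq (a - (lam a)%:A) by exact: subquot_pi0.
by rewrite pa scale0r subr0.
Qed.

Lemma dcotD a b : dcot (a + b) = dcot a + dcot b.
Proof. by have := dcot_linear 1 a b; rewrite !scale1r mul1r. Qed.

Lemma dcotB a b : dcot (a - b) = dcot a - dcot b.
Proof.
have := dcot_linear (-1) b a; rewrite !scaleN1r mulN1r addrC => ->.
by rewrite addrC.
Qed.

Lemma dcotZ x a : dcot (x%:A * a) = x *: dcot a.
Proof.
have d0 : dcot 0 = 0 by have := dcotB 0 0; rewrite !subrr.
by rewrite -[_ * a]addr0 dcot_linear d0 addr0.
Qed.

Lemma dcotM a b : p a -> dcot (b * a) = lam b *: dcot a.
Proof.
move=> pa; rewrite -dcotZ; apply/eqP; rewrite -subr_eq0 -dcotB -mulrBl; apply/eqP.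
apply/dcot0; first by rewrite /augp rmorphM pa mulr0.
apply/aug_sqE; apply: prod_ideal_mem => //; exact: augp_sub.
Qed.

Lemma dcot_surj v : exists a, p a /\ dcot a = v.
Proof.
have [a [pa <-]] := subquot_pi_surj (Z := aug_ideal lam)
  (B := smul (aug_ideal lam) (aug_ideal lam : {pred A^o})) v.
have la : lam a = 0 by move: (pa); rewrite inE => /eqP.
exists a; split=> //; congr (quotmod_pi _ _); apply: val_inj => /=.
by rewrite la scale0r subr0.
Qed.

Lemma dcot_sum n (b a : 'I_n -> A) : (forall i, p (a i)) ->
  dcot (\sum_i b i * a i) = \sum_i lam (b i) *: dcot (a i).
Proof.
move=> pa; elim/big_rec2: _ => [|i x y _ <-]; first by have := dcotB 0 0; rewrite !subrr.
by rewrite dcotD dcotM.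
Qed.

Variables (c : nat) (s : A) (X : 'I_c -> A -> O).
Hypotheses (hO : dvr O) (noethA : noetherian A) (nps : ~ p s).
Hypotheses (derX : forall i, derivation lam (X i)) (XK : forall i x, X i x%:A = 0).
Hypothesis kerX : forall a, p a -> (forall i, X i a = 0) -> prod_ideal p p (s * a).

(** Torsion elements of p / p ^ 2 have vanishing coordinates, hence are killed by lam s.
    *)
Lemma Phi_bounded_chains : bounded_chains (Phi lam).
Proof.
have idp := prime_is_ideal (augp_prime lam).
have [n [g [pg geng]]] := noetherian_fg noethA idp.
apply: (torsion_bounded_chains hO (V := cotO) (vs := fun i => dcot (g i)) (sigma := lam s)).
- move=> v; have [a [pa <-]] := dcot_surj v; have [b ->] := geng a pa.
  by exists (fun i => lam (b i)); rewrite dcot_sum.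
- exact/eqP.
move=> v /asboolP[x nzx]; have [a [pa <-]] := dcot_surj v; rewrite -dcotZ => /dcot0.
rewrite {1}/augp rmorphM pa mulr0 => /(_ erefl)/aug_sqE xa.
rewrite -dcotM //; apply/dcot0; first by rewrite /augp rmorphM pa mulr0.
apply/aug_sqE; apply: kerX => // i.
have [XD XM] := derX i.
have X0 : X i 0 = 0 by rewrite (derivation0 (derX i)).
have /eqP : X i (x%:A * a) = 0.
  elim: xa => [//|u v' y pu pv _ IH].
  by rewrite XD XM pu pv IH !mul0r !addr0.
rewrite XM XK mulr0 addr0 lamK mulf_eq0 (negbTE nzx) => /eqP.
by [].
Qed.
End Cotangent.

Section PhiMap.
Variables (O : idomainType) (A B : comAlgType O).
Variables (lamA : {rmorphism A -> O}) (lamB : {rmorphism B -> O}).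
Variable phi : {lrmorphism A -> B}.
Hypotheses (lamKA : forall x : O, lamA x%:A = x) (lamKB : forall x : O, lamB x%:A = x).
Hypotheses (phi_lam : forall a, lamB (phi a) = lamA a).
Hypothesis phi_surj : forall b, exists a, phi a = b.
Hypothesis torJ : forall a, phi a = 0 -> exists2 s, ~ augp lamA s & s * a = 0.

Lemma phi_aug_sq a : aug_sq lamA a -> aug_sq lamB (phi a).
Proof.
move/aug_sqE=> sq; apply/aug_sqE; elim: sq => [|x y z px py _ IH].
  by rewrite rmorph0; constructor.
by rewrite rmorphD rmorphM; constructor; rewrite // /augp phi_lam.
Qed.

Lemma aug_sq_lift b : aug_sq lamB b -> exists a, aug_sq lamA a /\ phi a = b.
Proof.
move/aug_sqE=> sq; suff [a [sqa Ea]] : exists a, prod_ideal (augp lamA) (augp lamA) a /\ phi a = b.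
  by exists a; split=> //; apply/aug_sqE.
elim: sq => [|x y z px py _ [a [sqa <-]]]; first by exists 0; split; [constructor | rewrite rmorph0].
have [x' Ex] := phi_surj x; have [y' Ey] := phi_surj y.
exists (x' * y' + a); split; last by rewrite rmorphD rmorphM /= Ex Ey.
by constructor; rewrite // /augp -phi_lam ?Ex ?Ey.
Qed.

(** The map induced by phi on torsion is surjective: if a multiple of the class of phi a
    vanishes, the corresponding multiple of a lies in p_A ^ 2 up to the kernel of phi,
    which is torsion. *)
Lemma Phi_map : exists h : Phi lamA -> Phi lamB, linear h /\ forall y, exists x, h x = y.
Proof.
have /choice[r rP] := dcot_surj lamKA.
pose h (v : cotO lamA) : cotO lamB := dcot lamKB (phi (r v)).
have phip a : augp lamA a -> augp lamB (phi a) by rewrite /augp phi_lam.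
have hE a : augp lamA a -> h (dcot lamKA a) = dcot lamKB (phi a).
  move=> pa; have [pr Er] := rP (dcot lamKA a).
  have pb : augp lamA (r (dcot lamKA a) - a) by rewrite /augp rmorphB pr pa subrr.
  apply/eqP; rewrite -subr_eq0 -dcotB -rmorphB; apply/eqP.
  apply/dcot0; first exact: phip.
  by apply: phi_aug_sq; apply/(dcot0 lamKA pb); rewrite dcotB Er subrr.
have h_lin : linear h.
  move=> x u v; have [pu Eu] := rP u; have [pv Ev] := rP v.
  have pw : augp lamA (x%:A * r u + r v).
    by rewrite /augp rmorphD rmorphM pu pv mulr0 addr0.
  have -> : x *: u + v = dcot lamKA (x%:A * r u + r v) by rewrite dcot_linear Eu Ev.
  by rewrite hE // rmorphD rmorphM /= linearZ /= rmorph1 dcot_linear.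
have h0 : h 0 = 0 by have := h_lin (-1) 0 0; rewrite scaleN1r addNr scaleN1r addNr.
have hZ x u : h (x *: u) = x *: h u by have := h_lin x u 0; rewrite h0 !addr0.
have h_tors (u : Phi lamA) : h (val u) \in tors (cotO lamB).
  have /asboolP[x nzx E] := valP u.
  by apply/asboolP; exists x; rewrite // -hZ E h0.
pose hP (u : Phi lamA) : Phi lamB := exist _ (h (val u)) (h_tors u).
exists hP; split=> [x u v|[y ty]].
  by apply: val_inj => /=; rewrite -h_lin; congr h.
have [b [pb Eb]] := dcot_surj lamKB y; have [a Ea] := phi_surj b.
have pa : augp lamA a by rewrite /augp -phi_lam Ea.
have ta : dcot lamKA a \in tors (cotO lamA).
  have /asboolP[x nzx] := ty; rewrite -Eb -dcotZ => /dcot0 sqb.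
  have /aug_sq_lift[z [sqz Ez]] : aug_sq lamB (x%:A * b).
    by apply: sqb; rewrite /augp rmorphM pb mulr0.
  have [|t npt E] := torJ (a := x%:A * a - z).
    by rewrite rmorphB rmorphM /= linearZ /= rmorph1 Ea Ez subrr.
  apply/asboolP; exists (lamA t * x); first by rewrite mulf_neq0 //; apply/eqP.
  rewrite -scalerA -dcotZ -dcotM; last by rewrite /augp rmorphM pa mulr0.
  apply/dcot0; first by rewrite /augp !rmorphM pa !mulr0.
  have -> : t * (x%:A * a) = t * z by apply/eqP; rewrite -subr_eq0 -mulrBr E.
  have idsq := prod_ideal_ideal (augp lamA) (prime_is_ideal (augp_prime lamA)).
  by apply/aug_sqE; apply: (idealM idsq); apply/aug_sqE.
exists (exist _ (dcot lamKA a) ta); apply: val_inj => /=.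
by rewrite hE // Ea.
Qed.
End PhiMap.

(** * The local rank *)

Lemma has_basis_semilinear (K K' : pzRingType) (V : lmodType K) (V' : lmodType K')
    (sg : K -> K') (h : V -> V') n :
  sg 0 = 0 -> injective sg -> (forall b, exists a, sg a = b) ->
  (forall u v, h (u + v) = h u + h v) -> (forall a v, h (a *: v) = sg a *: h v) ->
  injective h -> (forall v', exists v, h v = v') ->
  has_basis V n <-> has_basis V' n.
Proof.
move=> sg0 sgI sgS hD hZ hI hS.
have h0 : h 0 = 0 by apply: (addrI (h 0)); rewrite -hD !addr0.
have hsum (a : 'I_n -> K) (e : 'I_n -> V) :
    h (\sum_i a i *: e i) = \sum_i sg (a i) *: h (e i).
  by elim/big_rec2: _ => // i x y _ <-; rewrite hD hZ.
split=> -[e [span_e free_e]].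
  exists (fun i => h (e i)); split=> [v'|b].
    have [v <-] := hS v'; have [a ->] := span_e v.
    by exists (fun i => sg (a i)); rewrite hsum.
  have [a Ea] := choice (fun i => sgS (b i)).
  have -> : b = (fun i => sg (a i)) by apply/funext=> i; rewrite Ea.
  by rewrite -hsum -[RHS]h0 => /hI/free_e a0 i; rewrite a0.
have [r rK] := choice hS; have [t tK] := choice sgS.
exists (fun i => r (e i)); split=> [v|a].
  have [b Eb] := span_e (h v); exists (fun i => t (b i)); apply: hI.
  by rewrite hsum Eb; apply: eq_bigr => i _; rewrite tK rK.
move=> /(congr1 h); rewrite hsum h0; under eq_bigr do rewrite rK.
by move=> /free_e a0 i; apply: sgI; rewrite a0 sg0.
Qed.

Section LocMap.
Variables (R R' : comPzRingType) (S : mulrClosed R) (S' : mulrClosed R').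
Variable f : R -> R'.
Hypotheses (fM : forall a b, f (a * b) = f a * f b).
Hypotheses (fS : forall s, s \in S -> f s \in S').
Hypothesis fS_surj : forall s', s' \in S' -> exists2 s, s \in S & f s = s'.

Definition den_map (s : dens S) : dens S' := exist _ (f (den s)) (fS (den_in s)).

Section OneModule.
Variables (M : lmodType R) (M' : lmodType R') (g : M -> M').
Hypotheses (gD : forall u v, g (u + v) = g u + g v).
Hypotheses (gZ : forall a v, g (a *: v) = f a *: g v).

Definition loc_map (x : loc S M) : loc S' M' :=
  lfrac (g (lrep x).1) (den_map (lrep x).2).

Lemma loc_mapE m s : loc_map (lfrac m s) = lfrac (g m) (den_map s).
Proof.
have [u Su E] := lrep_lfrac m s; apply/lfrac_eq; exists (f u); first exact: fS.
have := congr1 g E; rewrite !gZ => E'.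
exact: esym E'.
Qed.

Lemma loc_mapD x y : loc_map (x + y) = loc_map x + loc_map y.
Proof.
elim/locP: x => m s; elim/locP: y => n t.
rewrite lfracD !loc_mapE lfracD gD !gZ; apply/lfrac_eq; exists 1; first exact: rpred1.
congr (1 *: (_ *: _)).
exact: (esym (fM (den s) (den t))).
Qed.

Lemma loc_map_surj : (forall v', exists v, g v = v') -> forall x', exists x, loc_map x = x'.
Proof.
move=> gS; elim/locP=> m' s'; have [m <-] := gS m'.
have [s Ss Es] := fS_surj (den_in s').
exists (lfrac m (exist _ s Ss)); rewrite loc_mapE; apply/lfrac_eq; exists 1; first exact: rpred1.
congr (1 *: (_ *: _)); exact: esym Es.
Qed.

(** It suffices that denominators kill the kernel of g. *)
Lemma loc_map_inj : (forall v, g v = 0 -> exists2 w, w \in S & w *: v = 0) -> injective loc_map.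
Proof.
move=> gK; elim/locP=> m s; elim/locP=> n t.
rewrite !loc_mapE => /lfrac_eq[u' /fS_surj[u Su <-] E].
have gN v : g (- v) = - g v.
  have g0 : g 0 = 0 by apply: (addrI (g 0)); rewrite -gD !addr0.
  by apply/eqP; rewrite -addr_eq0 -gD addNr g0.
have [|w Sw Ew] := gK (u *: (den t *: m) - u *: (den s *: n)).
  by rewrite gD gN !gZ; apply/eqP; rewrite subr_eq0; apply/eqP.
apply/lfrac_eq; exists (w * u); first exact: rpredM.
by apply/eqP; rewrite -subr_eq0 -!scalerA -scalerBr Ew.
Qed.
End OneModule.

Lemma loc_mapZ (M : lmodType R) (M' : lmodType R') (g : M -> M') :
  (forall a v, g (a *: v) = f a *: g v) ->
  forall (a : loc_ring S) (x : loc S M),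
    loc_map g (a *: x) = (loc_map (M := R^o) (M' := R'^o) f a : loc_ring S') *: loc_map g x.
Proof.
move=> gZ; elim/locP=> a s; elim/locP=> m t.
have -> : (lfrac a s : loc_ring S) *: lfrac m t = lfrac ((a : R) *: m) (den_mul s t).
  exact: loc_scaleE.
rewrite (loc_mapE gZ m t) (loc_mapE (M := R^o) (M' := R'^o) (g := f)) //.
rewrite loc_mapE // gZ.
have -> : (lfrac (f a : R'^o) (den_map s) : loc_ring S') *: lfrac (g m) (den_map t) =
    lfrac ((f a : R') *: g m) (den_mul (den_map s) (den_map t)) by exact: loc_scaleE.
apply/lfrac_eq; exists 1; first exact: rpred1.
congr (1 *: (_ *: _)); exact: (esym (fM (den s) (den t))).
Qed.
End LocMap.

(** A semilinear bijection localises to one over the total rings of fractions. *)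
Lemma generic_rank_semilinear (R R' : comPzRingType) (N : lmodType R) (N' : lmodType R')
    (f : R -> R') (g : N -> N') :
  (forall a b, f (a + b) = f a + f b) -> (forall a b, f (a * b) = f a * f b) ->
  injective f -> (forall b, exists a, f a = b) ->
  (forall u v, g (u + v) = g u + g v) -> (forall a v, g (a *: v) = f a *: g v) ->
  injective g -> (forall v', exists v, g v = v') ->
  generic_rank N = generic_rank N'.
Proof.
move=> fD fM fI fS gD gZ gI gS.
have f0 : f 0 = 0 by apply: (addrI (f 0)); rewrite -fD !addr0.
have g0 : g 0 = 0 by apply: (addrI (g 0)); rewrite -gD !addr0.
have nzdf s : s \in @non_zero_divisors R -> f s \in @non_zero_divisors R'.
  move=> /asboolP Hs; apply/asboolP => y; have [x <-] := fS y.
  by rewrite -fM -f0 => /fI/Hs->.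
have nzdS s' : s' \in @non_zero_divisors R' -> exists2 s, s \in @non_zero_divisors R & f s = s'.
  have [s <-] := fS s' => /asboolP Hs; exists s => //; apply/asboolP => y sy.
  by apply: fI; rewrite f0; apply: Hs; rewrite -fM sy f0.
pose S : mulrClosed R := @non_zero_divisors R.
pose S' : mulrClosed R' := @non_zero_divisors R'.
have ker1 (W : lmodType R) (W' : lmodType R') (h : W -> W') : h 0 = 0 -> injective h ->
    forall v, h v = 0 -> exists2 w, w \in S & w *: v = 0.
  by move=> h0 hI v hv; exists 1; [exact: rpred1 | apply: hI; rewrite scale1r hv h0].
pose sg : loc_ring S -> loc_ring S' := loc_map nzdf (M := R^o) (M' := R'^o) f.
have sgD : forall x y, sg (x + y) = sg x + sg y by apply: loc_mapD.
rewrite /generic_rank; congr (classical_sets.xget _ _); apply/funext=> n; apply/propext.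
apply: (@has_basis_semilinear _ _ _ _ sg (loc_map nzdf g)).
- by apply: (addrI (sg 0)); rewrite -sgD !addr0.
- by apply: loc_map_inj => //; apply: ker1.
- by apply: loc_map_surj.
- exact: loc_mapD.
- exact: loc_mapZ.
- by apply: loc_map_inj => //; apply: ker1.
- by apply: loc_map_surj.
Qed.

Section LocalRank.
Variables (O : idomainType) (A B : comAlgType O).
Variables (lamA : {rmorphism A -> O}) (lamB : {rmorphism B -> O}).
Variable phi : {lrmorphism A -> B}.
Hypotheses (phi_lam : forall a, lamB (phi a) = lamA a).
Hypothesis phi_surj : forall b, exists a, phi a = b.
Hypothesis torJ : forall a, phi a = 0 -> exists2 s, ~ augp lamA s & s * a = 0.
Variable M : lmodType B.

(** The localisations of A and B at the augmentation ideals are isomorphic, compatibly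
    with their actions on the localisation of M. *)
Lemma local_rank_restr : local_rank lamA (restr phi M) = local_rank lamB M.
Proof.
pose S : mulrClosed A := aug_compl lamA; pose S' : mulrClosed B := aug_compl lamB.
have fS s : s \in S -> phi s \in S' by rewrite !inE phi_lam.
have fS_surj s' : s' \in S' -> exists2 s, s \in S & phi s = s'.
  by have [s <-] := phi_surj s'; rewrite inE phi_lam => ns; exists s; rewrite ?inE.
have phiM a b : phi (a * b) = phi a * phi b by rewrite rmorphM.
pose f : loc_ring S -> loc_ring S' := loc_map fS (M := A^o) (M' := B^o) phi.
pose g : loc S (restr phi M) -> loc S' M := loc_map fS (M := restr phi M) (M' := M) id.
have phiZ (a : A) (v : A^o) : (phi (a *: v) : B^o) = phi a *: (phi v : B^o) by exact: phiM.
have phiD (a b : A^o) : (phi (a + b) : B^o) = phi a + phi b by exact: rmorphD.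
have kerphi (v : A^o) : (phi v : B^o) = 0 -> exists2 w, w \in S & w *: v = 0.
  by move=> /torJ[w npw E]; exists w; [apply/aug_complP | exact: E].
apply: (@generic_rank_semilinear _ _ _ _ f g).
- exact: (loc_mapD phiM fS phiD phiZ).
- by move=> a b; apply: (loc_mapZ phiM fS phiZ).
- exact: (loc_map_inj fS_surj phiD phiZ kerphi).
- by apply: loc_map_surj.
- by apply: loc_mapD.
- by apply: (loc_mapZ phiM fS).
- apply: loc_map_inj => //.
  by move=> v v0; exists 1; [exact: rpred1 | rewrite scale1r].
- by apply: loc_map_surj => // v; exists v.
Qed.
End LocalRank.

(** * Congruence modules and Wiles defects along a surjection *)

Lemma map_dprod (O : idomainType) (A B : comAlgType O) (phi : {lrmorphism A -> B})
    (K : complex A) (D : nat -> A -> O) (D' : nat -> B -> O) (w0 : 'cV[O]_(crk K 0)) i :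
  (forall j a, D' j (phi a) = D j a) ->
  dprod (K := map_complex phi K) D' w0 i = dprod D w0 i.
Proof.
move=> DD; elim: i => [//|i IHi] /=; rewrite IHi; congr (_ *m _).
by apply/matrixP=> a b; rewrite !mxE DD.
Qed.

(** The Koszul complex and the dual derivations are constructed over A and transported
    to B, where all comparisons take place. *)
Lemma Psi_restr_isomorphic (O : idomainType) (c : nat) (A B : comAlgType O)
    (lamA : {rmorphism A -> O}) (lamB : {rmorphism B -> O}) (phi : {lrmorphism A -> B})
    (FA : free_resolution (residue lamA)) (FB : free_resolution (residue lamB))
    (M : lmodType B) :
  dvr O -> in_C lamA c -> in_C lamB c -> (forall a, lamB (phi a) = lamA a) ->
  (forall b, exists a, phi a = b) -> depth_ge M c ->
  isomorphic (Psi FA c (restr phi M)) (Psi FB c M).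
Proof.
move=> hO hA hB phi_lam phi_surj hdepth.
have torJ := kernel_torsion hA hB phi_lam phi_surj.
have [K [eK [top [Ds [resK minK spn derD topK]]]]] := koszul_of_augmentation hO hA hB phi_lam phi_surj.
have [tau [tauP tau_eps]] := comparison_map hA hB phi_lam phi_surj FA FB.
have augK := res_aug resK.
have [rho [rhoP rho_eps]] := lift_augmentation (in_C_algebra hA) augK (free_resolutionP FA).
have /choice[Ds' DsP] : forall i, exists D' : B -> O,
    derivation lamB D' /\ forall a, D' (phi a) = Ds i a.
  by move=> i; have [D' der DE] := derivation_descent phi_lam phi_surj (derD i) torJ; exists D'.
pose rhoB i : 'M_(crk (map_complex phi K) i, crk (map_complex phi (free_complex FA)) i) :=
  map_mx phi (rho i).
have rhoBP : chain_map rhoB by move=> i; rewrite /= -!map_mxM rhoP.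
have rhoB_eps : map_mx lamB (rhoB 0) *m free_eps FA = eK by rewrite (map_phi_lam phi_lam).
have resKB := map_resolution phi_lam phi_surj torJ resK.
have minKB j : map_mx lamB (cdf (map_complex phi K) j) = 0 by rewrite /= (map_phi_lam phi_lam).
have spnB (v : 'rV_(crk (map_complex phi K) c)) : exists b, v = b *: map_mx phi top.
  have [v' <-] := phi_surj_mx phi_surj v; have [a ->] := spn v'.
  by exists (phi a); rewrite map_mxZ.
have derB i : derivation lamB (Ds' i) by case: (DsP i).
apply: (Psi_isomorphic hO hA hB phi_lam phi_surj hdepth tauP tau_eps rhoBP rhoB_eps
  resKB minKB spnB derB).
by rewrite (map_dprod _ _ (fun j => (DsP j).2)) (map_phi_lam phi_lam).
Qed.

Theorem theorem5 (O : idomainType) (w : O) (c : nat) (A B : comAlgType O)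
  (lamA : {rmorphism A -> O}) (lamB : {rmorphism B -> O})
  (phi : {lrmorphism A -> B})
  (hO : dvr O) (hw : uniformizer w)
  (hA : in_C lamA c) (hB : in_C lamB c)
  (hphi_local : local_map phi)
  (hphi_lam : forall a, lamB (phi a) = lamA a)
  (hphi_surj : forall b, exists a, phi a = b)
  (FA : free_resolution (residue lamA)) (FB : free_resolution (residue lamB))
  (M : lmodType B) (hM : fin_gen_module M) (hdepth : depth_ge M c) :
  [/\ isomorphic (Psi FA c (restr phi M)) (Psi FB c M),
      wiles_defect FB c M <= wiles_defect FA c (restr phi M) &
      (0 < local_rank lamB M)%N ->
        (wiles_defect FA c (restr phi M) = wiles_defect FB c M <->
         mlength (Phi lamA) = mlength (Phi lamB))].
Proof.
have isoPsi := Psi_restr_isomorphic FA FB hO hA hB hphi_lam hphi_surj hdepth.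
have torJ := kernel_torsion hA hB hphi_lam hphi_surj.
have le_Phi : (mlength (Phi lamB) <= mlength (Phi lamA))%N.
  have [s [X [nps derX XK kerX]]] := augmentation_coordinates hA hB hphi_lam hphi_surj.
  have [h [h_lin h_surj]] :=
    Phi_map (in_C_algebra hA) (in_C_algebra hB) hphi_lam hphi_surj torJ.
  apply: (mlength_surjective h_lin h_surj).
  exact: (Phi_bounded_chains (in_C_algebra hA) hO (in_C_noetherian hA) nps derX XK kerX).
have eq_rank := local_rank_restr hphi_lam hphi_surj torJ M.
rewrite /wiles_defect eq_rank (mlength_isomorphic isoPsi).
split=> //.
  by rewrite Num.Theory.lerD2r -!PoszM lez_nat leq_mul2l le_Phi orbT.
move=> rank_gt0; split=> [/addIr/eqP|-> //].
by rewrite -!PoszM eqz_nat eqn_pmul2l // => /eqP.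
Qed.
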